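(* Let $\beta>2/3$ and let $B_\beta$ be the Blaschke product with simple zeros $n^\beta+i$, $n\in\mathbb{N}$. If $f\in K_{B_\beta}$ is nonzero, then $$\int_0^\infty\frac{\log|f(t)|}{t^{3/2}+1}\,dt>-\infty.$$
   Context: $H^2$ is the Hardy space of $\mathbb{C}^+$ and $K_B=H^2\ominus BH^2$. *)

(* Defs.v *)
(* Complex numbers are R[i] (mathcomp-real-closed)
   over an arbitrary R : realType; integrals are Lebesgue integrals. *)
From HB Require Import structures.
From mathcomp Require Import all_boot all_order all_algebra.
From mathcomp Require Import all_classical all_reals all_analysis.
From mathcomp Require Export complex.
Import Order.TTheory GRing.Theory Num.Theory.
Import numFieldNormedType.Exports.

Set Implicit Arguments.
Unset Strict Implicit.
Unset Printing Implicit Defensive.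

Local Open Scope ring_scope.
Local Open Scope complex_scope.
Local Open Scope classical_set_scope.

(* Topology / normed structure on R[i] (the generic numFieldType instances of
   mathcomp-analysis, instantiated on R[i]). *)
Section CInst.
Variable R : realType.
HB.instance Definition _ := PseudoPointedMetric.copy R[i] (R[i])^o.
HB.instance Definition _ := GRing.ComAlgebra.copy R[i] (R[i])^o.
HB.instance Definition _ := Vector.copy R[i] (R[i])^o.
HB.instance Definition _ := NormedModule.copy R[i] (R[i])^o.
End CInst.

Section Hardy.
Variable R : realType.

(* modulus |z| of a complex number, as a real number *)
Definition cmod (z : R[i]) : R := Num.sqrt (complex.Re z ^+ 2 + complex.Im z ^+ 2).

(* holomorphic on the upper half-plane C^+ = {complex.Im z > 0}: complex differentiable
   at every point of C^+ *)
Definition holomorphic_UHP (f : R[i] -> R[i]) : Prop :=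
  forall z : R[i], 0 < complex.Im z -> derivable f z (1 : R[i]).

(* \int_R |f(x+iy)|^2 dx *)
Definition line_L2 (f : R[i] -> R[i]) (y : R) : \bar R :=
  (\int[@lebesgue_measure R]_(x in setT) ((cmod (f (x +i* y))) ^+ 2)%:E)%E.

(* Hardy space H^2(C^+) *)
Definition H2 (f : R[i] -> R[i]) : Prop :=
  holomorphic_UHP f /\ exists M : R, forall y : R, 0 < y -> (line_L2 f y <= M%:E)%E.

(* fb is the boundary function of f: for a.e. real t, f(t+iy) -> fb(t) as y -> 0+ *)
Definition boundary_value (f : R[i] -> R[i]) (fb : R -> R[i]) : Prop :=
  {ae @lebesgue_measure R, forall t : R,
     f (t +i* y) @[y --> (0 : R)^'+] --> fb t}.

(* (Borel) measurability of a complex-valued function on R *)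
Definition cmeasurable (fb : R -> R[i]) : Prop :=
  measurable_fun setT (fun t => complex.Re (fb t)) /\ measurable_fun setT (fun t => complex.Im (fb t)).

(* L^2(R) inner product <fb, hb> = \int fb * conj hb equals 0
   (real and imaginary parts separately) *)
Definition L2_orth (fb hb : R -> R[i]) : Prop :=
  (\int[@lebesgue_measure R]_(t in setT) (complex.Re (fb t * (hb t)^*))%:E = 0)%E /\
  (\int[@lebesgue_measure R]_(t in setT) (complex.Im (fb t * (hb t)^*))%:E = 0)%E.

(* model space K_B = H^2 ⊖ B H^2 *)
Definition model_space (B : R[i] -> R[i]) (f : R[i] -> R[i]) : Prop :=
  H2 f /\
  forall fb : R -> R[i], boundary_value f fb -> cmeasurable fb ->
  forall (g : R[i] -> R[i]) (hb : R -> R[i]), H2 g ->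
    boundary_value (fun z => B z * g z) hb -> cmeasurable hb ->
    L2_orth fb hb.

(* zeros z_n = n^beta + i, n = 1, 2, ... *)
Definition bzero (beta : R) (n : nat) : R[i] := (n%:R `^ beta) +i* 1.

(* Blaschke factor in C^+ with the usual unimodular convergence factor
   |z_n^2+1|/(z_n^2+1) *)
Definition bfactor (a z : R[i]) : R[i] :=
  (cmod (a ^+ 2 + 1))%:C / (a ^+ 2 + 1) * ((z - a) / (z - a^*)).

(* B_beta(z) = prod_{n >= 1} bfactor (z_n) z, as the limit of partial products *)
Definition blaschke (beta : R) (z : R[i]) : R[i] :=
  limn (fun N : nat => \prod_(1 <= n < N.+1) bfactor (bzero beta n) z).

(* extended-real logarithm: log 0 = -oo *)
Definition elog (x : R) : \bar R := if x == 0 then -oo%E else (ln x)%:E.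

End Hardy.

(* Main.v *)
(** Let [a_n = n^beta + i], let [B_N] be the partial products of [B], and for real [t]
    let [fb(t)] be the boundary value of [f].  As [fb conj(B)] is orthogonal to the Cauchy
    kernels, Cauchy's formula gives
      [f_N(z) = (2 pi i)^-1 int fb(t) (1 - B_N(z) conj(B_N(t))) / (t - z) dt -> f(z)],
    and [f_N] is a polynomial divided by [prod (z - conj a_n)].

    Apply Jensen's inequality for the Poisson kernel [P] of [w_0 = u + i v], [u, v > 0], to the
    rational function [w |-> f_N(w^2 + i y)].  Each denominator [w^2 + i y - conj a_n] has one
    root [- s + i t] in the half-plane, which costs at most [2 v t / s^2 = O(n^(-3 beta / 2))];
    the sum is finite because [beta > 2/3].  Hence [int log|f_N(x^2 + i y)| P(x) dx] is bounded
    below by [log|f_N(w_0^2 + i y)| - C], uniformly in [N] and [y].  Let [N -> oo] and then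
    [y -> 0]; the [H^2] norm controls the positive part of the logarithm.  Under [t = x^2]
    the weight [P(x) dx] dominates a multiple of [dt / (1 + t^(3/2))]. *)
Require Import Defs.
From HB Require Import structures.
From mathcomp Require Import all_boot all_order all_algebra.
From mathcomp Require Import all_classical all_reals all_analysis.
From mathcomp Require Import measurable_realfun complex ring lra.
Import Order.TTheory GRing.Theory Num.Theory.
Import numFieldNormedType.Exports.
Local Open Scope ring_scope.
Local Open Scope complex_scope.
Local Open Scope classical_set_scope.

Set Implicit Arguments.
Unset Strict Implicit.
Unset Printing Implicit Defensive.

(** * Complex modulus and integrals on the line *)

Section ComplexModulus.
Variable R : realType.
Implicit Types (x y : R) (z w : R[i]).

Lemma cReD z w : complex.Re (z + w) = complex.Re z + complex.Re w.
Proof. by case: z; case: w. Qed.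

Lemma cImD z w : complex.Im (z + w) = complex.Im z + complex.Im w.
Proof. by case: z; case: w. Qed.

Lemma cReN z : complex.Re (- z) = - complex.Re z.
Proof. by case: z. Qed.

Lemma cImN z : complex.Im (- z) = - complex.Im z.
Proof. by case: z. Qed.

Lemma cReM z w :
  complex.Re (z * w) = complex.Re z * complex.Re w - complex.Im z * complex.Im w.
Proof. by case: z; case: w. Qed.

Lemma cImM z w :
  complex.Im (z * w) = complex.Re z * complex.Im w + complex.Im z * complex.Re w.
Proof. by case: z => a b; case: w => c d /=; rewrite addrC. Qed.

Lemma cReJ z : complex.Re z^* = complex.Re z.
Proof. by case: z. Qed.

Lemma cImJ z : complex.Im z^* = - complex.Im z.
Proof. by case: z. Qed.

Definition ReImE := (cReD, cImD, cReN, cImN, cReM, cImM, cReJ, cImJ).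

Lemma complex_eqP z w :
  complex.Re z = complex.Re w -> complex.Im z = complex.Im w -> z = w.
Proof. by case: z => a b; case: w => c d /= -> ->. Qed.

Lemma cReV z : complex.Re z^-1 = complex.Re z / (cmod z ^+ 2).
Proof.
case: z => a b; rewrite /cmod /= sqr_sqrtr //.
by rewrite addr_ge0 // sqr_ge0.
Qed.

Lemma cImV z : complex.Im z^-1 = - complex.Im z / (cmod z ^+ 2).
Proof.
case: z => a b; rewrite /cmod /= sqr_sqrtr ?mulNr //.
by rewrite addr_ge0 // sqr_ge0.
Qed.

Lemma cmod_normc z : cmod z = ComplexField.Normc.normc z.
Proof. by case: z. Qed.

Lemma cmodE z : `|z| = (cmod z)%:C.
Proof. by rewrite normc_def. Qed.

Lemma cmod_sqr z : cmod z ^+ 2 = complex.Re z ^+ 2 + complex.Im z ^+ 2.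
Proof. by rewrite sqr_sqrtr // addr_ge0 // sqr_ge0. Qed.

Lemma cmod_ge0 z : 0 <= cmod z.
Proof. exact: sqrtr_ge0. Qed.

Lemma cmodM z w : cmod (z * w) = cmod z * cmod w.
Proof. by rewrite !cmod_normc ComplexField.Normc.normcM. Qed.

Lemma cmodV z : cmod z^-1 = (cmod z)^-1.
Proof. by rewrite !cmod_normc ComplexField.Normc.normcV. Qed.

Lemma cmodN z : cmod (- z) = cmod z.
Proof. by rewrite /cmod !ReImE !sqrrN. Qed.

Lemma cmodJ z : cmod z^* = cmod z.
Proof. by rewrite /cmod !ReImE !sqrrN. Qed.

Lemma cmod_real x : cmod x%:C = `|x|.
Proof. by rewrite /cmod /= expr0n addr0 sqrtr_sqr. Qed.

Lemma cmod_vertical x y y' : cmod (x +i* y - x +i* y') = `|y - y'|.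
Proof. by rewrite /cmod /= subrr expr0n add0r sqrtr_sqr. Qed.

Lemma cmod0 : cmod (0 : R[i]) = 0.
Proof. by rewrite (_ : 0 = 0%:C) // cmod_real normr0. Qed.

Lemma cmod1 : cmod (1 : R[i]) = 1.
Proof. by rewrite (_ : 1 = 1%:C) // cmod_real normr1. Qed.

Lemma cmod_triangle z w : cmod (z + w) <= cmod z + cmod w.
Proof. by rewrite !cmod_normc; exact: le_normcD. Qed.

Lemma cmodBC z w : cmod (z - w) = cmod (w - z).
Proof. by rewrite -cmodN opprB. Qed.

Lemma cmod_triangleB z w : cmod (z - w) <= cmod z + cmod w.
Proof. by rewrite -(cmodN w) cmod_triangle. Qed.

Lemma cmod_sqr_sub z w : cmod (z - w) ^+ 2 <= 2 * (cmod z ^+ 2 + cmod w ^+ 2).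
Proof.
have : cmod (z - w) ^+ 2 <= (cmod z + cmod w) ^+ 2.
  by rewrite ler_pXn2r // ?nnegrE ?addr_ge0 ?cmod_ge0 // cmod_triangleB.
by have := sqr_ge0 (cmod z - cmod w); lra.
Qed.

Lemma cmod_mul_le z w : 2 * cmod (z * w) <= cmod z ^+ 2 + cmod w ^+ 2.
Proof. by rewrite cmodM; have := sqr_ge0 (cmod z - cmod w); lra. Qed.

Lemma cmod_eq0 z : (cmod z == 0) = (z == 0).
Proof.
apply/eqP/eqP => [|->]; last exact: cmod0.
by rewrite cmod_normc; exact: ComplexField.Normc.eq0_normc.
Qed.

Lemma cmod_gt0 z : (0 < cmod z) = (z != 0).
Proof. by rewrite lt_neqAle cmod_ge0 andbT eq_sym cmod_eq0. Qed.

Lemma Re_le_cmod z : `|complex.Re z| <= cmod z.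
Proof. by rewrite -sqrtr_sqr ler_wsqrtr // lerDl sqr_ge0. Qed.

Lemma Im_le_cmod z : `|complex.Im z| <= cmod z.
Proof. by rewrite -sqrtr_sqr ler_wsqrtr // lerDr sqr_ge0. Qed.

Lemma cmod_le_ReIm z : cmod z <= `|complex.Re z| + `|complex.Im z|.
Proof.
rewrite -(@ler_pXn2r _ 2) // ?nnegrE ?addr_ge0 // ?cmod_ge0 // cmod_sqr sqrrD.
by rewrite !real_normK ?num_real // -addrA lerD2l lerDr mulrn_wge0 // mulr_ge0.
Qed.

Lemma cmod_prod (I : Type) (r : seq I) (P : pred I) (F : I -> R[i]) :
  cmod (\prod_(i <- r | P i) F i) = \prod_(i <- r | P i) cmod (F i).
Proof. exact: (big_morph _ cmodM cmod1). Qed.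

Lemma le_cmodB z w : `|cmod z - cmod w| <= cmod (z - w).
Proof.
rewrite ler_norml; apply/andP; split.
  rewrite lerNl opprB lerBlDr cmodBC.
  by rewrite -{1}[w](subrK z) cmod_triangle.
by rewrite lerBlDr -{1}[z](subrK w) cmod_triangle.
Qed.

(* [z^*] elaborates to [Num.conj] or to [conjc] according to the open scopes. *)
Lemma Num_conjE z : Num.conj z = conjc z.
Proof. by []. Qed.

Lemma conjcB z w : conjc (z - w) = conjc z - conjc w.
Proof. exact: rmorphB. Qed.

Lemma conjcM z w : conjc (z * w) = conjc z * conjc w.
Proof. exact: rmorphM. Qed.

Lemma conjcV z : conjc z^-1 = (conjc z)^-1.
Proof. exact: conjc_inv. Qed.

End ComplexModulus.

(* Convergence in R[i] is stated in Defs.v through the complex-valued norm; these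
   lemmas translate it to the real modulus. *)
Section ComplexTopology.
Variable R : realType.

Lemma nbhs_cmodP (z : R[i]) (A : set R[i]) :
  nbhs z A <-> exists2 d : R, 0 < d & forall w, cmod (w - z) < d -> A w.
Proof.
split=> [/nbhs_ballP[e /= e0 he]|[d d0 hd]].
  have := e0; rewrite ltcE /= => /andP[/eqP ei er].
  exists (complex.Re e) => // w hw; apply: he.
  rewrite /ball /= /ball_ /= cmodE ltcE /= eq_sym ei eqxx /= cmodBC.
  by move: hw.
apply/nbhs_ballP; exists d%:C => /=; first by rewrite ltcR.
move=> w; rewrite /ball /= /ball_ /= cmodE ltcR cmodBC; exact: hd.
Qed.

Lemma cvg_cmodP (T : Type) (F : set_system T) (FF : Filter F) (f : T -> R[i]) (l : R[i]) :
  f x @[x --> F] --> l <-> cmod (f x - l) @[x --> F] --> (0 : R).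
Proof.
split=> [h|h].
  apply/cvgrPdist_lt => e e0.
  have /h : nbhs l [set w | cmod (w - l) < e] by apply/nbhs_cmodP; exists e.
  move=> hA; apply: (@filterS _ F FF _ _ _ hA) => x /=.
  by rewrite sub0r normrN ger0_norm ?cmod_ge0.
move=> A /nbhs_cmodP[d d0 hd].
move/cvgrPdist_lt: h => /(_ d d0); apply: filterS => x /=.
rewrite sub0r normrN ger0_norm ?cmod_ge0 // => /hd; exact.
Qed.

Lemma cvg_lipschitz_cmod (A : R[i] -> R) (T : Type) (F : set_system T) (FF : Filter F)
    (w : T -> R[i]) (l : R[i]) : (forall a b, `|A a - A b| <= cmod (a - b)) ->
  cmod (w x - l) @[x --> F] --> (0 : R) -> A (w x) @[x --> F] --> A l.
Proof.
move=> hA /cvgrPdist_lt h; apply/cvgrPdist_lt => e /h; apply: filterS => x.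
by rewrite sub0r normrN ger0_norm ?cmod_ge0 // distrC; exact: le_lt_trans.
Qed.

Lemma cvg_Re_cmod (T : Type) (F : set_system T) (FF : Filter F) (w : T -> R[i]) (l : R[i]) :
  cmod (w x - l) @[x --> F] --> (0 : R) ->
  complex.Re (w x) @[x --> F] --> complex.Re l.
Proof.
by apply: cvg_lipschitz_cmod => a b; rewrite -cReN -cReD; exact: Re_le_cmod.
Qed.

Lemma cvg_Im_cmod (T : Type) (F : set_system T) (FF : Filter F) (w : T -> R[i]) (l : R[i]) :
  cmod (w x - l) @[x --> F] --> (0 : R) ->
  complex.Im (w x) @[x --> F] --> complex.Im l.
Proof.
by apply: cvg_lipschitz_cmod => a b; rewrite -cImN -cImD; exact: Im_le_cmod.
Qed.

Lemma cvg_cmod_cmod (T : Type) (F : set_system T) (FF : Filter F) (w : T -> R[i]) (l : R[i]) :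
  cmod (w x - l) @[x --> F] --> (0 : R) -> cmod (w x) @[x --> F] --> cmod l.
Proof. by apply: cvg_lipschitz_cmod; exact: le_cmodB. Qed.

End ComplexTopology.

Section IntegralsOnTheLine.
Variable R : realType.
Notation mu := (@lebesgue_measure R).
Implicit Types (f g h : R -> R).

Definition L1 f := mu.-integrable [set: R] (EFin \o f).
Definition Int f : R := \int[mu]_(x in [set: R]) f x.

Lemma ae_mono (P Q : R -> Prop) : {ae mu, forall t, P t} ->
  (forall t, P t -> Q t) -> {ae mu, forall t, Q t}.
Proof.
move=> h1 h2; have h := @filterS _ _ (@ae_filter_ringOfSetsType _ _ _ mu).
by apply: h h1.
Qed.

Lemma ae_all (P : R -> Prop) : (forall t, P t) -> {ae mu, forall t, P t}.
Proof. by move=> h; apply: (@filterE _ _ (@ae_filter_ringOfSetsType _ _ _ mu)). Qed.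

Lemma L1_meas f : L1 f -> measurable_fun setT f.
Proof. by move=> /measurable_int/measurable_EFinP. Qed.

Lemma L1_le f g : measurable_fun setT f -> (forall x, `|f x| <= g x) ->
  L1 g -> L1 f.
Proof.
move=> mf fg ig; apply: (le_integrable _ _ _ ig) => //.
  exact/measurable_EFinP.
by move=> x _ /=; rewrite lee_fin (le_trans (fg x)) // ler_norm.
Qed.

Lemma L1_ext f g : f =1 g -> L1 f -> L1 g.
Proof. by move=> fg; rewrite (_ : g = f) //; apply/funext. Qed.

Lemma Int_ext f g : f =1 g -> Int f = Int g.
Proof. by move=> fg; rewrite (_ : g = f) //; apply/funext. Qed.

Lemma L10 : L1 (fun=> 0).
Proof. exact: integrable0. Qed.

Lemma L1D f g : L1 f -> L1 g -> L1 (fun x => f x + g x).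
Proof. by move=> hf hg; have := integrableD measurableT hf hg. Qed.

Lemma L1Z c f : L1 f -> L1 (fun x => c * f x).
Proof. by move=> hf; have := integrableZl measurableT c hf. Qed.

Lemma L1N f : L1 f -> L1 (fun x => - f x).
Proof. by move=> /(L1Z (-1)); apply: L1_ext => x; rewrite mulN1r. Qed.

Lemma L1B f g : L1 f -> L1 g -> L1 (fun x => f x - g x).
Proof. by move=> hf /L1N; exact: L1D. Qed.

Lemma L1_norm f : L1 f -> L1 (fun x => `|f x|).
Proof. exact: integrable_norm. Qed.

Lemma IntD f g : L1 f -> L1 g -> Int (fun x => f x + g x) = Int f + Int g.
Proof. exact: RintegralD. Qed.

Lemma IntB f g : L1 f -> L1 g -> Int (fun x => f x - g x) = Int f - Int g.
Proof. exact: RintegralB. Qed.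

Lemma IntZ c f : L1 f -> Int (fun x => c * f x) = c * Int f.
Proof. exact: RintegralZl. Qed.

Lemma Int0 : Int (fun=> 0) = 0.
Proof. by rewrite /Int /Rintegral integral0. Qed.

Lemma L1_sum (I : Type) (s : seq I) (F : I -> R -> R) :
  (forall i, L1 (F i)) -> L1 (fun x => \sum_(i <- s) F i x).
Proof.
move=> h; elim: s => [|i s IH].
  by apply: (L1_ext _ L10) => x; rewrite big_nil.
by apply: (L1_ext _ (L1D (h i) IH)) => x; rewrite big_cons.
Qed.

Lemma Int_sum (I : Type) (s : seq I) (F : I -> R -> R) :
  (forall i, L1 (F i)) ->
  Int (fun x => \sum_(i <- s) F i x) = \sum_(i <- s) Int (F i).
Proof.
move=> h; elim: s => [|i s IH].
  by rewrite big_nil -[RHS]Int0; apply: Int_ext => x; rewrite big_nil.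
rewrite big_cons -IH -IntD //; last exact: L1_sum.
by apply: Int_ext => x; rewrite big_cons.
Qed.

Lemma Int_ge0 f : (forall x, 0 <= f x) -> 0 <= Int f.
Proof. by move=> h; exact: Rintegral_ge0. Qed.

Lemma Int_le f g : L1 f -> L1 g -> (forall x, f x <= g x) -> Int f <= Int g.
Proof. by move=> hf hg h; apply: le_Rintegral. Qed.

Lemma Int_norm f : L1 f -> `|Int f| <= Int (fun x => `|f x|).
Proof. by move=> hf; exact: le_normr_Rintegral. Qed.

Lemma Int_EFin f : L1 f -> (\int[mu]_(x in setT) (f x)%:E)%E = (Int f)%:E.
Proof. by move=> hf; rewrite /Int /Rintegral fineK // integrable_fin_num. Qed.

Lemma L1_ge0P f (M : R) : measurable_fun setT f -> (forall x, 0 <= f x) ->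
  (\int[mu]_(x in setT) (f x)%:E <= M%:E)%E -> L1 f /\ Int f <= M.
Proof.
move=> mf f0 hM; have hf : L1 f.
  apply/integrableP; split; first exact/measurable_EFinP.
  rewrite (le_lt_trans _ (ltry M)) // (le_trans _ hM) //.
  by rewrite le_eqVlt; apply/orP; left; apply/eqP/eq_integral => x _; rewrite /= ger0_norm.
by split => //; rewrite -lee_fin -Int_EFin.
Qed.

Lemma Int_dominated (f_ : nat -> R -> R) f g :
  (forall n, measurable_fun setT (f_ n)) -> measurable_fun setT f ->
  {ae mu, forall x, f_ ^~ x @ \oo --> f x} ->
  L1 g -> (forall n x, `|f_ n x| <= g x) ->
  L1 f /\ Int (f_ n) @[n --> \oo] --> Int f.
Proof.
move=> mf_ mf cf ig fg.
have [] := @dominated_convergence _ _ _ mu setT measurableT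
  (fun n => EFin \o f_ n) (EFin \o f) (EFin \o g).
- move=> n; apply/measurable_EFinP; exact: mf_.
- apply/measurable_EFinP; exact: mf.
- apply: (ae_mono cf) => x /= cx _.
  by apply: cvg_EFin => //; exact: nearW.
- exact: ig.
- by apply: ae_all => x n _; rewrite /= lee_fin.
move=> iF _ cF; split => //.
by move: cF; rewrite Int_EFin // => /fine_cvgP[].
Qed.

Lemma fatou_le (f_ : nat -> R -> R) f (M : R) :
  (forall n, measurable_fun setT (f_ n)) -> measurable_fun setT f ->
  (forall n x, 0 <= f_ n x) -> (forall x, 0 <= f x) ->
  {ae mu, forall x, f_ ^~ x @ \oo --> f x} ->
  (forall n, \int[mu]_(x in setT) (f_ n x)%:E <= M%:E)%E ->
  (\int[mu]_(x in setT) (f x)%:E <= M%:E)%E.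
Proof.
move=> mf_ mf f0_ f0 cf hM.
pose g x := limn_einf (fun n => (f_ n x)%:E).
have mg : measurable_fun setT g.
  apply: (@emeasurable_fun_cvg _ _ _ setT (fun n x => einfs (fun m => (f_ m x)%:E) n)).
    by move=> n; apply: measurable_fun_einfs => m; apply/measurable_EFinP; exact: mf_.
  by move=> x _; rewrite /g limn_einf_lim; exact: is_cvg_einfs.
have g0 x : (0 <= g x)%E.
  rewrite /g limn_einf_lim; apply: lime_ge; first exact: is_cvg_einfs.
  apply: nearW => n; apply: le_ereal_inf_tmp => _ [m _ <-].
  by rewrite lee_fin.
rewrite (@ge0_ae_eq_integral _ _ _ mu setT _ g) //=.
- apply: (le_trans (@fatou _ _ _ mu setT measurableT (fun n x => (f_ n x)%:E) _ _)).
  + by move=> n; apply/measurable_EFinP; exact: mf_.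
  + by move=> n x _; rewrite lee_fin.
  rewrite limn_einf_lim; apply: lime_le; first exact: is_cvg_einfs.
  apply: nearW => n; apply: (le_trans _ (hM n)).
  by apply: ereal_inf_lbound; exists n => /=.
- by apply/measurable_EFinP; exact: mf.
- by move=> x _; rewrite lee_fin.
- apply: (ae_mono cf) => x cx _; rewrite /g.
  have /cvg_limn_einf_sup[-> _] // : (fun n => (f_ n x)%:E) @ \oo --> (f x)%:E.
  by apply: cvg_EFin => //; exact: nearW.
Qed.

End IntegralsOnTheLine.

Section Bisection.
Variable R : realType.

Lemma exists_pow2_lt (L d : R) : 0 < d -> exists k : nat, L / 2 ^+ k < d.
Proof.
move=> d0; have /archi_boundP h : 0 <= `|L| / d by rewrite divr_ge0 // ltW.
exists (Num.bound (`|L| / d)); set k := Num.bound _ in h *.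
rewrite ltr_pdivrMr ?exprn_gt0 // (le_lt_trans (ler_norm _)) //.
rewrite mulrC -ltr_pdivrMr // (lt_le_trans h) //.
by rewrite -natrX ler_nat ltnW // ltn_expl.
Qed.

Lemma bisection_zero (Phi : R -> R -> R -> R -> R) (a b c d : R) :
  a <= b -> c <= d ->
  (forall p m q r s, a <= p -> p <= m -> m <= q -> q <= b ->
     c <= r -> r <= s -> s <= d -> Phi p q r s = Phi p m r s + Phi m q r s) ->
  (forall p q r m s, a <= p -> p <= q -> q <= b ->
     c <= r -> r <= m -> m <= s -> s <= d -> Phi p q r s = Phi p q r m + Phi p q m s) ->
  (forall x y, a <= x -> x <= b -> c <= y -> y <= d ->
     forall e, 0 < e -> exists2 dl, 0 < dl & forall p q r s,
       a <= p -> p <= x -> x <= q -> q <= b -> c <= r -> r <= y -> y <= s -> s <= d ->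
       q - p < dl -> s - r < dl -> `|Phi p q r s| <= e * (q - p + (s - r)) ^+ 2) ->
  Phi a b c d = 0.
Proof.
move=> ab cd Hx Hy Hloc.
pose w k := (b - a) / 2 ^+ k; pose h k := (d - c) / 2 ^+ k.
have w0 k : 0 <= w k by rewrite divr_ge0 ?subr_ge0 // exprn_ge0.
have h0 k : 0 <= h k by rewrite divr_ge0 ?subr_ge0 // exprn_ge0.
have wS k : w k = w k.+1 + w k.+1.
  rewrite /w exprS invfM; move: (2 ^+ k)^-1 => t; by field; rewrite ?pnatr_eq0.
have hS k : h k = h k.+1 + h k.+1.
  rewrite /h exprS invfM; move: (2 ^+ k)^-1 => t; by field; rewrite ?pnatr_eq0.
pose inv k (z : R * R) := [/\ a <= z.1, z.1 + w k <= b, c <= z.2 & z.2 + h k <= d].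
pose F k (z : R * R) := `|Phi z.1 (z.1 + w k) z.2 (z.2 + h k)|.
pose nxt k (z z' : R * R) := [/\ inv k.+1 z', z.1 <= z'.1 /\ z'.1 + w k.+1 <= z.1 + w k,
  z.2 <= z'.2 /\ z'.2 + h k.+1 <= z.2 + h k & F k z <= 4 * F k.+1 z'].
have step (kz : nat * (R * R)) : exists z', inv kz.1 kz.2 -> nxt kz.1 kz.2 z'.
  case: kz => k [p r] /=; have [hi|hi] := pselect (inv k (p, r)); last by exists (p, r).
  case: (hi) => /= ap pb cr rd.
  move: (wS k) (hS k) (w0 k.+1) (h0 k.+1) => wk hk W0 H0.
  set W := w k.+1 in wk W0 *; set H := h k.+1 in hk H0 *.
  have E : Phi p (p + w k) r (r + h k) =
      Phi p (p + W) r (r + H) + Phi p (p + W) (r + H) (r + H + H)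
    + (Phi (p + W) (p + W + W) r (r + H) + Phi (p + W) (p + W + W) (r + H) (r + H + H)).
    rewrite wk hk (addrA p) (addrA r) (_ : Phi p (p + W + W) r (r + H + H) =
      Phi p (p + W) r (r + H + H) + Phi (p + W) (p + W + W) r (r + H + H)).
      by congr (_ + _); apply: Hy; lra.
    by apply: Hx; lra.
  have tri x y z t (m : R) : `|x| < m -> `|y| < m -> `|z| < m -> `|t| < m ->
      `|x + y + (z + t)| < 4 * m.
    move=> h1 h2 h3 h4; have := ler_normD (x + y) (z + t).
    by have := ler_normD x y; have := ler_normD z t; lra.
  have mk (p' r' : R) : p' = p \/ p' = p + W -> r' = r \/ r' = r + H ->
      `|Phi p (p + w k) r (r + h k)| <= 4 * `|Phi p' (p' + W) r' (r' + H)| ->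
      exists z' : R * R, inv k (p, r) -> nxt k (p, r) z'.
    move=> hp hr hF; exists (p', r') => _; rewrite /nxt /inv /F /= -/W -/H.
    have hp1 : p <= p' /\ p' + W <= p + W + W by case: hp => ->; split; lra.
    have hr1 : r <= r' /\ r' + H <= r + H + H by case: hr => ->; split; lra.
    by split => //; split; lra.
  set G := `|Phi p (p + w k) r (r + h k)| in mk.
  case: (leP G (4 * `|Phi p (p + W) r (r + H)|)) => [|g1].
    by apply: mk; left.
  case: (leP G (4 * `|Phi p (p + W) (r + H) (r + H + H)|)) => [|g2].
    by apply: mk; [left|right].
  case: (leP G (4 * `|Phi (p + W) (p + W + W) r (r + H)|)) => [|g3].
    by apply: mk; [right|left].
  case: (leP G (4 * `|Phi (p + W) (p + W + W) (r + H) (r + H + H)|)) => [|g4].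
    by apply: mk; right.
  exfalso; have : G < 4 * (G / 4); last by lra.
  by rewrite {1}/G E; apply: tri; lra.
have [nx Hnx] := choice step.
pose z := fix z k := if k is k'.+1 then nx (k', z k') else (a, c).
have zinv k : inv k (z k).
  elim: k => [|k IH]; first by rewrite /inv /= /w /h expr0 !divr1; split; lra.
  by have [] := Hnx (k, z k) IH.
have zn k : nxt k (z k) (z k.+1) by exact: (Hnx (k, z k)).
have F0 k : `|Phi a b c d| <= 4 ^+ k * F k (z k).
  elim: k => [|k IH].
    by rewrite /F /= /w /h expr0 !divr1 mul1r !(addrC _ (_ - _)) !subrK.
  rewrite (le_trans IH) // exprSr -mulrA ler_wpM2l ?exprn_ge0 //.
  by case: (zn k).
have lim1 (p : nat -> R) (v : nat -> R) : (forall k, 0 <= v k) ->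
    (forall k, p k <= p k.+1) -> (forall k, p k.+1 + v k.+1 <= p k + v k) ->
    exists x, forall k, p k <= x /\ x <= p k + v k.
  move=> v0 pm pv.
  have pm' k j : p k <= p (k + j)%N.
    by elim: j => [|j IH]; rewrite ?addn0 // addnS (le_trans IH).
  have pv' k j : p (k + j)%N + v (k + j)%N <= p k + v k.
    by elim: j => [|j IH]; rewrite ?addn0 // addnS (le_trans _ IH).
  have pp k j : p j <= p k + v k.
    have [/subnK e|/ltnW/subnK e] := leqP k j.
      by have := pv' k (j - k)%N; rewrite addnC e; have := v0 j; lra.
    by have := pm' j (k - j)%N; rewrite addnC e; have := v0 k; lra.
  exists (sup (range p)) => k; split.
    apply: ub_le_sup; last by exists k.
    by exists (p 0 + v 0%N) => _ [j _ <-].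
  apply: ge_sup; first by exists (p k); exists k.
  by move=> _ [j _ <-].
have [x Hxk] := lim1 (fun k => (z k).1) w w0
  (fun k => let: And4 _ h1 _ _ := zn k in h1.1) (fun k => let: And4 _ h1 _ _ := zn k in h1.2).
have [y Hyk] := lim1 (fun k => (z k).2) h h0
  (fun k => let: And4 _ _ h1 _ := zn k in h1.1) (fun k => let: And4 _ _ h1 _ := zn k in h1.2).
have [ax xb] : a <= x /\ x <= b.
  by have := Hxk 0%N; rewrite /= /w expr0 divr1; lra.
have [cy yd] : c <= y /\ y <= d.
  by have := Hyk 0%N; rewrite /= /h expr0 divr1; lra.
pose L := (b - a) + (d - c); have L0 : 0 <= L by rewrite /L; lra.
have bound e : 0 < e -> `|Phi a b c d| <= e * L ^+ 2.
  move=> e0; have [dl dl0 Hdl] := Hloc x y ax xb cy yd e e0.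
  have [k hk] := exists_pow2_lt L dl0.
  have kp : 0 < 2 ^+ k :> R by rewrite exprn_gt0.
  have Lk : w k + h k = L / 2 ^+ k by rewrite /w /h -mulrDl.
  case: (zinv k) => i1 i2 i3 i4; case: (Hxk k) => x1 x2; case: (Hyk k) => y1 y2.
  have := w0 k; have := h0 k => hk0 wk0.
  have E1 : (z k).1 + w k - (z k).1 = w k by rewrite addrC addKr.
  have E2 : (z k).2 + h k - (z k).2 = h k by rewrite addrC addKr.
  have hF : F k (z k) <= e * (L / 2 ^+ k) ^+ 2.
    have := Hdl _ _ _ _ i1 x1 x2 i2 i3 y1 y2 i4; rewrite E1 E2 Lk; apply; lra.
  apply: (le_trans (F0 k)); rewrite (le_trans (ler_wpM2l _ hF)) ?exprn_ge0 //.
  have -> : 4 ^+ k = (2 ^+ k) ^+ 2 :> R by rewrite -exprM mulnC exprM; congr (_ ^+ k); ring.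
  by rewrite le_eqVlt; apply/orP; left; apply/eqP; field; rewrite gt_eqF.
apply/eqP; rewrite -normr_le0; apply/ler_addgt0Pr => e e0; rewrite add0r.
have L1p : 0 < L ^+ 2 + 1 by rewrite ltr_wpDl // sqr_ge0.
have /bound h1 : 0 < e / (L ^+ 2 + 1) by rewrite divr_gt0.
apply: (le_trans h1); rewrite mulrAC ler_pdivrMr //.
by rewrite ler_pM2l // lerDl.
Qed.

End Bisection.

(** * Goursat's theorem on rectangles *)

Section SegmentIntegrals.
Variable R : realType.
Notation mu := (@lebesgue_measure R).
Implicit Types (g : R -> R) (a b : R).

Definition seg a b g : R := \int[mu]_(x in `[a, b]) g x.

Definition cont_on a b g := forall x, a <= x -> x <= b -> {for x, continuous g}.

Lemma cont_on_sub a b p q g : a <= p -> q <= b -> cont_on a b g -> cont_on p q g.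
Proof. by move=> ap qb h x px xq; apply: h; [exact: le_trans px|exact: le_trans qb]. Qed.

Lemma cont_on_within a b g : cont_on a b g -> {within `[a, b], continuous g}.
Proof.
move=> h; apply: continuous_in_subspaceT => x; rewrite inE /= in_itv /= => /andP[].
exact: h.
Qed.

Lemma seg_integrable a b g : cont_on a b g -> mu.-integrable `[a, b] (EFin \o g).
Proof.
move=> /cont_on_within cg; apply: continuous_compact_integrable => //.
exact: segment_compact.
Qed.

Lemma cont_onN a b g : cont_on a b g -> cont_on a b (fun t => - g t).
Proof. by move=> h x ax xb; apply: continuousN; exact: h. Qed.

Lemma cont_onD a b g h : cont_on a b g -> cont_on a b h -> cont_on a b (fun t => g t + h t).
Proof. by move=> hg hh x ax xb; apply: continuousD; [exact: hg|exact: hh]. Qed.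

Lemma cont_onB a b g h : cont_on a b g -> cont_on a b h -> cont_on a b (fun t => g t - h t).
Proof. by move=> hg /cont_onN; exact: cont_onD. Qed.

Lemma cont_on_cst a b k : cont_on a b (fun=> k).
Proof. by move=> x _ _; exact: cvg_cst. Qed.

Lemma segB a b g h : cont_on a b g -> cont_on a b h ->
  seg a b (fun t => g t - h t) = seg a b g - seg a b h.
Proof. by move=> hg hh; apply: RintegralB => //; exact: seg_integrable. Qed.

Lemma segD a b g h : cont_on a b g -> cont_on a b h ->
  seg a b (fun t => g t + h t) = seg a b g + seg a b h.
Proof. by move=> hg hh; apply: RintegralD => //; exact: seg_integrable. Qed.

Lemma seg_cst a b k : a <= b -> seg a b (fun=> k) = k * (b - a).
Proof.
move=> ab; rewrite /seg Rintegral_cst //; congr (_ * _).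
rewrite [X in fine X](_ : _ = (b - a)%:E) //.
have := lebesgue_measure_itv `[a, b]%R; rewrite /= lte_fin => ->.
by case: ltgtP ab => // -> _; rewrite subrr.
Qed.

Lemma seg_le a b g h : cont_on a b g -> cont_on a b h ->
  (forall x, a <= x -> x <= b -> g x <= h x) -> seg a b g <= seg a b h.
Proof.
move=> hg hh H; apply: le_Rintegral => //; try exact: seg_integrable.
by move=> x /=; rewrite in_itv /= => /andP[]; exact: H.
Qed.

Lemma seg_close a b g k e : a <= b -> cont_on a b g ->
  (forall x, a <= x -> x <= b -> `|g x - k| <= e) ->
  `|seg a b g - k * (b - a)| <= e * (b - a).
Proof.
move=> ab cg H; rewrite -[e * _]seg_cst // -[k * _]seg_cst // ler_distl.
apply/andP; split.
  rewrite -segB; do ?exact: cont_on_cst.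
  apply: seg_le => //; first by apply: cont_onB; exact: cont_on_cst.
  by move=> x ax xb; have := H x ax xb; rewrite ler_distl => /andP[].
rewrite -segD; do ?exact: cont_on_cst.
apply: seg_le => //; first by apply: cont_onD; exact: cont_on_cst.
by move=> x ax xb; have := H x ax xb; rewrite ler_distl => /andP[].
Qed.

Lemma seg_bounded a b g M : a <= b -> cont_on a b g ->
  (forall x, a <= x -> x <= b -> `|g x| <= M) -> `|seg a b g| <= M * (b - a).
Proof.
move=> ab cg H; rewrite -[seg _ _ _]subr0 -(mul0r (b - a)).
by apply: seg_close => // x ax xb; rewrite subr0 H.
Qed.

Lemma seg_split a m b g : a <= m -> m <= b -> cont_on a b g ->
  seg a b g = seg a m g + seg m b g.
Proof.
move=> am mb cg; apply/eqP; rewrite addrC -subr_eq; apply/eqP.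
rewrite /seg Rintegral_itvB ?bnd_simp //; last exact: seg_integrable.
rewrite Rintegral_itv_obnd_cbnd //.
apply: (integrableS _ _ _ (seg_integrable cg)) => //.
by apply: subset_itv; rewrite bnd_simp.
Qed.

Definition has_diff (P : R -> R -> R) x y al ka :=
  forall e, 0 < e -> exists2 dl, 0 < dl & forall x' y',
    `|x' - x| < dl -> `|y' - y| < dl ->
    `|P x' y' - P x y - al * (x' - x) - ka * (y' - y)| <= e * (`|x' - x| + `|y' - y|).

Lemma has_diff_cvg P x y al ka : has_diff P x y al ka ->
  forall e, 0 < e -> exists2 dl, 0 < dl & forall x' y',
    `|x' - x| < dl -> `|y' - y| < dl -> `|P x' y' - P x y| < e.
Proof.
move=> h e e0; have [dl dl0 H] := h 1 ltr01.
pose K := 2 + `|al| + `|ka|.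
have K0 : 0 < K by rewrite /K; have := normr_ge0 al; have := normr_ge0 ka; lra.
exists (Num.min dl (e / (2 * K))).
  by rewrite lt_min dl0 divr_gt0 // mulr_gt0.
move=> x' y'; rewrite !lt_min => /andP[x1 x2] /andP[y1 y2].
have := H _ _ x1 y1; rewrite mul1r.
move: x2 y2; rewrite !ltr_pdivlMr ?mulr_gt0 //.
set X := x' - x; set Y := y' - y; set D := P x' y' - _ => hX hY hD.
have e1 : `|D| <= `|D - al * X - ka * Y| + `|al| * `|X| + `|ka| * `|Y|.
  rewrite -!normrM; have := ler_normD (D - al * X - ka * Y) (al * X + ka * Y).
  have := ler_normD (al * X) (ka * Y).
  by rewrite (_ : D - al * X - ka * Y + (al * X + ka * Y) = D); [lra|ring].
have := normr_ge0 al; have := normr_ge0 ka; have := normr_ge0 X; have := normr_ge0 Y.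
move: hX hY hD e1; rewrite /K.
move: `|D| `|D - _ - _| `|X| `|Y| `|al| `|ka| => d d' u v p q hX hY hD e1 v0 u0 q0 p0.
have : u * p <= u * (2 + p + q) by rewrite ler_wpM2l //; lra.
have : v * q <= v * (2 + p + q) by rewrite ler_wpM2l //; lra.
have : u * p + 2 * u <= u * (2 + p + q) by nra.
have : v * q + 2 * v <= v * (2 + p + q) by nra.
by nra.
Qed.

Lemma has_diff_cont1 P x y al ka : has_diff P x y al ka -> {for x, continuous (P^~ y)}.
Proof.
move=> /has_diff_cvg h; apply/cvgrPdist_lt => e /h[dl dl0 H].
apply/nbhs_ballP; exists dl => //= x' hx'; rewrite distrC.
by apply: H; rewrite ?subrr ?normr0 // distrC.
Qed.

Lemma has_diff_cont2 P x y al ka : has_diff P x y al ka -> {for y, continuous (P x)}.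
Proof.
move=> /has_diff_cvg h; apply/cvgrPdist_lt => e /h[dl dl0 H].
apply/nbhs_ballP; exists dl => //= x' hx'; rewrite distrC.
by apply: H; rewrite ?subrr ?normr0 // distrC.
Qed.

(* The circulation of the 1-form [P dx + Q dy] around the rectangle [p, q] x [r, s]. *)
Definition circ (P Q : R -> R -> R) p q r s :=
  seg p q (P^~ r) - seg p q (P^~ s) + (seg r s (Q q) - seg r s (Q p)).

Definition closed_at (P Q : R -> R -> R) x y :=
  exists al ka la, has_diff P x y al ka /\ has_diff Q x y ka la.

Lemma circ_splitx P Q p m q r s : p <= m -> m <= q ->
  cont_on p q (P^~ r) -> cont_on p q (P^~ s) ->
  circ P Q p q r s = circ P Q p m r s + circ P Q m q r s.
Proof. by move=> pm mq c1 c2; rewrite /circ !(seg_split pm mq) //; ring. Qed.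

Lemma circ_splity P Q p q r m s : r <= m -> m <= s ->
  cont_on r s (Q p) -> cont_on r s (Q q) ->
  circ P Q p q r s = circ P Q p q r m + circ P Q p q m s.
Proof. by move=> rm ms c1 c2; rewrite /circ !(seg_split rm ms) //; ring. Qed.

Lemma closed_cont1 P Q a b c d : (forall x y, a <= x -> x <= b -> c <= y -> y <= d ->
  closed_at P Q x y) -> forall y, c <= y -> y <= d -> cont_on a b (P^~ y).
Proof.
by move=> h y cy yd x ax xb; have [? [? [? [/has_diff_cont1]]]] := h x y ax xb cy yd.
Qed.

Lemma closed_cont2 P Q a b c d : (forall x y, a <= x -> x <= b -> c <= y -> y <= d ->
  closed_at P Q x y) -> forall x, a <= x -> x <= b -> cont_on c d (Q x).
Proof.
by move=> h x ax xb y cy yd; have [? [? [? [_ /has_diff_cont2]]]] := h x y ax xb cy yd.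
Qed.

Lemma has_diff_increment (F : R -> R -> R) (x y al ka e dl w t r s : R) :
  (forall x' y', `|x' - x| < dl -> `|y' - y| < dl ->
    `|F x' y' - F x y - al * (x' - x) - ka * (y' - y)| <= e / 2 * (`|x' - x| + `|y' - y|)) ->
  0 < e -> `|t - x| < dl -> `|t - x| <= w -> r <= y -> y <= s -> s - r < dl ->
  `|F t s - F t r - ka * (s - r)| <= e * (w + (s - r)).
Proof.
move=> H e0 t1 t2 ry ys h1.
have hr : `|r - y| <= s - r by rewrite ler_norml; apply/andP; split; lra.
have hs : `|s - y| <= s - r by rewrite ler_norml; apply/andP; split; lra.
have := H _ _ t1 (le_lt_trans hr h1); have := H _ _ t1 (le_lt_trans hs h1).
set A := F t s - _ - _ - _; set B := F t r - _ - _ - _ => hA hB.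
have -> : F t s - F t r - ka * (s - r) = A - B by rewrite /A /B; ring.
apply: le_trans (ler_normB _ _) _.
have : e / 2 * (`|t - x| + `|s - y|) <= e / 2 * (w + (s - r)).
  by rewrite ler_pM2l ?divr_gt0 // lerD.
have : e / 2 * (`|t - x| + `|r - y|) <= e / 2 * (w + (s - r)).
  by rewrite ler_pM2l ?divr_gt0 // lerD.
by lra.
Qed.

Lemma goursat P Q a b c d : a <= b -> c <= d ->
  (forall x y, a <= x -> x <= b -> c <= y -> y <= d -> closed_at P Q x y) ->
  circ P Q a b c d = 0.
Proof.
move=> ab cd H; have C1 := closed_cont1 H; have C2 := closed_cont2 H.
apply: bisection_zero ab cd _ _ _ => //.
- move=> p m q r s ap pm mq qb cr rs sd; apply: circ_splitx => //.
    by apply: cont_on_sub ap qb _; apply: C1 => //; exact: le_trans sd.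
  by apply: cont_on_sub ap qb _; apply: C1 => //; exact: le_trans rs.
- move=> p q r m s ap pq qb cr rm ms sd; apply: circ_splity => //.
    by apply: cont_on_sub cr sd _; apply: C2 => //; exact: le_trans qb.
  by apply: cont_on_sub cr sd _; apply: C2 => //; exact: le_trans pq.
move=> x y ax xb cy yd e e0; have [al [ka [la [hP hQ]]]] := H x y ax xb cy yd.
have e2 : 0 < e / 2 by rewrite divr_gt0.
have [d1 d10 H1] := hP _ e2; have [d2 d20 H2] := hQ _ e2.
exists (Num.min d1 d2); first by rewrite lt_min d10.
move=> p q r s ap px xq qb cr ry ys sd; rewrite !lt_min => /andP[w1 w2] /andP[h1 h2].
have pq : p <= q by apply: le_trans px xq.
have rs : r <= s by apply: le_trans ry ys.
set w := q - p in w1 w2 *; set h := s - r in h1 h2 *.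
have near (u v z dl : R) : u <= v -> v <= z -> z - u < dl -> forall t : R, u <= t -> t <= z ->
    `|t - v| < dl /\ `|t - v| <= z - u.
  move=> uv vz zu t ut tz.
  have : `|t - v| <= z - u by rewrite ler_norml; apply/andP; split; lra.
  by move=> hh; split => //; exact: le_lt_trans hh zu.
have PP t : p <= t -> t <= q -> `|(P t r - P t s) - (- ka * h)| <= e * (w + h).
  move=> pt tq; have [t1 t2] := near _ _ _ _ px xq w1 t pt tq.
  have := has_diff_increment H1 e0 t1 t2 ry ys h1; rewrite -normrN.
  by congr (`|_| <= _); rewrite /h; ring.
have QQ t : r <= t -> t <= s -> `|(Q q t - Q p t) - ka * w| <= e * (w + h).
  move=> rt ts; have [t1 t2] := near _ _ _ _ ry ys h2 t rt ts.
  have H2' x' y' : `|x' - y| < d2 -> `|y' - x| < d2 ->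
      `|Q y' x' - Q x y - la * (x' - y) - ka * (y' - x)| <= e / 2 * (`|x' - y| + `|y' - x|).
    by move=> ? ?; rewrite addrAC [`|_| + _]addrC; exact: H2.
  by rewrite [w + h]addrC; exact: (has_diff_increment (F := fun x y => Q y x) H2').
have rd : r <= d by apply: le_trans sd.
have cs : c <= s by apply: le_trans rs.
have pb : p <= b by apply: le_trans qb.
have aq : a <= q by apply: le_trans pq.
have cPr : cont_on p q (P^~ r) by apply: cont_on_sub ap qb _; exact: C1.
have cPs : cont_on p q (P^~ s) by apply: cont_on_sub ap qb _; exact: C1.
have cQp : cont_on r s (Q p) by apply: cont_on_sub cr sd _; exact: C2.
have cQq : cont_on r s (Q q) by apply: cont_on_sub cr sd _; exact: C2.
have B1 := seg_close pq (cont_onB cPr cPs) PP.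
have B2 := seg_close rs (cont_onB cQq cQp) QQ.
rewrite /circ -segB // -segB //.
rewrite -/w -/h in B1 B2.
set S1 := seg p q _ in B1 *; set S2 := seg r s _ in B2 *.
rewrite (_ : S1 + S2 = (S1 - - ka * h * w) + (S2 - ka * w * h)); last by ring.
apply: le_trans (ler_normD _ _) _.
apply: le_trans (lerD B1 B2) _.
by rewrite le_eqVlt; apply/orP; left; apply/eqP; ring.
Qed.

(* One exceptional point is allowed as long as the form stays bounded near it: the
   circulation only sees an arbitrarily small square around that point. *)
Lemma goursat_except P Q a b c d u v (M : R) : a < u -> u < b -> c < v -> v < d ->
  (forall x y, a <= x -> x <= b -> c <= y -> y <= d -> (x != u) || (y != v) ->
    closed_at P Q x y) ->
  (exists2 dl, 0 < dl & forall x y, `|x - u| < dl -> `|y - v| < dl ->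
     (x != u) || (y != v) -> `|P x y| <= M /\ `|Q x y| <= M) ->
  circ P Q a b c d = 0.
Proof.
move=> au ub cv vd H [dl dl0 HM].
pose dl1 := Num.min (Num.min dl (u - a)) (Num.min (b - u) (Num.min (v - c) (d - v))).
have dl10 : 0 < dl1 by rewrite !lt_min dl0 !subr_gt0 au ub cv vd.
have red e : 0 < e -> e < dl1 -> circ P Q a b c d = circ P Q (u - e) (u + e) (v - e) (v + e).
  move=> e0; rewrite !lt_min => /andP[/andP[e1 e2] /andP[e3 /andP[e4 e5]]].
  have i1 : a <= u - e by lra.
  have i2 : u - e <= u + e by lra.
  have i3 : u + e <= b by lra.
  have i4 : c <= v - e by lra.
  have i5 : v - e <= v + e by lra.
  have i6 : v + e <= d by lra.
  have cP y : c <= y -> y <= d -> y != v -> cont_on a b (P^~ y).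
    move=> cy yd yv x ax xb.
    by have [|? [? [? [/has_diff_cont1]]]] := H x y ax xb cy yd; first by rewrite yv orbT.
  have cQ x : a <= x -> x <= b -> x != u -> cont_on c d (Q x).
    move=> ax xb xu y cy yd.
    by have [|? [? [? [_ /has_diff_cont2]]]] := H x y ax xb cy yd; first by rewrite xu.
  rewrite (@circ_splitx _ _ a (u - e) b) //; last 3 first.
  - by apply: (le_trans i2).
  - by apply: cP => //; [lra|rewrite lt_eqF].
  - by apply: cP => //; [lra|rewrite gt_eqF].
  rewrite (@circ_splitx _ _ (u - e) (u + e) b) //; last 2 first.
  - by apply: (cont_on_sub i1 (lexx _)); apply: cP => //; [lra|rewrite lt_eqF].
  - by apply: (cont_on_sub i1 (lexx _)); apply: cP => //; [lra|rewrite gt_eqF].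
  rewrite (@circ_splity _ _ (u - e) (u + e) c (v - e) d) //; last 3 first.
  - by apply: (le_trans i5).
  - by apply: cQ => //; [lra|rewrite lt_eqF //; lra].
  - by apply: cQ => //; [lra|rewrite gt_eqF //; lra].
  rewrite (@circ_splity _ _ (u - e) (u + e) (v - e) (v + e) d) //; last 2 first.
  - by apply: (cont_on_sub i4 (lexx _)); apply: cQ => //; [lra|rewrite lt_eqF //; lra].
  - by apply: (cont_on_sub i4 (lexx _)); apply: cQ => //; [lra|rewrite gt_eqF //; lra].
  rewrite (@goursat _ _ a (u - e) c d) ?(ltW (lt_trans cv vd)) //; last first.
    move=> x y ax xb cy yd; apply: H => //; first lra.
    by rewrite lt_eqF //; lra.
  rewrite (@goursat _ _ (u + e) b c d) ?(ltW (lt_trans cv vd)) //; last first.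
    move=> x y ax xb cy yd; apply: H => //; first lra.
    by rewrite gt_eqF //; lra.
  rewrite (@goursat _ _ (u - e) (u + e) c (v - e)) //; last first.
    by move=> x y ax xb cy yd; apply: H => //; lra.
  rewrite (@goursat _ _ (u - e) (u + e) (v + e) d) //; last first.
    by move=> x y ax xb cy yd; apply: H => //; lra.
  by ring.
have small e : 0 < e -> e < dl1 -> `|circ P Q a b c d| <= 8 * M * e.
  move=> e0 e1; rewrite (red e) //.
  move: e1; rewrite !lt_min => /andP[/andP[e1 e2] /andP[e3 /andP[e4 e5]]].
  have bP y : y != v -> `|y - v| < dl -> c <= y -> y <= d ->
      `|seg (u - e) (u + e) (P^~ y)| <= M * (u + e - (u - e)).
    move=> yv ydl cy yd; apply: seg_bounded; first lra.
      move=> x x1 x2; have [] : closed_at P Q x y.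
        by apply: H => //; [lra|lra|rewrite yv orbT].
      by move=> ? [? [? [/has_diff_cont1]]].
    move=> x x1 x2; apply HM => //; last by rewrite yv orbT.
    by rewrite ltr_norml; apply/andP; split; lra.
  have bQ x : x != u -> `|x - u| < dl -> a <= x -> x <= b ->
      `|seg (v - e) (v + e) (Q x)| <= M * (v + e - (v - e)).
    move=> xu xdl ax xb; apply: seg_bounded; first lra.
      move=> y y1 y2; have [] : closed_at P Q x y.
        by apply: H => //; [lra|lra|rewrite xu].
      by move=> ? [? [? [_ /has_diff_cont2]]].
    move=> y y1 y2; apply HM => //; last by rewrite xu.
    by rewrite ltr_norml; apply/andP; split; lra.
  have ue : `|u - e - u| = e by rewrite addrAC subrr add0r normrN gtr0_norm.
  have ue' : `|u + e - u| = e by rewrite addrAC subrr add0r gtr0_norm.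
  have ve : `|v - e - v| = e by rewrite addrAC subrr add0r normrN gtr0_norm.
  have ve' : `|v + e - v| = e by rewrite addrAC subrr add0r gtr0_norm.
  have := bP (v - e); rewrite lt_eqF ?ve; last lra.
  move=> /(_ isT e1); have := bP (v + e); rewrite gt_eqF ?ve'; last lra.
  move=> /(_ isT e1); have := bQ (u - e); rewrite lt_eqF ?ue; last lra.
  move=> /(_ isT e1); have := bQ (u + e); rewrite gt_eqF ?ue'; last lra.
  move=> /(_ isT e1) B1 B2 B3 B4.
  have {}B1 := B1 ltac:(lra) ltac:(lra).
  have {}B2 := B2 ltac:(lra) ltac:(lra).
  have {}B3 := B3 ltac:(lra) ltac:(lra).
  have {}B4 := B4 ltac:(lra) ltac:(lra).
  rewrite /circ; move: B1 B2 B3 B4.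
  set s1 := seg _ _ (Q _); set s2 := seg _ _ (Q _).
  set s3 := seg _ _ _; set s4 := seg _ _ _.
  move=> B1 B2 B3 B4.
  have := ler_normD (s4 - s3) (s1 - s2); have := ler_normB s4 s3; have := ler_normB s1 s2.
  by lra.
apply/eqP; rewrite -normr_le0; apply/ler_addgt0Pr => e e0; rewrite add0r.
pose K := 8 * `|M| + 1; have K0 : 0 < K by rewrite /K; have := normr_ge0 M; lra.
pose t := Num.min (dl1 / 2) (e / K).
have t0 : 0 < t by rewrite lt_min !divr_gt0.
have t1 : t < dl1.
  by rewrite gt_min; apply/orP; left; lra.
apply: (le_trans (small t t0 t1)).
have : t * K <= e by rewrite -ler_pdivlMr // ge_min lexx orbT.
rewrite /K; have := ler_norm M; nra.
Qed.

End SegmentIntegrals.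

Section ProductMeasurability.
Variable R : realType.
Notation mu := (@lebesgue_measure R).

Lemma measurable_continuous_section (f : R -> R -> R) :
  (forall y, continuous (f^~ y)) -> (forall x, measurable_fun setT (f x)) ->
  measurable_fun setT (fun z : R * R => f z.1 z.2).
Proof.
move=> cf mf.
pose g (n : nat) (z : R * R) := f ((Num.floor (z.1 * n.+1%:R))%:~R / n.+1%:R) z.2.
apply: (@measurable_fun_cvg _ _ _ setT g).
  move=> n _ Y mY; rewrite setTI.
  rewrite (_ : g n @^-1` Y = \bigcup_(k : int)
    (`[k%:~R / n.+1%:R, (k + 1)%:~R / n.+1%:R[%classic `*` (f (k%:~R / n.+1%:R) @^-1` Y))).
    apply: countable_bigcupT_measurable => [|k]; first exact: countableP.
    apply: measurableX => //.
    by rewrite -[X in measurable X]setTI; apply: mf.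
  have n0 : 0 < n.+1%:R :> R by [].
  apply/seteqP; split=> [[x y] /= h|[x y] /= [k _ [/=]]].
    exists (Num.floor (x * n.+1%:R)) => //; split => //=.
    by rewrite in_itv /= ler_pdivrMr // ltr_pdivlMr // floor_le floorD1_gt.
  rewrite in_itv /= ler_pdivrMr // ltr_pdivlMr // => h; rewrite /g /=.
  by rewrite (_ : Num.floor _ = k) //; apply: floor_def.
move=> [x y] _ /=; rewrite /g /=.
apply: (@cvg_comp _ _ _ (fun n => (Num.floor (x * n.+1%:R))%:~R / n.+1%:R) (f^~ y)); last exact: cf.
apply/cvgrPdist_lt => e e0.
near=> n.
have hn : n.+1%:R^-1 < e :> R.
  near: n; have /cvgrPdist_lt/(_ e e0) := @cvg_harmonic R.
  by apply: filterS => k /=; rewrite sub0r normrN ger0_norm ?harmonic_ge0.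
have n0 : 0 < n.+1%:R :> R by [].
have := floor_le (x * n.+1%:R); have := floorD1_gt (x * n.+1%:R).
rewrite intrD -ler_pdivrMr // -ltr_pdivlMr // mulrDl mul1r.
set q := _ / _ => h1 h2.
rewrite ger0_norm ?subr_ge0 //.
by apply: lt_trans hn; rewrite ltrBlDl.
Unshelve. all: by end_near. Qed.

Lemma tonelli_line (f : R -> R -> R) :
  measurable_fun setT (fun z : R * R => f z.1 z.2) -> (forall x y, 0 <= f x y) ->
  (\int[mu]_x \int[mu]_y (f x y)%:E = \int[mu]_y \int[mu]_x (f x y)%:E)%E.
Proof.
move=> mf f0.
pose F := fun z : R * R => (f z.1 z.2)%:E.
have mF : measurable_fun setT F by apply/measurable_EFinP.
have F0 z : (0 <= F z)%E by rewrite lee_fin.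
have := @fubini_tonelli1 _ _ _ _ R mu mu F mF F0.
by rewrite (@fubini_tonelli2 _ _ _ _ R mu mu F mF F0) => ->.
Qed.

End ProductMeasurability.

Section PoissonKernelIntegral.
Variable R : realType.
Notation mu := (@lebesgue_measure R).

Lemma den_gt0 (u v t : R) : v != 0 -> 0 < (t - u) ^+ 2 + v ^+ 2.
Proof.
move=> v0; rewrite ltr_wpDl ?sqr_ge0 //.
by rewrite lt_neqAle sqr_ge0 andbT eq_sym expf_eq0.
Qed.

Lemma den_cont (u v : R) : continuous (fun t : R => (t - u) ^+ 2 + v ^+ 2).
Proof.
move=> t; have h : (fun t => t - u) x @[x --> t] --> t - u.
  by apply: cvgB; [exact: cvg_id|exact: cvg_cst].
by apply: cvgD; [exact: (cvgM h h)|exact: cvg_cst].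
Qed.

Lemma inv_den_cont (u v : R) : v != 0 ->
  continuous (fun t : R => ((t - u) ^+ 2 + v ^+ 2)^-1).
Proof.
by move=> v0 t; apply: cvgV; [rewrite gt_eqF // den_gt0|exact: den_cont].
Qed.

Lemma integralT_oneDsqr : (\int[mu]_(x in setT) (oneDsqr x)^-1%:E = pi%:E)%E.
Proof.
rewrite ge0_symfun_integralT //=.
- have := @integral0y_oneDsqr R; rewrite set_itvcy => ->.
  by rewrite -EFinM; congr EFin; field.
- exact: continuous_oneDsqrV.
- by move=> x; rewrite /oneDsqr /= sqrrN.
Qed.

Lemma integral_inv_den (u v : R) : 0 < v ->
  (\int[mu]_(t in setT) (((t - u) ^+ 2 + v ^+ 2)^-1)%:E = (pi / v)%:E)%E.
Proof.
move=> v0; have vn0 : v != 0 by rewrite gt_eqF.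
pose F (x : R) := u + v * x.
have dF : F^`() = cst v.
  apply/funext => x; rewrite derive1E.
  apply: derive_val.
  by apply: is_derive_eq; rewrite add0r mul1r /GRing.scale /= mulr1.
rewrite (@increasing_ge0_integration_by_substitutionT _ F
  (fun t => ((t - u) ^+ 2 + v ^+ 2)^-1)) //.
- transitivity (\int[mu]_(x in setT) ((v^-1)%:E * (oneDsqr x)^-1%:E)%E)%E.
    apply: eq_integral => x _; rewrite -EFinM dF; congr EFin.
    rewrite !fctE /F /oneDsqr addrAC subrr add0r exprMn.
    rewrite -{2}(mulr1 (v ^+ 2)) -mulrDr (addrC (x ^+ 2)); field.
    by rewrite vn0 /= gt_eqF // (lt_le_trans ltr01) // oneDsqr_ge1.
  have mo : measurable_fun setT (fun x : R => (oneDsqr x)^-1).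
    by apply: continuous_measurable_fun; exact: continuous_oneDsqrV.
  rewrite ge0_integralZl_EFin //.
  + by rewrite integralT_oneDsqr -EFinM mulrC.
  + by apply/measurable_EFinP; exact: mo.
  + by rewrite invr_ge0 ltW.
- by move=> x y xy; rewrite ltrD2l ltr_pM2l.
- by rewrite dF => x; exact: cvg_cst.
- by rewrite dF; exact: is_cvg_cst.
- by rewrite dF; exact: is_cvg_cst.
- apply/cvgrNyPle => A; exists ((A - u) / v); split; first by rewrite num_real.
  by move=> x; rewrite ltr_pdivlMr // mulrC => /ltW; rewrite lerBrDl.
- apply/cvgryPge => A; exists ((A - u) / v); split; first by rewrite num_real.
  by move=> x; rewrite ltr_pdivrMr // mulrC => /ltW; rewrite lerBlDl.
- exact: inv_den_cont.
- by move=> x; rewrite invr_ge0 ltW // den_gt0.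
Qed.

Lemma L1_inv_den (u v : R) : v != 0 -> L1 (fun t => ((t - u) ^+ 2 + v ^+ 2)^-1).
Proof.
move=> v0; have a0 : 0 < `|v| by rewrite normr_gt0.
apply: (@L1_ext _ (fun t => ((t - u) ^+ 2 + `|v| ^+ 2)^-1)).
  by move=> t; rewrite real_normK ?num_real.
apply: (proj1 (@L1_ge0P _ _ (pi / `|v|) _ _ _)).
- apply: continuous_measurable_fun; apply: inv_den_cont; exact: lt0r_neq0.
- by move=> t; rewrite invr_ge0 ltW // den_gt0 // lt0r_neq0.
- by rewrite integral_inv_den.
Qed.

Lemma Int_inv_den (u v : R) : 0 < v ->
  Int (fun t => ((t - u) ^+ 2 + v ^+ 2)^-1) = pi / v.
Proof.
move=> v0; apply: EFin_inj; rewrite -Int_EFin ?integral_inv_den //.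
by apply: L1_inv_den; rewrite gt_eqF.
Qed.

End PoissonKernelIntegral.

Section ComplexDifferentiability.
Variable R : realType.
Implicit Types (f g : R[i] -> R[i]) (z w a : R[i]).

Definition cder f z := derivable f z (1 : R[i]).

Lemma cderB f g z : cder f z -> cder g z -> cder (fun w => f w - g w) z.
Proof. exact: (@derivableB R[i] R[i] R[i] f g z 1). Qed.

Lemma cderM f g z : cder f z -> cder g z -> cder (fun w => f w * g w) z.
Proof. exact: (@derivableM R[i] R[i] f g z 1). Qed.

Lemma cderV f z : f z != 0 -> cder f z -> cder (fun w => (f w)^-1) z.
Proof. exact: (@derivableV R[i] R[i] f z 1). Qed.

Lemma cder_cst a z : cder (fun=> a) z.
Proof. exact: (@derivable_cst R[i] R[i] R[i] a z 1). Qed.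

Lemma cder_sub a z : cder (fun w => w - a) z.
Proof.
apply: (@derivableB R[i] R[i] R[i] id (cst a) z 1); last exact: derivable_cst.
exact: (@derivable_id R[i] R[i] z 1).
Qed.

Lemma cder_shift f a z : cder f (z + a) -> cder (fun w => f (w + a)) z.
Proof.
rewrite /cder /derivable; set F := (X in cvg (X @ _)); set G := (X in _ -> cvg (X @ _)).
by rewrite (_ : F = G) //; apply/funext => h; rewrite /F /G /= !addrA.
Qed.

Lemma cderP f z : cder f z -> exists l : R[i],
  forall e, 0 < e -> exists2 d : R, 0 < d & forall w, cmod (w - z) < d ->
    cmod (f w - f z - l * (w - z)) <= e * cmod (w - z).
Proof.
move=> /cvg_ex[l hl]; exists l => e e0.
have /hl : nbhs l [set w | cmod (w - l) < e] by apply/nbhs_cmodP; exists e.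
move=> /nbhs_cmodP[d d0 hd]; exists d => // w hw.
have [->|wz] := eqVneq w z; first by rewrite !subrr mulr0 subr0 cmod0 mulr0.
have wz0 : w - z != 0 by rewrite subr_eq0.
have := hd (w - z); rewrite subr0 => /(_ hw wz0) /=.
rewrite /GRing.scale /= mulr1 subrK => /ltW h.
have -> : f w - f z - l * (w - z) = ((w - z)^-1 * (f w - f z) - l) * (w - z).
  by rewrite mulrBl mulrAC mulVf // mul1r.
by rewrite cmodM ler_wpM2r // cmod_ge0.
Qed.

Lemma cder_cont f z : cder f z ->
  forall e : R, 0 < e -> exists2 d : R, 0 < d & forall w, cmod (w - z) < d -> cmod (f w - f z) < e.
Proof.
move=> /cderP[l hl] e e0; have [d d0 hd] := hl 1 ltr01.
have K0 : 0 < 1 + cmod l by rewrite ltr_pwDl // cmod_ge0.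
exists (Num.min d (e / (1 + cmod l))); first by rewrite lt_min d0 divr_gt0.
move=> w; rewrite lt_min => /andP[/hd h1 h2].
rewrite -(subrK (l * (w - z)) (f w - f z)).
apply: le_lt_trans (cmod_triangle _ _) _; rewrite cmodM.
apply: le_lt_trans (lerD h1 (lexx _)) _.
by rewrite -mulrDl mulrC -ltr_pdivlMr.
Qed.

Lemma cder_cvg f z (T : Type) (F : set_system T) (FF : Filter F) (u : T -> R[i]) :
  cder f z -> cmod (u x - z) @[x --> F] --> (0 : R) ->
  cmod (f (u x) - f z) @[x --> F] --> (0 : R).
Proof.
move=> /cder_cont h /cvgrPdist_lt hu; apply/cvgrPdist_lt => e /h[d d0 hd].
apply: filterS (hu d d0) => x; rewrite !sub0r !normrN !ger0_norm ?cmod_ge0 //.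
exact: hd.
Qed.

Definition reP f (x y : R) := complex.Re (f (x +i* y)).
Definition imP f (x y : R) := complex.Im (f (x +i* y)).

Lemma cauchy_riemann f x y : cder f (x +i* y) -> exists al be,
  has_diff (reP f) x y al (- be) /\ has_diff (imP f) x y be al.
Proof.
move=> /cderP[l hl].
have key e : 0 < e -> exists2 d : R, 0 < d & forall x' y', `|x' - x| < d -> `|y' - y| < d ->
    cmod (f (x' +i* y') - f (x +i* y) - l * ((x' +i* y') - (x +i* y)))
      <= e * (`|x' - x| + `|y' - y|).
  move=> e0; have [d d0 hd] := hl e e0; exists (d / 2); first by rewrite divr_gt0.
  move=> x' y' hx hy; have hw := cmod_le_ReIm ((x' +i* y') - (x +i* y)).
  apply: le_trans (hd _ _) _; first by apply: le_lt_trans hw _; lra.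
  by apply: ler_wpM2l => //; exact: ltW.
exists (complex.Re l), (complex.Im l); split=> e /key[d d0 hd]; exists d => // x' y' hx hy;
  apply: le_trans (hd x' y' hx hy).
  apply: le_trans (Re_le_cmod _); rewrite /reP !ReImE /=.
  by rewrite le_eqVlt; apply/orP; left; apply/eqP; congr `|_|; ring.
apply: le_trans (Im_le_cmod _); rewrite /imP !ReImE /=.
by rewrite le_eqVlt; apply/orP; left; apply/eqP; congr `|_|; ring.
Qed.

Lemma has_diffN (P : R -> R -> R) x y al ka : has_diff P x y al ka ->
  has_diff (fun x y => - P x y) x y (- al) (- ka).
Proof.
move=> h e /h[d d0 hd]; exists d => // x' y' hx hy.
apply: le_trans (hd x' y' hx hy); rewrite -normrN.
by rewrite le_eqVlt; apply/orP; left; apply/eqP; congr `|_|; ring.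
Qed.

Lemma cder_closed_re f x y : cder f (x +i* y) ->
  closed_at (reP f) (fun x y => - imP f x y) x y.
Proof.
move=> /cauchy_riemann[al [be [h1 h2]]]; exists al, (- be), (- al); split => //.
exact: has_diffN.
Qed.

Lemma cder_closed_im f x y : cder f (x +i* y) -> closed_at (imP f) (reP f) x y.
Proof. by move=> /cauchy_riemann[al [be [h1 h2]]]; exists be, al, (- be). Qed.

Lemma cder_cont_line f x y : cder f (x +i* y) ->
  [/\ {for x, continuous (reP f ^~ y)}, {for x, continuous (imP f ^~ y)},
      {for y, continuous (reP f x)} & {for y, continuous (imP f x)}].
Proof.
move=> /cauchy_riemann[al [be [h1 h2]]].
by split; [exact: has_diff_cont1 h1|exact: has_diff_cont1 h2
  |exact: has_diff_cont2 h1|exact: has_diff_cont2 h2].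
Qed.

Lemma cder_cmod_cont f x y : cder f (x +i* y) ->
  {for x, continuous (fun t => cmod (f (t +i* y)))} /\
  {for y, continuous (fun t => cmod (f (x +i* t)))}.
Proof.
move=> /cder_cont_line[c1 c2 c3 c4]; split.
  exact: (cvg_comp _ _ (cvgD (cvgM c1 c1) (cvgM c2 c2)) (@sqrt_continuous R _)).
exact: (cvg_comp _ _ (cvgD (cvgM c3 c3) (cvgM c4 c4)) (@sqrt_continuous R _)).
Qed.

End ComplexDifferentiability.

(** * Cauchy's formula in the half-plane *)

Section Tails.
Variable R : realType.
Implicit Types (g W : R -> R).

Lemma continuous_maxl (c : R) : continuous (fun t : R => Num.max t c).
Proof.
move=> t; apply: (@continuous_max R R id (cst c) t); first exact: cvg_id.
exact: cvg_cst.
Qed.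

Lemma seg_Int (a b : R) g : seg a b g = Int (g \_ `[a, b]).
Proof. exact: Rintegral_mkcond. Qed.

Lemma L1_patch (a b : R) g : L1 g -> L1 (g \_ `[a, b]).
Proof.
move=> hg; apply: (@L1_le _ _ (fun x => `|g x|)); last exact: L1_norm.
  apply/(measurable_restrictT _ _).1 => //.
  by apply: measurable_funTS; exact: L1_meas.
by move=> x; rewrite patchE; case: ifP => // _; rewrite normr0.
Qed.

Lemma seg_tail g : L1 g -> forall e, 0 < e -> exists A, forall X1 X2,
  X1 < - A -> A < X2 -> `|Int g - seg X1 X2 g| <= e.
Proof.
move=> hg e e0; have hn := L1_norm hg.
have [_ /cvgrPdist_lt/(_ e e0)[n _ /(_ n (leqnn n)) hN]] := @Int_dominated _
  (fun n => (fun x => `|g x|) \_ `[- n%:R, n%:R]) (fun x => `|g x|) _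
  (fun n => L1_meas (L1_patch _ _ hn)) (L1_meas hn)
  ltac:(apply: ae_all => x; apply: cvg_near_cst;
    exists (Num.bound `|x|) => // n /= hnn; rewrite patchE mem_set //= in_itv /=;
    rewrite -ler_norml; apply: (le_trans (ltW (archi_boundP (normr_ge0 x)))); by rewrite ler_nat)
  hn ltac:(move=> n x /=; rewrite patchE; case: ifP => _; rewrite ?normr0 ?normr_id //).
exists n%:R => X1 X2 h1 h2.
rewrite seg_Int -IntB //; last exact: L1_patch.
have L := L1B hg (L1_patch X1 X2 hg).
apply: le_trans (Int_norm L) _.
apply: le_trans (ltW hN).
rewrite -IntB //; last exact: L1_patch.
have L' := L1B hn (L1_patch (- n%:R) n%:R hn).
apply: le_trans (ler_norm _).
apply: Int_le => [||x]; [exact: L1_norm|exact: L'|].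
rewrite !patchE; have [hx|hx] := boolP (x \in `[- n%:R, n%:R]%classic).
  rewrite mem_set ?subrr ?normr0 //=.
  move: hx; rewrite inE /= !in_itv /= => /andP[a b].
  by rewrite (le_trans (ltW h1) a) (le_trans b (ltW h2)).
by rewrite subr0; case: ifP => _; rewrite ?subr0 // subrr normr0.
Qed.

Lemma small_value W (e B n : R) : L1 W -> (forall x, 0 <= W x) -> 0 <= n ->
  Int W < e * n -> exists x, [/\ B <= x, x <= B + n & W x < e].
Proof.
move=> hW W0 n0 hI; apply: contrapT => /forallNP H.
suff : e * n <= Int W by rewrite leNgt hI.
have Bn : B <= B + n by rewrite lerDl.
have <- : seg B (B + n) (fun=> e) = e * n.
  by rewrite seg_cst // (addrC B) addrK.
rewrite seg_Int; apply: Int_le => //.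
  have /integrable_mkcond := seg_integrable (@cont_on_cst _ B (B + n) e).
  rewrite restrict_EFin => h; apply: h; exact: measurable_itv.
move=> x; rewrite patchE; case: ifP => // /set_mem /=.
rewrite in_itv /= => /andP[x1 x2]; rewrite leNgt; apply/negP => h.
by apply: (H x).
Qed.

End Tails.

Section StripPredicates.
Variable R : realType.
Implicit Types (P Q N : R -> R -> R) (u v M : R).

Definition line_cont N := forall y : R, 0 <= y -> continuous (N^~ y).
Definition col_cont N := forall x y : R, 0 <= y -> {for y, continuous (N x)}.
Definition line_cont_off P v :=
  forall x y : R, 0 <= y -> y != v -> {for x, continuous (P^~ y)}.
Definition col_cont_off Q u :=
  forall x y : R, 0 <= y -> x != u -> {for y, continuous (Q x)}.
Definition line_sq_le N M := forall y : R, 0 <= y ->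
  (\int[@lebesgue_measure R]_(x in setT) (N x y ^+ 2)%:E <= M%:E)%E.
Definition kernel_bound P N u v := forall x y d : R,
  0 <= y -> (x != u) || (y != v) -> 0 < d ->
  2 * `|P x y| <= d * N x y ^+ 2 + d^-1 * ((x - u) ^+ 2 + (y - v) ^+ 2)^-1.

End StripPredicates.

Section HalfPlaneContour.
Variable R : realType.
Notation mu := (@lebesgue_measure R).
Variables (P Q N : R -> R -> R) (u v M : R).
Hypothesis v0 : 0 < v.
Hypothesis cN1 : line_cont N.
Hypothesis cN2 : col_cont N.
Hypothesis NM : line_sq_le N M.
Hypothesis cP : line_cont_off P v.
Hypothesis cQ : col_cont_off Q u.
Hypothesis bP : kernel_bound P N u v.
Hypothesis bQ : kernel_bound Q N u v.
Hypothesis circ0 : forall X1 X2 Y, X1 < u -> u < X2 -> v < Y -> circ P Q X1 X2 0 Y = 0.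

Lemma line_N_L1 (y : R) : 0 <= y -> L1 (fun x => N x y ^+ 2) /\ Int (fun x => N x y ^+ 2) <= M.
Proof.
move=> y0; apply: L1_ge0P; [|by move=> x; exact: sqr_ge0|exact: NM y0].
by apply: measurable_funX; apply: continuous_measurable_fun; exact: cN1 y0.
Qed.

Lemma line_P_L1 (y : R) : 0 <= y -> y != v -> L1 (P^~ y).
Proof.
move=> y0 yv; have yv0 : y - v != 0 by rewrite subr_eq0.
apply: (@L1_le _ _ (fun x => N x y ^+ 2 + ((x - u) ^+ 2 + (y - v) ^+ 2)^-1)).
- by apply: continuous_measurable_fun => x; exact: cP.
- move=> x; have := @bP x y 1 y0; rewrite yv orbT => /(_ isT ltr01).
  by rewrite invr1 !mul1r; have := normr_ge0 (P x y); lra.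
- by apply: L1D; [exact: (line_N_L1 y0).1|exact: L1_inv_den].
Qed.

Lemma line_P_bound (y d : R) : v < y -> 0 < d ->
  2 * Int (fun x => `|P x y|) <= d * M + d^-1 * (pi / (y - v)).
Proof.
move=> vy d0; have y0 : 0 <= y by apply: ltW; exact: lt_trans vy.
have yv : y != v by rewrite gt_eqF.
have yv0 : 0 < y - v by rewrite subr_gt0.
have yvn : y - v != 0 by rewrite gt_eqF.
have [NL NI] := line_N_L1 y0.
have LP := L1_norm (line_P_L1 y0 yv).
have LD := L1_inv_den u yvn.
apply: (@le_trans _ _ (Int (fun x => d * N x y ^+ 2 + d^-1 * ((x - u) ^+ 2 + (y - v) ^+ 2)^-1))).
  rewrite -IntZ //; apply: Int_le; [exact: L1Z|by apply: L1D; exact: L1Z|move=> x].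
  by apply: bP => //; rewrite yv orbT.
rewrite IntD; [|exact: L1Z|exact: L1Z].
rewrite IntZ // IntZ // Int_inv_den // lerD2r.
by apply: ler_wpM2l => //; exact: ltW.
Qed.

Definition strip_fun (Y x y : R) : R := N x (Num.max y 0) ^+ 2 * \1_(`[0, Y]) y.

Lemma max0_ge0 (y : R) : 0 <= Num.max y 0.
Proof. by rewrite le_max lexx orbT. Qed.

Lemma strip_fun_ge0 (Y x y : R) : 0 <= strip_fun Y x y.
Proof. by rewrite mulr_ge0 // sqr_ge0. Qed.

Lemma strip_fun_measurable (Y : R) :
  measurable_fun setT (fun z : R * R => strip_fun Y z.1 z.2).
Proof.
apply: (@measurable_continuous_section _ (strip_fun Y)) => [y x|x].
  apply: cvgM; last exact: cvg_cst.
  have h := @cN1 _ (max0_ge0 y) x; exact: (cvgM h h).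
apply: measurable_funM; last exact: measurable_indic.
apply: measurable_funX; apply: continuous_measurable_fun => y.
apply: (@cvg_comp _ _ _ (fun y : R => Num.max y 0) (N x)).
  exact: continuous_maxl.
exact: (@cN2 x _ (max0_ge0 y)).
Qed.

Lemma strip_cont (Y x : R) : cont_on 0 Y (fun y => N x y ^+ 2).
Proof. by move=> y y0 _; have h := @cN2 x _ y0; exact: (cvgM h h). Qed.

Lemma strip_inner (Y x : R) :
  (\int[mu]_(y in setT) (strip_fun Y x y)%:E = (seg 0 Y (fun y => N x y ^+ 2))%:E)%E.
Proof.
have iN := seg_integrable (@strip_cont Y x).
rewrite /seg /Rintegral fineK; last by apply: integrable_fin_num iN; exact: measurable_itv.
rewrite [RHS]integral_mkcond; apply: eq_integral => y _.
rewrite patchE /strip_fun indicE; case: ifP => [hy|_]; last by rewrite mulr0.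
rewrite mulr1; move: hy => /set_mem; rewrite /= in_itv /= => /andP[y0 _].
by rewrite max_l.
Qed.

Lemma line_sq_M_ge0 : 0 <= M.
Proof.
rewrite -lee_fin; apply: le_trans (NM (lexx 0)); apply: integral_ge0 => x _.
by rewrite lee_fin sqr_ge0.
Qed.

Lemma integral_cst_indic (Y : R) : 0 <= Y ->
  (\int[mu]_(y in setT) (M * \1_(`[0, Y]) y)%:E = (M * Y)%:E)%E.
Proof.
move=> Y0; under eq_integral do rewrite EFinM.
have mI : measurable_fun setT (EFin \o (\1_(`[0, Y]) : R -> R)).
  by apply/measurable_EFinP; exact: measurable_indic.
have I0 (x : R) : [set: R] x -> (0 <= (\1_(`[0, Y]) x : R)%:E)%E by rewrite lee_fin.
have -> := @ge0_integralZl_EFin _ _ _ mu setT measurableT _ I0 mI M line_sq_M_ge0.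
rewrite (@integral_indic _ _ _ mu setT measurableT); last exact: measurable_itv.
rewrite setIT; have := lebesgue_measure_itv `[0, Y]%R.
rewrite /= lte_fin => ->; case: ltgtP Y0 => // [_ _|<- _].
  by rewrite -EFinB subr0.
by rewrite mule0 mulr0.
Qed.

Lemma strip_bound (Y : R) : 0 <= Y ->
  (\int[mu]_(x in setT) \int[mu]_(y in setT) (strip_fun Y x y)%:E <= (M * Y)%:E)%E.
Proof.
move=> Y0; rewrite (tonelli_line (@strip_fun_measurable Y) (@strip_fun_ge0 Y)).
rewrite -integral_cst_indic //.
apply: ge0_le_integral; first exact: measurableT.
- by move=> y _; apply: integral_ge0 => x _; rewrite lee_fin; exact: strip_fun_ge0.
- apply: (@measurable_fun_fubini_tonelli_G _ _ _ _ R mu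
    (fun z : R * R => (strip_fun Y z.1 z.2)%:E)).
    by apply/measurable_EFinP; exact: strip_fun_measurable.
  by move=> z; rewrite lee_fin; exact: strip_fun_ge0.
- by apply/measurable_EFinP; apply: measurable_funM; [exact: measurable_cst|exact: measurable_indic].
move=> y _; rewrite /strip_fun indicE.
case: (y \in _); last first.
  by under eq_integral do rewrite mulr0; rewrite integral0 mulr0.
under eq_integral do rewrite mulr1.
by rewrite mulr1; exact: NM (max0_ge0 y).
Qed.

Lemma strip_L1 (Y : R) : 0 <= Y -> L1 (fun x => seg 0 Y (fun y => N x y ^+ 2)).
Proof.
move=> Y0; have B := strip_bound Y0.
pose W x := seg 0 Y (fun y => N x y ^+ 2).
have mW : measurable_fun setT W.
  apply/measurable_EFinP.
  rewrite (_ : _ \o _ = fun x => (\int[mu]_y (strip_fun Y x y)%:E)%E); last first.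
    by apply/funext => x /=; rewrite strip_inner.
  apply: (@measurable_fun_fubini_tonelli_F _ _ _ _ R mu
    (fun z : R * R => (strip_fun Y z.1 z.2)%:E)).
    by apply/measurable_EFinP; exact: strip_fun_measurable.
  by move=> z; rewrite lee_fin; exact: strip_fun_ge0.
have W0 x : 0 <= W x by apply: Rintegral_ge0 => y _; exact: sqr_ge0.
apply: (proj1 (@L1_ge0P _ W (M * Y) mW W0 _)).
by under eq_integral do rewrite -strip_inner.
Qed.

Lemma vertical_small (Y e A : R) : 0 < Y -> 0 < e -> u < A -> - A < u ->
  (exists X, A < X /\ `|seg 0 Y (Q X)| <= e) /\
  (exists X, X < - A /\ `|seg 0 Y (Q X)| <= e).
Proof.
move=> Y0 e0 uA Au; have LW := strip_L1 (ltW Y0).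
have cNs x := @strip_cont Y x.
set W := (X in L1 X) in LW.
have W0 x : 0 <= W x by apply: Rintegral_ge0 => y _; exact: sqr_ge0.
have WE x : W x = seg 0 Y (fun y => N x y ^+ 2) by [].
clearbody W.
have key X : X != u -> W X < e -> Y / (X - u) ^+ 2 < e -> `|seg 0 Y (Q X)| <= e.
  move=> Xu h1 h2.
  have Xu2 : 0 < (X - u) ^+ 2 by rewrite exprn_even_gt0 //= subr_eq0.
  have cQX : cont_on 0 Y (Q X) by move=> y y0 _; exact: cQ.
  have B y : 0 <= y -> y <= Y -> 2 * `|Q X y| <= N X y ^+ 2 + ((X - u) ^+ 2)^-1.
    move=> y0 _; have := @bQ X y 1 y0; rewrite Xu => /(_ isT ltr01).
    rewrite invr1 !mul1r => h; apply: le_trans h _; rewrite lerD2l.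
    by rewrite lef_pV2 ?posrE ?ltr_wpDr // ?sqr_ge0 // lerDl sqr_ge0.
  pose b := fun y => 2^-1 * (N X y ^+ 2 + ((X - u) ^+ 2)^-1).
  have cb : cont_on 0 Y b.
    move=> y y0 yY; apply: cvgM; first exact: cvg_cst.
    by apply: cvgD; [exact: cNs|exact: cvg_cst].
  have Eb : seg 0 Y b = 2^-1 * (W X + Y / (X - u) ^+ 2).
    rewrite /seg RintegralZl //; last first.
      by apply: seg_integrable; apply: cont_onD => //; exact: cont_on_cst.
    congr (_ * _); rewrite WE -/(seg 0 Y _) segD //; last exact: cont_on_cst.
    by rewrite seg_cst ?ltW // subr0 mulrC.
  have : `|seg 0 Y (Q X)| <= seg 0 Y b.
    apply: le_trans (le_normr_Rintegral _ (seg_integrable cQX)) (seg_le _ cb _) => //.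
      by move=> y y0 yY; apply: cvg_norm; exact: cQX.
    by move=> y y0 yY; have := B y y0 yY; rewrite /b; lra.
  by rewrite Eb; lra.
pose n := Int W / e + 1.
have n0 : 0 <= n by rewrite addr_ge0 // divr_ge0 ?Int_ge0 // ltW.
have hn : Int W < e * n.
  by rewrite /n mulrDr mulr1 mulrC divfK ?gt_eqF // ltrDl.
pose K := 1 + Y / e.
have K1 : 1 <= K by rewrite lerDl divr_ge0 // ltW.
have far X : K <= `|X - u| -> Y / (X - u) ^+ 2 < e.
  move=> hK; have pos : 0 < (X - u) ^+ 2.
    by rewrite -real_normK ?num_real // exprn_gt0 // (lt_le_trans ltr01) // (le_trans K1).
  rewrite ltr_pdivrMr // mulrC -ltr_pdivrMr //.
  rewrite -real_normK ?num_real // expr2.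
  have : Y / e < K by rewrite /K ltrDr.
  move=> h; apply: lt_le_trans h _; apply: (le_trans hK).
  by rewrite ler_peMr ?normr_ge0 // (le_trans K1 hK).
split.
  have [X [X1 X2 X3]] := @small_value _ W e (A + K) n LW W0 n0 hn.
  have hX : K <= `|X - u| by rewrite ger0_norm; lra.
  exists X; split; first lra.
  by apply: key => //; [rewrite gt_eqF //; lra|exact: far].
have [X [X1 X2 X3]] := @small_value _ W e (- A - K - n) n LW W0 n0 hn.
have hX : K <= `|X - u| by rewrite ler0_norm; lra.
exists X; split; first lra.
by apply: key => //; [rewrite lt_eqF //; lra|exact: far].
Qed.

Lemma half_plane_contour : Int (P^~ 0) = 0.
Proof.
have v00 : 0 != v by rewrite lt_eqF.
have LP0 := line_P_L1 (lexx 0) v00.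
have step Y e : v < Y -> 0 < e -> `|Int (P^~ 0)| <= Int (fun x => `|P x Y|) + e.
  move=> vY e0; have Y0 : 0 < Y by exact: lt_trans vY.
  have e3 : 0 < e / 3 by rewrite divr_gt0.
  have [A0 hA] := seg_tail LP0 e3.
  pose A := Num.max A0 (`|u| + 1).
  have A1 : A0 <= A by rewrite le_max lexx.
  have A2 : `|u| + 1 <= A by rewrite le_max lexx orbT.
  have uA : u < A by have := ler_norm u; lra.
  have Au : - A < u by have := ler_norm (- u); rewrite normrN; lra.
  have [[X2 [X2A hX2]] [X1 [X1A hX1]]] := vertical_small Y0 e3 uA Au.
  have := hA X1 X2; have := @circ0 X1 X2 Y; rewrite /circ => /(_ ltac:(lra) ltac:(lra) vY) c0.
  move=> /(_ ltac:(lra) ltac:(lra)) t0.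
  have LPY : L1 (P^~ Y) by apply: line_P_L1; [exact: ltW|rewrite gt_eqF].
  have hY : `|seg X1 X2 (P^~ Y)| <= Int (fun x => `|P x Y|).
    rewrite seg_Int; apply: le_trans (Int_norm (L1_patch _ _ LPY)) _.
    apply: Int_le; [exact/L1_norm/L1_patch|exact: L1_norm|].
    by move=> x; rewrite patchE; case: ifP => // _; rewrite normr0.
  move: t0 c0 hY hX1 hX2.
  set I0 := Int _; set s0 := seg _ _ (P^~ 0); set sY := seg _ _ (P^~ Y).
  set q1 := seg _ _ (Q X1); set q2 := seg _ _ (Q X2).
  move: (Int _) => IY t0 c0 hY hX1 hX2.
  have -> : I0 = (I0 - s0) + (sY + (q1 - q2)) by move: c0; lra.
  have := ler_normD (I0 - s0) (sY + (q1 - q2)); have := ler_normD sY (q1 - q2).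
  by have := ler_normB q1 q2; lra.
have M0 := line_sq_M_ge0.
apply/eqP; rewrite -normr_le0; apply/ler_addgt0Pr => e e0; rewrite add0r.
pose d := e / (M + 1); have d0 : 0 < d by rewrite divr_gt0 // ltr_wpDl.
pose Y := v + (d^-1 * pi) / (e / 2).
have p0 : 0 < d^-1 * pi :> R by rewrite mulr_gt0 ?invr_gt0 // pi_gt0.
have vY : v < Y by rewrite ltrDl divr_gt0 // divr_gt0.
have e4 : 0 < e / 4 by rewrite divr_gt0.
have := step Y _ vY e4; have := line_P_bound vY d0.
have -> : d^-1 * (pi / (Y - v)) = e / 2.
  rewrite /Y (addrC v) addrK mulrA; move: (d^-1 * pi) p0 => k k0.
  by field; rewrite !gt_eqF.
have : d * M <= e.
  rewrite /d mulrAC ler_pdivrMr ?ltr_wpDl //; rewrite ler_pM2l //; lra.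
lra.
Qed.

End HalfPlaneContour.

Section ComplexIntegral.
Variable R : realType.
Implicit Types (f g h : R -> R[i]) (c : R[i]).

Definition CL1 h := L1 (fun t => complex.Re (h t)) /\ L1 (fun t => complex.Im (h t)).
Definition Cint h : R[i] := Int (fun t => complex.Re (h t)) +i* Int (fun t => complex.Im (h t)).

Lemma CL1_ext f g : f =1 g -> CL1 f -> CL1 g.
Proof. by move=> fg; rewrite (_ : g = f) //; apply/funext. Qed.

Lemma Cint_ext f g : f =1 g -> Cint f = Cint g.
Proof. by move=> fg; rewrite (_ : g = f) //; apply/funext. Qed.

Lemma CL1D f g : CL1 f -> CL1 g -> CL1 (fun t => f t + g t).
Proof.
move=> [f1 f2] [g1 g2]; split.
  by apply: L1_ext (L1D f1 g1) => t; rewrite cReD.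
by apply: L1_ext (L1D f2 g2) => t; rewrite cImD.
Qed.

Lemma CintD f g : CL1 f -> CL1 g -> Cint (fun t => f t + g t) = Cint f + Cint g.
Proof.
move=> [f1 f2] [g1 g2]; apply: complex_eqP; rewrite ?cReD ?cImD /= -IntD //.
  by apply: Int_ext => t; rewrite cReD.
by apply: Int_ext => t; rewrite cImD.
Qed.

Lemma CL1Z c f : CL1 f -> CL1 (fun t => c * f t).
Proof.
move=> [f1 f2]; split.
  by apply: L1_ext (L1B (L1Z (complex.Re c) f1) (L1Z (complex.Im c) f2)) => t; rewrite cReM.
by apply: L1_ext (L1D (L1Z (complex.Re c) f2) (L1Z (complex.Im c) f1)) => t; rewrite cImM.
Qed.

Lemma CintZ c f : CL1 f -> Cint (fun t => c * f t) = c * Cint f.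
Proof.
move=> [f1 f2]; apply: complex_eqP; rewrite ?cReM ?cImM /= -!IntZ //.
  rewrite -IntB; [|exact: L1Z|exact: L1Z].
  by apply: Int_ext => t; rewrite cReM.
rewrite -IntD; [|exact: L1Z|exact: L1Z].
by apply: Int_ext => t; rewrite cImM.
Qed.

Lemma CL1N f : CL1 f -> CL1 (fun t => - f t).
Proof. by move=> /(CL1Z (-1)); apply: CL1_ext => t; rewrite mulN1r. Qed.

Lemma CintB f g : CL1 f -> CL1 g -> Cint (fun t => f t - g t) = Cint f - Cint g.
Proof.
move=> hf hg; rewrite CintD //; last exact: CL1N.
by congr (_ + _); rewrite -mulN1r -CintZ //; apply: Cint_ext => t; rewrite mulN1r.
Qed.

Lemma cmeas_M f g : cmeasurable f -> cmeasurable g -> cmeasurable (fun t => f t * g t).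
Proof.
move=> [f1 f2] [g1 g2]; split.
  rewrite (_ : (fun t => _) = (fun t => complex.Re (f t) * complex.Re (g t)
      - complex.Im (f t) * complex.Im (g t))); last by apply/funext => t; rewrite cReM.
  by apply: measurable_funB; exact: measurable_funM.
rewrite (_ : (fun t => _) = (fun t => complex.Re (f t) * complex.Im (g t)
    + complex.Im (f t) * complex.Re (g t))); last by apply/funext => t; rewrite cImM.
by apply: measurable_funD; exact: measurable_funM.
Qed.

Lemma cmeas_B f g : cmeasurable f -> cmeasurable g -> cmeasurable (fun t => f t - g t).
Proof.
move=> [f1 f2] [g1 g2]; split; under eq_fun do rewrite ?(cReD, cReN, cImD, cImN).
  exact: measurable_funB.
exact: measurable_funB.
Qed.

Lemma cmeas_cmod f : cmeasurable f -> measurable_fun setT (fun t => cmod (f t)).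
Proof.
move=> [f1 f2]; have m : measurable_fun setT
    (fun t => complex.Re (f t) ^+ 2 + complex.Im (f t) ^+ 2).
  by apply: measurable_funD; exact: measurable_funX.
apply: (measurableT_comp _ m); apply: continuous_measurable_fun.
exact: sqrt_continuous.
Qed.

Lemma CL1_le f (g : R -> R) : cmeasurable f -> (forall t, cmod (f t) <= g t) -> L1 g -> CL1 f.
Proof.
move=> [f1 f2] fg hg; split; apply: (L1_le _ _ hg) => // t; apply: le_trans (fg t).
  exact: Re_le_cmod.
exact: Im_le_cmod.
Qed.

Lemma CL1_mul f g : cmeasurable f -> cmeasurable g ->
  L1 (fun t => cmod (f t) ^+ 2) -> L1 (fun t => cmod (g t) ^+ 2) -> CL1 (fun t => f t * g t).
Proof.
move=> mf mg hf hg; apply: (CL1_le _ _ (L1D hf hg)); first exact: cmeas_M.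
by move=> t; have := cmod_mul_le (f t) (g t); have := cmod_ge0 (f t * g t); lra.
Qed.

Lemma CL1_meas f : CL1 f -> cmeasurable f.
Proof. by move=> [/L1_meas h1 /L1_meas h2]. Qed.

Lemma CL1_cmod f : CL1 f -> L1 (fun t => cmod (f t)).
Proof.
move=> hf; have [f1 f2] := hf.
apply: (L1_le _ _ (L1D (L1_norm f1) (L1_norm f2))).
  by apply: cmeas_cmod; exact: CL1_meas.
by move=> t; rewrite ger0_norm ?cmod_ge0 // cmod_le_ReIm.
Qed.

Lemma cmod_Cint_le f : CL1 f -> cmod (Cint f) <= 2 * Int (fun t => cmod (f t)).
Proof.
move=> hf; have [f1 f2] := hf; apply: le_trans (cmod_le_ReIm _) _ => /=.
have h := CL1_cmod hf; rewrite mulr_natl mulr2n; apply: lerD.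
  apply: le_trans (Int_norm f1) _; apply: Int_le => //; first exact: L1_norm.
  by move=> t; exact: Re_le_cmod.
apply: le_trans (Int_norm f2) _; apply: Int_le => //; first exact: L1_norm.
by move=> t; exact: Im_le_cmod.
Qed.

Definition ccontinuous h := continuous (fun t => complex.Re (h t)) /\
  continuous (fun t => complex.Im (h t)).

Lemma ccontinuous_meas h : ccontinuous h -> cmeasurable h.
Proof. by move=> [h1 h2]; split; exact: continuous_measurable_fun. Qed.

Lemma cder_line_ccontinuous (F : R[i] -> R[i]) y : (forall x, cder F (x +i* y)) ->
  ccontinuous (fun x => F (x +i* y)).
Proof. by move=> h; split=> x; have [] := cder_cont_line (h x). Qed.

End ComplexIntegral.

Section CauchyFormulaShifted.
Variable R : realType.
Lemma cmod_sub_sqr (x y u v : R) :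
  cmod (x +i* y - u +i* v) ^+ 2 = (x - u) ^+ 2 + (y - v) ^+ 2.
Proof. by rewrite cmod_sqr !ReImE. Qed.

Lemma cplx_neq (x y u v : R) : (x != u) || (y != v) -> x +i* y - u +i* v != 0.
Proof. by rewrite subr_eq0 eq_complex /= negb_and. Qed.

Lemma cplx_shift_neq0 (c e : R) (w : R[i]) : - e < complex.Im w -> w - c +i* - e != 0.
Proof. by case: w => p q /= hq; apply: cplx_neq; rewrite orbC gt_eqF. Qed.

Lemma amgm_div (a D d : R) : 0 < D -> 0 < d ->
  2 * (a / D) <= d * a ^+ 2 + d^-1 * (D ^+ 2)^-1.
Proof.
move=> D0 d0; rewrite -subr_ge0.
rewrite (_ : _ - _ = d * (a - (d * D)^-1) ^+ 2); first by rewrite mulr_ge0 ?sqr_ge0 // ltW.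
by field; rewrite !gt_eqF.
Qed.

Section Zero.
Variables (G : R[i] -> R[i]) (u v M eta : R).
Hypothesis eta0 : 0 < eta.
Hypothesis v0 : 0 < v.
Hypothesis dG : forall w, - eta < complex.Im w -> cder G w.
Hypothesis GM : forall y : R, 0 <= y -> (line_L2 G y <= M%:E)%E.
Hypothesis Gz : G (u +i* v) = 0.

Let h w := G w / (w - u +i* v).
Let N (x y : R) := cmod (G (x +i* y)).

Lemma quotient_cder x y : 0 <= y -> (x != u) || (y != v) -> cder h (x +i* y).
Proof.
move=> y0 xy; apply: cderM; first by apply: dG; apply: lt_le_trans y0; rewrite oppr_lt0.
by apply: cderV; [exact: cplx_neq|exact: cder_sub].
Qed.

Lemma quotient_bound (A : R[i] -> R) : (forall w, `|A w| <= cmod w) ->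
  kernel_bound (fun x y => A (h (x +i* y))) N u v.
Proof.
move=> hA x y d y0 xy d0; rewrite -cmod_sub_sqr.
have D0 : 0 < cmod (x +i* y - u +i* v) by rewrite cmod_gt0 cplx_neq.
apply: le_trans (amgm_div (N x y) D0 d0); apply: ler_wpM2l => //.
by apply: le_trans (hA _) _; rewrite cmodM cmodV.
Qed.

Lemma quotient_circ (P Q : R -> R -> R) :
  (forall x y, `|P x y| <= cmod (h (x +i* y)) /\ `|Q x y| <= cmod (h (x +i* y))) ->
  (forall x y, cder h (x +i* y) -> closed_at P Q x y) ->
  forall X1 X2 Y, X1 < u -> u < X2 -> v < Y -> circ P Q X1 X2 0 Y = 0.
Proof.
move=> bPQ hPQ X1 X2 Y h1 h2 h3.
have [|l hl] := @cderP _ G (u +i* v).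
  by apply: dG => /=; apply: lt_trans v0; rewrite oppr_lt0.
have [d d0 hd] := hl 1 ltr01.
apply: (@goursat_except _ _ _ _ _ _ _ u v (1 + cmod l)) => //.
  by move=> x y _ _ y0 _ xy; apply: hPQ; exact: quotient_cder.
exists (d / 2); first by rewrite divr_gt0.
move=> x y xu yv xy.
have hxy : cmod (x +i* y - u +i* v) < d.
  by apply: le_lt_trans (cmod_le_ReIm _) _; lra.
have D0 : 0 < cmod (x +i* y - u +i* v) by rewrite cmod_gt0 cplx_neq.
have hb : cmod (h (x +i* y)) <= 1 + cmod l.
  rewrite cmodM cmodV ler_pdivrMr //.
  have := hd _ hxy; rewrite Gz subr0 => hh.
  rewrite -(subrK (l * (x +i* y - u +i* v)) (G _)).
  apply: le_trans (cmod_triangle _ _) _; rewrite mulrDl cmodM lerD2r.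
  exact: hh.
by have [b1 b2] := bPQ x y; split; exact: le_trans hb.
Qed.

Lemma modulus_line_cont : line_cont N.
Proof.
by move=> y y0 x; apply: (cder_cmod_cont (dG _)).1; apply: lt_le_trans y0; rewrite oppr_lt0.
Qed.

Lemma modulus_col_cont : col_cont N.
Proof.
by move=> x y y0; apply: (cder_cmod_cont (dG _)).2; apply: lt_le_trans y0; rewrite oppr_lt0.
Qed.

Lemma cauchy_zero :
  CL1 (fun t => h (t +i* 0)) /\ Cint (fun t => h (t +i* 0)) = 0.
Proof.
have v0' : (0 : R) != v by rewrite lt_eqF.
have off x y (y0 : 0 <= y) (xy : (x != u) || (y != v)) := cder_cont_line (quotient_cder y0 xy).
have cRe : line_cont_off (reP h) v.
  by move=> x y y0 yv; have [] := off x y y0 ltac:(by rewrite yv orbT).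
have cIm : line_cont_off (imP h) v.
  by move=> x y y0 yv; have [] := off x y y0 ltac:(by rewrite yv orbT).
have kRe : col_cont_off (reP h) u.
  by move=> x y y0 xu; have [] := off x y y0 ltac:(by rewrite xu).
have kIm : col_cont_off (fun x y => - imP h x y) u.
  by move=> x y y0 xu; have [_ _ _ hh] := off x y y0 ltac:(by rewrite xu); exact: cvgN.
have bRe := quotient_bound (@Re_le_cmod R).
have bIm := quotient_bound (@Im_le_cmod R).
have bImN : kernel_bound (fun x y => - imP h x y) N u v.
  by move=> x y d; rewrite normrN; exact: bIm.
have zRe := @half_plane_contour _ _ _ _ u v M v0 modulus_line_cont modulus_col_cont GM
  cRe kIm bRe bImN.
have zIm := @half_plane_contour _ _ _ _ u v M v0 modulus_line_cont modulus_col_cont GM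
  cIm kRe bIm bRe.
have LRe := @line_P_L1 _ _ _ u v M modulus_line_cont GM cRe bRe 0 (lexx 0) v0'.
have LIm := @line_P_L1 _ _ _ u v M modulus_line_cont GM cIm bIm 0 (lexx 0) v0'.
split; first by split.
apply: complex_eqP => /=.
  apply: zRe; apply: quotient_circ => x y; last exact: cder_closed_re.
  by rewrite normrN; split; [exact: Re_le_cmod|exact: Im_le_cmod].
apply: zIm; apply: quotient_circ => x y; last exact: cder_closed_im.
by split; [exact: Im_le_cmod|exact: Re_le_cmod].
Qed.

End Zero.

End CauchyFormulaShifted.

Section WeakLimit.
Variable R : realType.
Notation mu := (@lebesgue_measure R).

Lemma weak_limit (g_ : nat -> R -> R[i]) (g phi : R -> R[i]) (M : R) :
  (forall n, cmeasurable (g_ n)) -> cmeasurable g -> cmeasurable phi ->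
  (forall n, \int[mu]_(x in setT) (cmod (g_ n x) ^+ 2)%:E <= M%:E)%E ->
  {ae mu, forall x, cmod (g_ n x - g x) @[n --> \oo] --> (0 : R)} ->
  L1 (fun x => cmod (g x) ^+ 2) -> L1 (fun x => cmod (phi x) ^+ 2) ->
  cmod (Cint (fun x => g_ n x * phi x) - Cint (fun x => g x * phi x)) @[n --> \oo] --> (0 : R).
Proof.
move=> mg_ mg mphi hM cg hg hphi.
have sq n := L1_ge0P (measurable_funX 2 (cmeas_cmod (mg_ n))) (fun x => sqr_ge0 _) (hM n).
have Lg := CL1_mul mg mphi hg hphi.
have Lg_ n := CL1_mul (mg_ n) mphi (sq n).1 hphi.
pose d n x := g_ n x - g x.
have md n : cmeasurable (d n) by exact: cmeas_B.
pose C := 2 * (M + Int (fun x => cmod (g x) ^+ 2)).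
have sd n : L1 (fun x => cmod (d n x) ^+ 2) /\ Int (fun x => cmod (d n x) ^+ 2) <= C.
  have L2 := L1Z 2 (L1D (sq n).1 hg).
  have L : L1 (fun x => cmod (d n x) ^+ 2).
    apply: (L1_le _ _ L2) => [|x]; first by apply: measurable_funX; exact: cmeas_cmod.
    by rewrite ger0_norm ?sqr_ge0 // cmod_sqr_sub.
  split => //; apply: le_trans (Int_le L L2 (fun x => cmod_sqr_sub _ _)) _.
  rewrite IntZ ?(IntD (sq n).1 hg) ?ler_wpM2l ?lerD2r ?(sq n).2 //.
  exact: L1D (sq n).1 hg.
have C0 : 0 <= C by apply: le_trans (sd 0%N).2; apply: Int_ge0 => x; exact: sqr_ge0.
have Ld n : CL1 (fun x => d n x * phi x) by exact: CL1_mul (sd n).1 hphi.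
pose m K n x := Num.max (cmod (d n x * phi x) - K^-1 * cmod (d n x) ^+ 2) 0.
have m0 K n x : 0 <= m K n x by rewrite le_max lexx orbT.
have mle K n x : 0 < K -> m K n x <= K * cmod (phi x) ^+ 2.
  move=> K0; rewrite ge_max mulr_ge0 ?sqr_ge0 ?(ltW K0) // andbT cmodM.
  move: (cmod (d n x)) (cmod (phi x)) (cmod_ge0 (d n x)) (cmod_ge0 (phi x)) => a b a0 b0.
  have := mulr_ge0 a0 b0; have : 0 <= K^-1 * (a - K * b) ^+ 2.
    by rewrite mulr_ge0 ?sqr_ge0 // invr_ge0 ltW.
  have -> : K^-1 * (a - K * b) ^+ 2 = K^-1 * a ^+ 2 - 2 * (a * b) + K * b ^+ 2.
    by field; rewrite gt_eqF.
  by lra.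
have mm K n : measurable_fun setT (m K n).
  apply: measurable_maxr; last exact: measurable_cst.
  apply: measurable_funB; first by apply: cmeas_cmod; exact: CL1_meas.
  apply: measurable_funM; first exact: measurable_cst.
  by apply: measurable_funX; exact: cmeas_cmod.
have mlim K : 0 < K -> Int (m K n) @[n --> \oo] --> (0 : R).
  move=> K0; rewrite -(Int0 R).
  apply: (@Int_dominated _ _ _ (fun x => K * cmod (phi x) ^+ 2) (mm K) _ _ _ _).2.
  - exact: measurable_cst.
  - apply: (ae_mono cg) => x cx.
    have dx : cmod (d n x) * cmod (phi x) @[n --> \oo] --> (0 : R).
      by rewrite -(mul0r (cmod (phi x))); exact: cvgM cx (cvg_cst _).
    apply: (squeeze_cvgr _ (cvg_cst 0) dx); apply: nearW => n.
    rewrite m0 /= ge_max -cmodM gerBl !mulr_ge0 ?cmod_ge0 ?sqr_ge0 ?invr_ge0 ?(ltW K0) //.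
  - exact: L1Z.
  - by move=> n x; rewrite ger0_norm ?m0 ?mle.
have key K n : 0 < K -> cmod (Cint (fun x => g_ n x * phi x) - Cint (fun x => g x * phi x))
    <= 2 * (Int (m K n) + K^-1 * C).
  move=> K0; rewrite -CintB // (@Cint_ext _ _ (fun x => d n x * phi x)); last first.
    by move=> x; rewrite mulrBl.
  apply: le_trans (cmod_Cint_le (Ld n)) _; rewrite ler_pM2l //.
  have Lm : L1 (m K n).
    by apply: (L1_le (mm K n) _ (L1Z K hphi)) => x; rewrite ger0_norm ?mle.
  have L3 := L1D Lm (L1Z K^-1 (sd n).1).
  apply: (le_trans (Int_le (CL1_cmod (Ld n)) L3 _)).
    by move=> x; rewrite -lerBlDr le_max lexx.
  rewrite IntD ?IntZ ?lerD2l ?ler_pM2l ?invr_gt0 ?(sd n).2 ?(sd n).1 //.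
  exact: L1Z (sd n).1.
apply/cvgrPdist_lt => e e0.
pose K := (8 * C + 1) / e.
have K0 : 0 < K by rewrite divr_gt0 //; lra.
have /cvgrPdist_lt/(_ (e / 4) ltac:(by rewrite divr_gt0)) := mlim K K0.
apply: filterS => n; rewrite !sub0r !normrN (ger0_norm (cmod_ge0 _)) => h1.
apply: le_lt_trans (key K n K0) _.
have h2 : K^-1 * C < e / 4.
  rewrite /K invf_div mulrAC ltr_pdivrMr //; last by lra.
  by nra.
by have := ler_norm (Int (m K n)); lra.
Qed.

End WeakLimit.

Section CauchyKernel.
Variable R : realType.
Implicit Types (F : R[i] -> R[i]) (u v x y t : R).

Definition cker (z : R[i]) (t : R) : R[i] := (t +i* 0 - z)^-1.

Lemma cker_den_neq0 u v t : v != 0 -> t +i* 0 - u +i* v != 0.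
Proof. by move=> v0; apply: cplx_neq; rewrite (eq_sym 0) v0 orbT. Qed.

Lemma cker_cmod2 u v t : cmod (cker (u +i* v) t) ^+ 2 = ((t - u) ^+ 2 + v ^+ 2)^-1.
Proof. by rewrite /cker cmodV exprVn cmod_sub_sqr sub0r sqrrN. Qed.

Lemma cker_Re u v t : complex.Re (cker (u +i* v) t) = (t - u) / ((t - u) ^+ 2 + v ^+ 2).
Proof. by rewrite /cker cReV cmod_sub_sqr sub0r sqrrN. Qed.

Lemma cker_Im u v t : complex.Im (cker (u +i* v) t) = v / ((t - u) ^+ 2 + v ^+ 2).
Proof. by rewrite /cker cImV cmod_sub_sqr sub0r sqrrN /= sub0r opprK. Qed.

Lemma cker_cont u v : v != 0 -> ccontinuous (cker (u +i* v)).
Proof.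
move=> v0; split => t.
  rewrite (_ : (fun t => _) = fun t => (t - u) / ((t - u) ^+ 2 + v ^+ 2)); last first.
    by apply/funext => s; rewrite cker_Re.
  apply: cvgM; last exact: inv_den_cont.
  by apply: cvgB; [exact: cvg_id|exact: cvg_cst].
rewrite (_ : (fun t => _) = fun t => v / ((t - u) ^+ 2 + v ^+ 2)); last first.
  by apply/funext => s; rewrite cker_Im.
by apply: cvgM; [exact: cvg_cst|exact: inv_den_cont].
Qed.

Lemma cker_meas u v : v != 0 -> cmeasurable (cker (u +i* v)).
Proof. by move=> v0; apply: ccontinuous_meas; exact: cker_cont. Qed.

Lemma cker_L2 u v : v != 0 -> L1 (fun t => cmod (cker (u +i* v) t) ^+ 2).
Proof. by move=> v0; apply: L1_ext (L1_inv_den u v0) => t; rewrite cker_cmod2. Qed.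

(* [(z - z^* ) / ((t - z) (t - z^* ))] is [2i] times [v / ((t - u)^2 + v^2)]. *)
Lemma cker_conj u v t : v != 0 ->
  (0 +i* (2 * v)) * cker (u +i* v) t * cker (u +i* - v) t
    = (0 +i* 2) * (v / ((t - u) ^+ 2 + v ^+ 2))%:C.
Proof.
move=> v0; have D0 := den_gt0 u t v0.
apply: complex_eqP; rewrite !ReImE !cker_Re !cker_Im sqrrN /=;
  set D := (t - u) ^+ 2 + v ^+ 2 in D0 *.
  by field; rewrite gt_eqF.
have -> : 2 * (v / D) = 2 * v * ((t - u) ^+ 2 + v ^+ 2) / (D * D).
  by rewrite -/D; field; rewrite gt_eqF.
by field; rewrite gt_eqF.
Qed.

Lemma line_L2P F y M : measurable_fun setT (fun x => cmod (F (x +i* y))) ->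
  (line_L2 F y <= M%:E)%E ->
  L1 (fun x => cmod (F (x +i* y)) ^+ 2) /\ Int (fun x => cmod (F (x +i* y)) ^+ 2) <= M.
Proof.
move=> m h; apply: L1_ge0P; [exact: measurable_funX|by move=> x; exact: sqr_ge0|exact: h].
Qed.

Lemma line_L2_EFin F y : L1 (fun x => cmod (F (x +i* y)) ^+ 2) ->
  line_L2 F y = (Int (fun x => cmod (F (x +i* y)) ^+ 2))%:E.
Proof. by move=> h; rewrite -Int_EFin. Qed.

Lemma cauchy_shifted F u v M eta : 0 < eta -> 0 < v ->
  (forall w, - eta < complex.Im w -> cder F w) ->
  (forall y : R, 0 <= y -> (line_L2 F y <= M%:E)%E) ->
  CL1 (fun t => F (t +i* 0) * cker (u +i* v) t) /\
  Cint (fun t => F (t +i* 0) * cker (u +i* v) t) = (0 +i* (2 * pi)) * F (u +i* v).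
Proof.
move=> eta0 v0 dF FM.
have vn0 : v != 0 by rewrite gt_eqF.
pose c := F (u +i* v) * (0 +i* (2 * v)).
pose k w := c * (w - u +i* - v)^-1.
pose G w := F w - k w.
have dk w : - v < complex.Im w -> cder k w.
  move=> hw; apply: cderM; first exact: cder_cst.
  by apply: cderV; [exact: cplx_shift_neq0|exact: cder_sub].
have dG w : - Num.min eta v < complex.Im w -> cder G w.
  rewrite ltrNl lt_min => /andP[h1 h2].
  by apply: cderB; [apply: dF|apply: dk]; rewrite ltrNl.
have GL y : 0 <= y -> (line_L2 G y <= (2 * (M + cmod c ^+ 2 * (pi / v)))%:E)%E.
  move=> y0.
  have hy w : complex.Im w = y -> - Num.min eta v < complex.Im w.
    by move=> ->; apply: lt_le_trans y0; rewrite oppr_lt0 lt_min eta0.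
  have contm (H : R[i] -> R[i]) : (forall w, complex.Im w = y -> cder H w) ->
      measurable_fun setT (fun x => cmod (H (x +i* y))).
    move=> dH; apply: cmeas_cmod; apply: ccontinuous_meas.
    by apply: cder_line_ccontinuous => x; exact: dH.
  have mG := contm G (fun w e => dG w (hy w e)).
  have hy' w : complex.Im w = y -> - eta < complex.Im w.
    by move=> ->; apply: lt_le_trans y0; rewrite oppr_lt0.
  have mF := contm F (fun w e => dF w (hy' w e)).
  have [LF IF] := line_L2P mF (FM y y0).
  have yv : 0 < y + v by rewrite ltr_wpDl.
  have LD := L1_inv_den u (lt0r_neq0 yv).
  have kE x : cmod (k (x +i* y)) ^+ 2 = cmod c ^+ 2 * ((x - u) ^+ 2 + (y + v) ^+ 2)^-1.
    by rewrite /k cmodM cmodV exprMn exprVn cmod_sub_sqr opprK.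
  have Lk : L1 (fun x => cmod (k (x +i* y)) ^+ 2).
    by apply: L1_ext (L1Z (cmod c ^+ 2) LD) => x; rewrite kE.
  have Ik : Int (fun x => cmod (k (x +i* y)) ^+ 2) <= cmod c ^+ 2 * (pi / v).
    rewrite (Int_ext kE) IntZ // Int_inv_den //; apply: ler_wpM2l; first exact: sqr_ge0.
    by rewrite ler_pM2l ?pi_gt0 // lef_pV2 ?posrE // lerDr.
  have LS := L1Z 2 (L1D LF Lk).
  have leS x : cmod (G (x +i* y)) ^+ 2 <= 2 * (cmod (F (x +i* y)) ^+ 2 + cmod (k (x +i* y)) ^+ 2).
    exact: cmod_sqr_sub.
  have LG : L1 (fun x => cmod (G (x +i* y)) ^+ 2).
    apply: (L1_le _ _ LS); first exact: measurable_funX.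
    by move=> x; rewrite ger0_norm ?sqr_ge0.
  rewrite line_L2_EFin // lee_fin; apply: le_trans (Int_le LG LS leS) _.
  rewrite IntZ ?IntD //; last exact: L1D.
  by rewrite ler_pM2l // lerD.
have Gz : G (u +i* v) = 0.
  rewrite /G /k /c -mulrA (_ : u +i* v - u +i* - v = 0 +i* (2 * v)).
    rewrite divff ?mulr1 ?subrr // eq_complex negb_and /= orbC mulf_neq0 //.
  by apply: complex_eqP; rewrite /= ?subrr // opprK mulr_natl mulr2n.
have m0 : 0 < Num.min eta v by rewrite lt_min eta0.
have [CG IG] := cauchy_zero m0 v0 dG GL Gz.
pose D t := (v / ((t - u) ^+ 2 + v ^+ 2))%:C.
have CD : CL1 D.
  split; first exact: L1Z (L1_inv_den u vn0).
  exact: L10.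
have ID : Cint D = pi%:C.
  apply: complex_eqP => /=; last exact: Int0.
  by rewrite IntZ; [rewrite Int_inv_den // mulrC divfK|exact: L1_inv_den].
pose a := F (u +i* v) * (0 +i* 2).
have E t : F (t +i* 0) * cker (u +i* v) t = G (t +i* 0) / (t +i* 0 - u +i* v) + a * D t.
  rewrite -[in RHS]/(cker (u +i* v) t) /G mulrBl.
  have -> : k (t +i* 0) * cker (u +i* v) t = a * D t; last by rewrite subrK.
  rewrite /k -/(cker (u +i* - v) t) /c /a -!mulrA -cker_conj //; congr (_ * _).
  by rewrite -!mulrA (mulrC (cker _ _)).
split; first by apply: CL1_ext (CL1D CG (CL1Z a CD)) => t; rewrite E.
rewrite (Cint_ext E) CintD //; last exact: CL1Z.
rewrite IG add0r CintZ // ID /a -mulrA mulrC; congr (_ * _).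
by apply: complex_eqP => /=; rewrite ?mulr0 ?mul0r ?subrr ?addr0 ?add0r.
Qed.

End CauchyKernel.

Section CauchyFormulaH2.
Variable R : realType.
Notation mu := (@lebesgue_measure R).
Implicit Types (f : R[i] -> R[i]) (fb : R -> R[i]) (u v : R).

Lemma cvg_complexP (w : nat -> R[i]) (l : R[i]) :
  complex.Re (w n) @[n --> \oo] --> complex.Re l ->
  complex.Im (w n) @[n --> \oo] --> complex.Im l ->
  cmod (w n - l) @[n --> \oo] --> (0 : R).
Proof.
move=> h1 h2; have h : `|complex.Re (w n) - complex.Re l| + `|complex.Im (w n) - complex.Im l|
    @[n --> \oo] --> (0 : R).
  rewrite -(addr0 0) -(normr0 R); apply: cvgD; apply: cvg_norm.
    by rewrite -(subrr (complex.Re l)); apply: cvgB => //; exact: cvg_cst.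
  by rewrite -(subrr (complex.Im l)); apply: cvgB => //; exact: cvg_cst.
apply: (squeeze_cvgr _ (cvg_cst 0) h); apply: nearW => n.
by rewrite cmod_ge0 /= -cReN -cReD -cImN -cImD cmod_le_ReIm.
Qed.

Definition eta_ (n : nat) : R := n.+1%:R^-1.

Lemma eta_gt0 n : 0 < eta_ n.
Proof. by rewrite invr_gt0. Qed.

Lemma eta_cvg : eta_ n @[n --> \oo] --> (0 : R).
Proof. exact: cvg_harmonic. Qed.

Lemma cder_vertical_cvg f u v : cder f (u +i* v) ->
  cmod (f (u +i* (v + eta_ n)) - f (u +i* v)) @[n --> \oo] --> (0 : R).
Proof.
move=> /cder_cvg; apply; under eq_fun do rewrite cmod_vertical addrAC subrr add0r.
by rewrite -(normr0 R); apply: cvg_norm; exact: eta_cvg.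
Qed.

Lemma boundary_seq f fb : boundary_value f fb ->
  {ae mu, forall t, cmod (f (t +i* eta_ n) - fb t) @[n --> \oo] --> (0 : R)}.
Proof.
move=> h; apply: (ae_mono h) => t /cvg_cmodP ct.
move/(cvg_at_rightP (fun y => cmod (f (t +i* y) - fb t))): ct => /(_ eta_) ct.
by apply: ct; split; [exact: eta_gt0|exact: eta_cvg].
Qed.

Definition shiftf f (n : nat) (w : R[i]) := f (w + 0 +i* eta_ n).

Lemma shiftfE f n x y : shiftf f n (x +i* y) = f (x +i* (y + eta_ n)).
Proof. by rewrite /shiftf; congr f; apply: complex_eqP; rewrite /= ?addr0. Qed.

Lemma shiftf_cder f n w : holomorphic_UHP f -> - eta_ n < complex.Im w -> cder (shiftf f n) w.
Proof.
move=> hf hw; apply: cder_shift; apply: hf; rewrite cImD /=.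
by rewrite -ltrBlDr sub0r.
Qed.

Lemma shiftf_line_cont f n : holomorphic_UHP f -> ccontinuous (fun t => shiftf f n (t +i* 0)).
Proof.
move=> hf; apply: cder_line_ccontinuous => t.
by apply: shiftf_cder => //=; rewrite oppr_lt0 eta_gt0.
Qed.

Lemma shiftf_line_L2 f n y M : (forall y, 0 < y -> (line_L2 f y <= M%:E)%E) -> 0 <= y ->
  (line_L2 (shiftf f n) y <= M%:E)%E.
Proof.
move=> hM y0; have := hM (y + eta_ n) (ltr_wpDl y0 (eta_gt0 n)).
by rewrite /line_L2; under eq_integral do rewrite -shiftfE.
Qed.

Lemma boundary_shift f fb : boundary_value f fb ->
  {ae mu, forall t, cmod (shiftf f n (t +i* 0) - fb t) @[n --> \oo] --> (0 : R)}.
Proof.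
move=> /boundary_seq h; apply: (ae_mono h) => t.
rewrite (_ : (fun n => cmod (shiftf f n _ - _)) = (fun n => cmod (f (t +i* eta_ n) - fb t))) //.
by apply/funext => n; rewrite shiftfE add0r.
Qed.

Lemma boundary_L2 f fb M : holomorphic_UHP f ->
  (forall y, 0 < y -> (line_L2 f y <= M%:E)%E) ->
  boundary_value f fb -> cmeasurable fb -> L1 (fun t => cmod (fb t) ^+ 2).
Proof.
move=> hf hM hb mb.
apply: (proj1 (@L1_ge0P _ _ M _ _ _)).
- by apply: measurable_funX; exact: cmeas_cmod.
- by move=> t; exact: sqr_ge0.
apply: (@fatou_le _ (fun n t => cmod (shiftf f n (t +i* 0)) ^+ 2)).
- move=> n; apply: measurable_funX; apply: cmeas_cmod; apply: ccontinuous_meas.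
  exact: shiftf_line_cont.
- by apply: measurable_funX; exact: cmeas_cmod.
- by move=> n t; exact: sqr_ge0.
- by move=> t; exact: sqr_ge0.
- by apply: (ae_mono (boundary_shift hb)) => t /cvg_cmod_cmod h; exact: (cvgM h h).
- by move=> n; have := shiftf_line_L2 n hM (lexx 0).
Qed.

Lemma cauchy_H2 f fb u v : H2 f -> boundary_value f fb -> cmeasurable fb -> 0 < v ->
  CL1 (fun t => fb t * cker (u +i* v) t) /\
  Cint (fun t => fb t * cker (u +i* v) t) = (0 +i* (2 * pi)) * f (u +i* v).
Proof.
move=> [hf [M hM]] hb mb v0; have vn0 : v != 0 by rewrite gt_eqF.
pose g n t := shiftf f n (t +i* 0); pose k := cker (u +i* v).
have mg n : cmeasurable (g n) by apply: ccontinuous_meas; exact: shiftf_line_cont.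
have mk : cmeasurable k by exact: cker_meas.
have kL : L1 (fun t => cmod (k t) ^+ 2) by exact: cker_L2.
have gM n : (\int[mu]_(t in setT) (cmod (g n t) ^+ 2)%:E <= M%:E)%E.
  exact: shiftf_line_L2.
have hbs := boundary_shift hb.
have L := boundary_L2 hf hM hb mb.
split; first exact: CL1_mul.
have c1 := weak_limit mg mb mk gM hbs L kL.
have Eg n : Cint (fun t => g n t * k t) = (0 +i* (2 * pi)) * f (u +i* (v + eta_ n)).
  rewrite -shiftfE.
  have [_ h] := @cauchy_shifted _ (shiftf f n) u v M (eta_ n) (eta_gt0 n) v0
    (fun w => @shiftf_cder f n w hf) (fun y => @shiftf_line_L2 f n y M hM).
  exact: h.
have h := cder_vertical_cvg (hf (u +i* v) v0).
have c2 : cmod (Cint (fun t => g n t * k t) - (0 +i* (2 * pi)) * f (u +i* v)) @[n --> \oo] --> (0 : R).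
  have h2 := cvgM (cvg_cst (cmod (0 +i* (2 * pi)))) h; rewrite mulr0 in h2.
  by under eq_fun do rewrite Eg -mulrBr cmodM; exact: h2.
apply: complex_eqP.
  exact: (cvg_unique _ (cvg_Re_cmod _ c1) (cvg_Re_cmod _ c2)).
exact: (cvg_unique _ (cvg_Im_cmod _ c1) (cvg_Im_cmod _ c2)).
Qed.

End CauchyFormulaH2.

(** * Blaschke products *)

Section PowerSums.
Variable R : realType.

Definition psum (p : R) (N : nat) : R := \sum_(1 <= n < N.+1) n%:R `^ (- p).

Lemma psumS p N : psum p N.+1 = psum p N + N.+1%:R `^ (- p).
Proof. by rewrite /psum big_nat_recr. Qed.

Lemma psum_ge0 p N : 0 <= psum p N.
Proof. by apply: sumr_ge0 => n _; exact: powR_ge0. Qed.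

Lemma psum_nd p : nondecreasing_seq (psum p).
Proof. by apply/nondecreasing_seqP => N; rewrite psumS lerDl powR_ge0. Qed.

Lemma powR_step (q : R) (n : nat) : 0 < q ->
  q * n.+2%:R `^ (- (q + 1)) <= n.+1%:R `^ (- q) - n.+2%:R `^ (- q).
Proof.
move=> q0; have m0 : 0 < n.+2%:R :> R by [].
have n0 : 0 < n.+1%:R :> R by [].
have B0 : 0 < n.+2%:R `^ (- q) :> R by exact: powR_gt0.
have -> : n.+2%:R `^ (- (q + 1)) = n.+2%:R `^ (- q) / n.+2%:R :> R.
  rewrite opprD powRD; first by rewrite powR_inv1.
  by apply/implyP => _; rewrite gt_eqF.
have -> : n.+1%:R `^ (- q) = n.+2%:R `^ (- q) * expR (q * (ln n.+2%:R - ln n.+1%:R)) :> R.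
  rewrite /powR !pnatr_eq0 /= -expRD; congr expR; ring.
have h1 : n.+2%:R^-1 <= ln n.+2%:R - ln n.+1%:R :> R.
  have : ln (1 + - n.+2%:R^-1) <= - n.+2%:R^-1 :> R.
    by apply: le_ln1Dx; rewrite ltrN2 invf_lt1 // ltr1n.
  have -> : 1 + - n.+2%:R^-1 = n.+1%:R / n.+2%:R :> R.
    by apply: (mulIf (lt0r_neq0 m0)); rewrite divfK ?gt_eqF // mulrDl mulNr mulVf ?gt_eqF //
      -[n.+2]addn1 natrD; ring.
  by rewrite ln_div ?posrE // lerNr opprB.
have h2 := expR_ge1Dx (q * (ln n.+2%:R - ln n.+1%:R)).
have h3 : q * n.+2%:R^-1 <= q * (ln n.+2%:R - ln n.+1%:R) by rewrite ler_pM2l.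
have h4 : 1 + q * n.+2%:R^-1 <= expR (q * (ln n.+2%:R - ln n.+1%:R)).
  by apply: le_trans h2; rewrite lerD2l.
rewrite -[X in _ <= _ - X]mulr1 -mulrBr mulrCA ler_pM2l //.
by rewrite lerBrDl.
Qed.

Lemma psum_le p N : 1 < p -> psum p N <= 1 + (p - 1)^-1.
Proof.
move=> p1; have q0 : 0 < p - 1 by rewrite subr_gt0.
have iq0 : 0 < (p - 1)^-1 by rewrite invr_gt0.
have key M : psum p M.+1 <= 1 + (p - 1)^-1 * (1 - M.+1%:R `^ (- (p - 1))).
  elim: M => [|M IH]; first by rewrite /psum big_nat1 !powR1 subrr mulr0 addr0.
  rewrite psumS; have := powR_step M q0; rewrite subrK => h.
  have : M.+2%:R `^ (- p) <= (p - 1)^-1 * (M.+1%:R `^ (- (p - 1)) - M.+2%:R `^ (- (p - 1))).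
    by rewrite ler_pdivlMl.
  by rewrite !mulrBr; move: IH; rewrite !mulrBr; lra.
case: N => [|N]; first by rewrite /psum big_geq // addr_ge0 // ltW.
apply: le_trans (key N) _; by rewrite lerD2l ler_piMr ?ltW // gerBl powR_ge0.
Qed.

Lemma psum_cvg p : 1 < p -> cvgn (psum p).
Proof.
move=> p1; apply: nondecreasing_is_cvgn; first exact: psum_nd.
by exists (1 + (p - 1)^-1) => _ [N _ <-]; exact: psum_le.
Qed.

Lemma dominated_cauchy_cvg (u s : nat -> R) (c K : R) : 0 <= c -> cvgn s ->
  (forall n, `|u n| <= K) -> (forall n m, (n <= m)%N -> `|u m - u n| <= c * (s m - s n)) ->
  exists l : R, u n @[n --> \oo] --> l.
Proof.
move=> c0 cs hu hd.
have cw : cvgn (fun n => u n + c * s n).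
  apply: nondecreasing_is_cvgn.
    apply/nondecreasing_seqP => n.
    by have := hd n n.+1 (leqnSn n); have := ler_norm (- (u n.+1 - u n)); rewrite normrN mulrBr; lra.
  have [B [Br hB]] := cvg_seq_bounded cs.
  exists (K + c * (B + 1)) => _ [n _ <-]; apply: lerD.
    by apply: le_trans (ler_norm _) _.
  apply: ler_wpM2l => //; apply: le_trans (ler_norm _) _.
  by apply: hB => //; rewrite ltrDl.
have [L hL] : exists L : R, (u n + c * s n) - c * s n @[n --> \oo] --> L.
  by exists (limn (fun n => u n + c * s n) - c * limn s); exact: cvgB cw (cvgM (cvg_cst c) cs).
exists L; rewrite (_ : u = fun n => u n + c * s n - c * s n) //.
by apply/funext => n; rewrite addrK.
Qed.

End PowerSums.

Section BlaschkeFactor.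
Variable R : realType.
Implicit Types (s : R) (z : R[i]).

Lemma bfactor_sqr1 s : (s +i* 1) ^+ 2 + 1 = (s ^+ 2) +i* (2 * s).
Proof.
by apply: complex_eqP; rewrite ?cReD ?cImD expr2 /=; ring.
Qed.

Lemma bfactor_unim_neq0 s : 0 < s -> (s +i* 1) ^+ 2 + 1 != 0.
Proof.
by move=> s0; rewrite bfactor_sqr1 eq_complex /= negb_and gt_eqF // exprn_gt0.
Qed.

Lemma cmod_unim s : 0 < s ->
  cmod ((cmod ((s +i* 1) ^+ 2 + 1))%:C / ((s +i* 1) ^+ 2 + 1)) = 1.
Proof.
move=> /bfactor_unim_neq0 h.
by rewrite cmodM cmodV cmod_real ger0_norm ?cmod_ge0 // divff // cmod_eq0.
Qed.

Lemma bfactor_den_neq0 s z : - 1 < complex.Im z -> z - (s +i* 1)^* != 0.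
Proof.
case: z => x y /= hy; rewrite eq_complex /= negb_and opprK.
by apply/orP; right; rewrite gt_eqF // -ltrBlDr sub0r.
Qed.

Lemma cmod_num_le s z : 0 <= complex.Im z -> cmod (z - s +i* 1) <= cmod (z - (s +i* 1)^*).
Proof.
move=> hz; rewrite -(@ler_pXn2r _ 2) // ?nnegrE ?cmod_ge0 // !cmod_sqr !ReImE /= opprK.
by move: hz; move: (complex.Im z) => y; nra.
Qed.

Lemma bfactor_le1 s z : 0 < s -> 0 <= complex.Im z -> cmod (bfactor (s +i* 1) z) <= 1.
Proof.
move=> s0 hz; rewrite /bfactor cmodM cmod_unim // mul1r cmodM cmodV.
have h : 0 < cmod (z - (s +i* 1)^*).
  by rewrite cmod_gt0 bfactor_den_neq0 // (lt_le_trans _ hz) // ltrN10.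
by rewrite ler_pdivrMr // mul1r cmod_num_le.
Qed.

Lemma bfactor_cder s z : - 1 < complex.Im z -> cder (bfactor (s +i* 1)) z.
Proof.
move=> hz; apply: cderM; first exact: cder_cst.
apply: cderM; first exact: cder_sub.
by apply: cderV; [exact: bfactor_den_neq0|exact: cder_sub].
Qed.

Definition bconst z : R := 2 + 2 * cmod z * (1 + cmod z).

Lemma bconst_ge0 z : 0 <= bconst z.
Proof. by rewrite /bconst addr_ge0 // !mulr_ge0 // ?addr_ge0 ?cmod_ge0. Qed.

Lemma bfactor_close s z : 1 <= s -> 0 <= complex.Im z ->
  cmod (1 - bfactor (s +i* 1) z) <= bconst z / s ^+ 2.
Proof.
move=> s1 hz; have s0 : 0 < s by exact: lt_le_trans s1.
set a := s +i* 1; pose q := a ^+ 2 + 1; pose m : R := s ^+ 2 + 1.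
pose ka := (cmod q)%:C / q.
have ka1 : cmod ka = 1 by exact: cmod_unim.
have q0 : q != 0 by exact: bfactor_unim_neq0.
have s20 : 0 < s ^+ 2 by rewrite exprn_gt0.
have m0 : 0 < m by rewrite /m; lra.
have aa : a * a^* = m%:C by apply: complex_eqP => /=; rewrite /m; ring.
have d0 : z - a^* != 0 by rewrite bfactor_den_neq0 // (lt_le_trans _ hz) // ltrN10.
have am : cmod a ^+ 2 = m by rewrite cmod_sqr /= /m expr1n.
have sa : s <= cmod a.
  by rewrite -(@ler_pXn2r _ 2) // ?nnegrE ?cmod_ge0 ?am ?ltW // /m; lra.
have a0 : a != 0 by rewrite -cmod_gt0 (lt_le_trans s0).
have aj0 : a^* != 0 by rewrite conjc_eq0.
have E : 1 - bfactor a z = ((m - cmod q)%:C + ka) / m%:C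
    + ka * ((a - a^*) * z / (a^* * (z - a^*))).
  have mz : m%:C != 0 by rewrite -aa mulf_neq0.
  have e1 : (z - a) / (z - a^*) = a / a^* - (a - a^*) * z / (a^* * (z - a^*)).
    by field; rewrite d0 aj0.
  have e2 : ka * (a / a^*) = ((cmod q)%:C - ka) / m%:C.
    have -> : a / a^* = (q - 1) / m%:C.
      by rewrite -aa /q addrK; field; rewrite aj0 a0.
    by rewrite mulrA mulrBr mulr1 /ka divfK.
  rewrite /bfactor -/q -/ka e1 mulrBr e2 opprB addrCA addrC; congr (_ + _).
  have -> : (m - cmod q)%:C = m%:C - (cmod q)%:C by apply: complex_eqP; rewrite //= oppr0 addr0.
  by field.
rewrite E; apply: le_trans (cmod_triangle _ _) _.
rewrite /bconst [X in _ <= X]mulrDl; apply: lerD.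
  rewrite cmodM cmodV cmod_real (gtr0_norm m0).
  have qsq : cmod q ^+ 2 = (s ^+ 2) ^+ 2 + 4 * s ^+ 2.
    by rewrite cmod_sqr /q bfactor_sqr1 /=; ring.
  have q1 : s ^+ 2 <= cmod q.
    rewrite -(@ler_pXn2r _ 2) // ?nnegrE ?cmod_ge0 ?qsq ?ltW //.
    by rewrite ltrDl mulr_gt0.
  have q2 : cmod q <= s ^+ 2 + 2.
    rewrite -(@ler_pXn2r _ 2) // ?nnegrE ?cmod_ge0 ?qsq ?addr_ge0 ?ltW //.
    by rewrite -subr_gt0; have -> : (s ^+ 2 + 2) ^+ 2 - ((s ^+ 2) ^+ 2 + 4 * s ^+ 2) = 4 :> R by ring.
  have h2 : cmod ((m - cmod q)%:C + ka) <= 2.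
    apply: le_trans (cmod_triangle _ _) _; rewrite cmod_real ka1.
    have : `|m - cmod q| <= 1 by rewrite ler_norml /m; apply/andP; split; lra.
    by lra.
  apply: ler_pM; [exact: cmod_ge0|by rewrite invr_ge0 ltW|exact: h2|].
  by rewrite lef_pV2 ?posrE // /m lerDl.
rewrite cmodM ka1 mul1r !cmodM cmodV cmodM cmodJ.
have -> : cmod (a - a^*) = 2.
  rewrite (_ : a - a^* = 0 +i* 2); last by apply: complex_eqP => /=; rewrite ?subrr // opprK -mulr2n.
  by rewrite /cmod /= expr0n add0r sqrtr_sqr ger0_norm.
set D := cmod (z - a^*).
have D0 : 0 < D by rewrite cmod_gt0.
have D1 : 1 <= D.
  apply: le_trans (Im_le_cmod _); rewrite !ReImE /= opprK ger0_norm ?lerDr //.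
  by rewrite addr_ge0.
have sD : s <= D * (1 + cmod z).
  have h1 : s <= cmod z + D.
    apply: le_trans sa _; rewrite -cmodJ /D cmodBC.
    by rewrite -{1}(subrK z a^*) addrC cmod_triangle.
  have h3 : cmod z <= D * cmod z by rewrite ler_peMl ?cmod_ge0.
  by rewrite mulrDr mulr1; lra.
have z0 := cmod_ge0 z.
rewrite -!mulrA; apply: ler_wpM2l => //; apply: ler_wpM2l => //.
apply: (@le_trans _ _ (s * D)^-1).
  by rewrite lef_pV2 ?posrE ?mulr_gt0 ?ler_pM2r // (lt_le_trans s0).
rewrite ler_pdivlMr //; have -> : (s * D)^-1 * s ^+ 2 = s / D by field; rewrite !gt_eqF.
by rewrite ler_pdivrMr // mulrC.
Qed.

End BlaschkeFactor.

Section BlaschkeProduct.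
Variables (R : realType) (beta : R).
Hypothesis hbeta : 1 < 2 * beta.
Implicit Types (z : R[i]).

Definition bprod (b : R) (N : nat) (z : R[i]) : R[i] :=
  \prod_(1 <= n < N.+1) bfactor (bzero b n) z.

Lemma bprod0 z : bprod beta 0 z = 1.
Proof. by rewrite /bprod big_geq. Qed.

Lemma bprodS N z : bprod beta N.+1 z = bprod beta N z * bfactor (bzero beta N.+1) z.
Proof. by rewrite /bprod big_nat_recr. Qed.

Lemma node_ge1 n : 1 <= n.+1%:R `^ beta :> R.
Proof.
have b0 : 0 <= beta by have := hbeta; lra.
rewrite -[X in X <= _](_ : (1 : R) `^ beta = 1); last by rewrite powR1.
by apply: ge0_ler_powR; rewrite ?nnegrE // ler1n.
Qed.

Lemma node_sqr n : (n.+1%:R `^ beta) ^+ 2 = n.+1%:R `^ (2 * beta) :> R.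
Proof. by rewrite -powR_mulrn ?powR_ge0 // -powRrM mulrC. Qed.

Lemma bprod_le1 N z : 0 <= complex.Im z -> cmod (bprod beta N z) <= 1.
Proof.
move=> hz; elim: N => [|N IH]; first by rewrite bprod0 cmod1.
rewrite bprodS cmodM; apply: mulr_ile1; rewrite ?cmod_ge0 //.
by apply: bfactor_le1 => //; rewrite (lt_le_trans ltr01) // node_ge1.
Qed.

Lemma bprod_cder N z : - 1 < complex.Im z -> cder (bprod beta N) z.
Proof.
move=> hz; elim: N => [|N IH].
  rewrite (_ : bprod beta 0 = fun=> 1); first exact: cder_cst.
  by apply/funext => w; rewrite bprod0.
rewrite (_ : bprod beta N.+1 = fun w => bprod beta N w * bfactor (bzero beta N.+1) w).
  by apply: cderM; [exact: IH|exact: bfactor_cder].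
by apply/funext => w; rewrite bprodS.
Qed.

Lemma bprod_step N z : 0 <= complex.Im z ->
  cmod (bprod beta N.+1 z - bprod beta N z)
    <= bconst z * (psum (2 * beta) N.+1 - psum (2 * beta) N).
Proof.
move=> hz; rewrite bprodS -{2}(mulr1 (bprod _ _ _)) -mulrBr cmodM psumS addrAC subrr add0r.
have h := bfactor_close (node_ge1 N) hz.
rewrite cmodBC powRN -node_sqr.
apply: le_trans h; rewrite -[X in _ <= X]mul1r; apply: ler_wpM2r; first exact: cmod_ge0.
exact: bprod_le1.
Qed.

Lemma bprod_dist N k z : 0 <= complex.Im z ->
  cmod (bprod beta (N + k) z - bprod beta N z)
    <= bconst z * (psum (2 * beta) (N + k) - psum (2 * beta) N).
Proof.
move=> hz; elim: k => [|k IH]; first by rewrite addn0 !subrr cmod0 mulr0.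
rewrite addnS; have := bprod_step (N + k) hz.
have := cmod_triangle (bprod beta (N + k).+1 z - bprod beta (N + k) z)
  (bprod beta (N + k) z - bprod beta N z).
by rewrite addrA subrK; move: IH; rewrite !mulrBr; lra.
Qed.

Lemma blaschke_cvg z : 0 <= complex.Im z ->
  cmod (bprod beta n z - blaschke beta z) @[n --> \oo] --> (0 : R).
Proof.
move=> hz; have cs := psum_cvg hbeta.
have hd n m : (n <= m)%N -> cmod (bprod beta m z - bprod beta n z)
    <= bconst z * (psum (2 * beta) m - psum (2 * beta) n).
  by move=> /subnKC <-; exact: bprod_dist.
have [|n m nm|a ha] := @dominated_cauchy_cvg _ (fun n => complex.Re (bprod beta n z))
    (psum (2 * beta)) (bconst z) 1 (bconst_ge0 z) cs.
- by move=> n; apply: le_trans (Re_le_cmod _) _; exact: bprod_le1.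
- by apply: le_trans (hd _ _ nm); rewrite -cReN -cReD; exact: Re_le_cmod.
have [|n m nm|b hb] := @dominated_cauchy_cvg _ (fun n => complex.Im (bprod beta n z))
    (psum (2 * beta)) (bconst z) 1 (bconst_ge0 z) cs.
- by move=> n; apply: le_trans (Im_le_cmod _) _; exact: bprod_le1.
- by apply: le_trans (hd _ _ nm); rewrite -cImN -cImD; exact: Im_le_cmod.
have hc : cmod (bprod beta n z - a +i* b) @[n --> \oo] --> (0 : R) by exact: cvg_complexP.
suff -> : blaschke beta z = a +i* b by [].
apply: cvg_lim; first exact: (@norm_hausdorff R[i] R[i]).
exact/cvg_cmodP.
Qed.

Definition ptail (N : nat) : R := limn (psum (2 * beta)) - psum (2 * beta) N.

Lemma ptail_cvg : ptail N @[N --> \oo] --> (0 : R).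
Proof.
rewrite -(subrr (limn (psum (2 * beta)))); apply: cvgB; first exact: cvg_cst.
exact: psum_cvg.
Qed.

Lemma ptail_ge0 N : 0 <= ptail N.
Proof.
rewrite subr_ge0; apply: nondecreasing_cvgn_le; first exact: psum_nd.
exact: psum_cvg.
Qed.

Lemma blaschke_tail N z : 0 <= complex.Im z ->
  cmod (blaschke beta z - bprod beta N z) <= bconst z * ptail N.
Proof.
move=> hz; apply/ler_addgt0Pr => e e0.
have /cvgrPdist_lt/(_ e e0)[m _ hm] := blaschke_cvg hz.
have := hm (m + N)%N (leq_addr _ _); rewrite sub0r normrN ger0_norm ?cmod_ge0 // => h1.
rewrite addnC in h1.
have h2 := bprod_dist N m hz.
have h3 : psum (2 * beta) (N + m) <= limn (psum (2 * beta)).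
  by apply: nondecreasing_cvgn_le; [exact: psum_nd|exact: psum_cvg].
have h4 : bconst z * (psum (2 * beta) (N + m) - psum (2 * beta) N) <= bconst z * ptail N.
  by apply: ler_wpM2l; [exact: bconst_ge0|rewrite lerD2r].
have := cmod_triangle (blaschke beta z - bprod beta (N + m) z)
  (bprod beta (N + m) z - bprod beta N z).
rewrite addrA subrK (cmodBC (blaschke beta z) (bprod beta (N + m) z)); lra.
Qed.

Lemma blaschke_le1 z : 0 <= complex.Im z -> cmod (blaschke beta z) <= 1.
Proof.
move=> hz.
have h : cmod (bprod beta n z) @[n --> \oo] --> cmod (blaschke beta z).
  by apply: cvg_cmod_cmod; exact: blaschke_cvg.
rewrite -(cvg_lim (@Rhausdorff R) h); apply: limr_le; first exact: cvgP h.
by apply: nearW => n; exact: bprod_le1.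
Qed.

Lemma bconst_mono z (r : R) : cmod z <= r -> bconst z <= 2 + 2 * r * (1 + r).
Proof.
move=> h; have z0 := cmod_ge0 z; rewrite /bconst lerD2l -!mulrA ler_pM2l //.
by apply: ler_pM => //; [rewrite addr_ge0|rewrite lerD2l].
Qed.

Lemma blaschke_boundary (t : R) :
  cmod (blaschke beta (t +i* y) - blaschke beta (t +i* 0)) @[y --> (0 : R)^'+] --> (0 : R).
Proof.
pose r : R := `|t| + 1; pose K : R := 2 + 2 * r * (1 + r).
have r0 : 0 <= r by rewrite addr_ge0.
have K0 : 0 <= K by rewrite addr_ge0 // !mulr_ge0 // addr_ge0.
have bK (y : R) : 0 <= y -> y <= 1 -> bconst (t +i* y) <= K.
  move=> y0 y1; apply: bconst_mono; apply: le_trans (cmod_le_ReIm _) _ => /=.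
  by rewrite lerD2l ger0_norm.
apply/cvgrPdist_lt => e e0.
have e3 : 0 < e / (3 * (K + 1)) by rewrite divr_gt0 // mulr_gt0 // ltr_wpDl.
have /cvgrPdist_lt/(_ _ e3)[N _ /(_ N (leqnn N))] := ptail_cvg.
rewrite /= sub0r normrN ger0_norm ?ptail_ge0 // ltr_pdivlMr ?mulr_gt0 ?ltr_wpDl // => hN.
have hB : - 1 < complex.Im (t +i* (0 : R)) by rewrite /= oppr_lt0.
have e4 : 0 < e / 3 by rewrite divr_gt0.
have [d d0 hd] := cder_cont (@bprod_cder N _ hB) e4.
near=> y.
have y0 : 0 < y by near: y; exact: nbhs_right_gt.
have y1 : y <= 1 by near: y; apply: nbhs_right_le.
have yd : y < d by near: y; apply: nbhs_right_lt.
rewrite sub0r normrN ger0_norm ?cmod_ge0 //.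
have h1 := @blaschke_tail N (t +i* y) (ltW y0).
have h2 := @blaschke_tail N (t +i* 0) (lexx 0).
have h3 : cmod (bprod beta N (t +i* y) - bprod beta N (t +i* 0)) < e / 3.
  by apply: hd; rewrite cmod_vertical subr0 ger0_norm // ltW.
have T0 := ptail_ge0 N.
have k1 : bconst (t +i* y) * ptail N <= K * ptail N by apply: ler_wpM2r => //; apply: bK => //; exact: ltW.
have k2 : bconst (t +i* 0) * ptail N <= K * ptail N by apply: ler_wpM2r => //; apply: bK.
have k3 : 3 * (K * ptail N) < e.
  by apply: le_lt_trans hN; have : 0 <= 3 * ptail N by [rewrite mulr_ge0]; lra.
have t1 := cmod_triangle (blaschke beta (t +i* y) - bprod beta N (t +i* y))
  (bprod beta N (t +i* y) - blaschke beta (t +i* 0)).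
have t2 := cmod_triangle (bprod beta N (t +i* y) - bprod beta N (t +i* 0))
  (bprod beta N (t +i* 0) - blaschke beta (t +i* 0)).
rewrite !addrA !subrK in t1 t2.
rewrite (cmodBC (bprod beta N (t +i* 0)) (blaschke beta (t +i* 0))) in t2.
move: t1 t2 h1 h2 h3 k1 k2 k3; lra.
Unshelve. all: by end_near. Qed.

Lemma bprod_line_meas N : cmeasurable (fun t => bprod beta N (t +i* 0)).
Proof.
apply: ccontinuous_meas; apply: cder_line_ccontinuous => t.
by apply: bprod_cder => /=; rewrite oppr_lt0.
Qed.

Lemma blaschke_line_meas : cmeasurable (fun t => blaschke beta (t +i* 0)).
Proof.
split.
  apply: (@measurable_fun_cvg _ _ _ setT (fun n (t : R) => complex.Re (bprod beta n (t +i* 0)))).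
    by move=> n; exact: (bprod_line_meas n).1.
  by move=> t _; apply: cvg_Re_cmod; exact: blaschke_cvg.
apply: (@measurable_fun_cvg _ _ _ setT (fun n (t : R) => complex.Im (bprod beta n (t +i* 0)))).
  by move=> n; exact: (bprod_line_meas n).2.
by move=> t _; apply: cvg_Im_cmod; exact: blaschke_cvg.
Qed.

End BlaschkeProduct.

(** * Rational approximation in the model space *)

Section ModelSpaceApproximation.
Variables (R : realType) (beta : R) (f : R[i] -> R[i]) (fb : R -> R[i]).
Hypothesis hbeta : 1 < 2 * beta.
Hypothesis hf : model_space (blaschke beta) f.
Hypothesis hfb : boundary_value f fb.
Hypothesis mfb : cmeasurable fb.
Implicit Types (z a : R[i]) (u v t : R).

Lemma cmeas_conj (h : R -> R[i]) : cmeasurable h -> cmeasurable (fun t => conjc (h t)).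
Proof.
move=> [h1 h2]; split.
  by rewrite (_ : (fun t => _) = fun t => complex.Re (h t)) //; apply/funext => t; rewrite cReJ.
rewrite (_ : (fun t => _) = fun t => - complex.Im (h t)); last by apply/funext => t; rewrite cImJ.
exact: measurable_funN.
Qed.

Lemma H2_inverse_shift u v : 0 < v -> H2 (fun w : R[i] => (w - u +i* - v)^-1).
Proof.
move=> v0.
split=> [z z0|].
  apply: cderV; last exact: cder_sub.
  by apply: cplx_shift_neq0; apply: lt_trans z0; rewrite oppr_lt0.
exists (pi / v) => y y0; rewrite /line_L2.
have yv : 0 < y + v by rewrite addr_gt0.
under eq_integral do rewrite cmodV exprVn cmod_sub_sqr opprK.
rewrite integral_inv_den // lee_fin ler_pM2l ?pi_gt0 // lef_pV2 ?posrE //.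
by rewrite lerDr ltW.
Qed.

Lemma fb_L2 : L1 (fun t => cmod (fb t) ^+ 2).
Proof. by have [[h1 [M h2]] _] := hf; exact: (@boundary_L2 _ f fb M). Qed.

Lemma fb_cker_le u v (w : R[i]) t : cmod w <= 1 ->
  2 * cmod (fb t * w * cker (u +i* v) t) <= cmod (fb t) ^+ 2 + cmod (cker (u +i* v) t) ^+ 2.
Proof.
move=> w1; apply: le_trans (cmod_mul_le _ _); rewrite ler_pM2l // !cmodM.
by rewrite ler_wpM2r ?cmod_ge0 // ler_piMr ?cmod_ge0.
Qed.

Lemma fb_cker_CL1 u v (w : R -> R[i]) : 0 < v -> cmeasurable w -> (forall t, cmod (w t) <= 1) ->
  CL1 (fun t => fb t * w t * cker (u +i* v) t).
Proof.
move=> v0 mw w1; have vn0 : v != 0 by rewrite gt_eqF.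
apply: (CL1_le _ _ (L1D fb_L2 (cker_L2 u vn0))).
  by apply: cmeas_M; [exact: cmeas_M|exact: cker_meas].
move=> t; have := fb_cker_le u v t (w1 t).
by have := cmod_ge0 (fb t * w t * cker (u +i* v) t); lra.
Qed.

Lemma fb_cker_bound u v (w : R -> R[i]) : 0 < v -> cmeasurable w -> (forall t, cmod (w t) <= 1) ->
  cmod (Cint (fun t => fb t * w t * cker (u +i* v) t))
    <= Int (fun t => cmod (fb t) ^+ 2) + pi / v.
Proof.
move=> v0 mw w1; have vn0 : v != 0 by rewrite gt_eqF.
have hC := CL1_cmod (fb_cker_CL1 u v0 mw w1); have kL := cker_L2 u vn0.
apply: le_trans (cmod_Cint_le (fb_cker_CL1 u v0 mw w1)) _.
have -> : pi / v = Int (fun t => cmod (cker (u +i* v) t) ^+ 2).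
  by rewrite -(Int_inv_den u v0); apply: Int_ext => t; rewrite cker_cmod2.
rewrite -(IntD fb_L2 kL) -IntZ //.
by apply: Int_le; [exact: L1Z|exact: L1D fb_L2 kL|move=> t; exact: fb_cker_le].
Qed.

Definition Bline N t := bprod beta N (t +i* 0).

Lemma Bline_conj_meas N : cmeasurable (fun t => conjc (Bline N t)).
Proof. by apply: cmeas_conj; exact: bprod_line_meas. Qed.

Lemma Bline_conj_le1 N t : cmod (conjc (Bline N t)) <= 1.
Proof. by rewrite cmodJ; exact: bprod_le1. Qed.

Lemma Bconj_meas : cmeasurable (fun t => conjc (blaschke beta (t +i* 0))).
Proof. by apply: cmeas_conj; exact: blaschke_line_meas. Qed.

Lemma Bconj_le1 t : cmod (conjc (blaschke beta (t +i* 0))) <= 1.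
Proof. by rewrite cmodJ; exact: blaschke_le1. Qed.

Lemma model_orth u v : 0 < v ->
  Cint (fun t => fb t * conjc (blaschke beta (t +i* 0)) * cker (u +i* v) t) = 0.
Proof.
move=> v0; have [_ orth] := hf.
pose g w : R[i] := (w - u +i* - v)^-1.
pose hb t := blaschke beta (t +i* 0) * cker (u +i* - v) t.
have vn0 : - v != 0 by rewrite oppr_eq0 gt_eqF.
have bv : boundary_value (fun z => blaschke beta z * g z) hb.
  apply: ae_all => t; apply/cvg_cmodP.
  have hg : cmod (g (t +i* y) - g (t +i* 0)) @[y --> (0 : R)^'+] --> (0 : R).
    apply: cder_cvg.
      by apply: cderV; [exact: cker_den_neq0|exact: cder_sub].
    under eq_fun do rewrite cmod_vertical subr0.
    have h : `|y| @[y --> (0 : R)^'+] --> `|0 : R|.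
      by apply: cvg_norm; apply: cvg_at_right_filter; apply: cvg_id.
    by rewrite normr0 in h.
  have hB := blaschke_boundary hbeta t.
  have hs : cmod (g (t +i* y) - g (t +i* 0))
      + cmod (blaschke beta (t +i* y) - blaschke beta (t +i* 0)) * cmod (g (t +i* 0))
      @[y --> (0 : R)^'+] --> (0 : R).
    have h := cvgD hg (cvgM hB (cvg_cst (cmod (g (t +i* 0))))).
    by rewrite mul0r addr0 in h; exact: h.
  apply: (squeeze_cvgr _ (cvg_cst 0) hs).
  near=> y; rewrite cmod_ge0 /=.
  have y0 : 0 <= y by apply: ltW; near: y; exact: nbhs_right_gt.
  rewrite /hb -[cker _ _]/(g (t +i* 0)).
  rewrite (_ : _ - _ = blaschke beta (t +i* y) * (g (t +i* y) - g (t +i* 0))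
     + (blaschke beta (t +i* y) - blaschke beta (t +i* 0)) * g (t +i* 0)); last by ring.
  apply: le_trans (cmod_triangle _ _) _; rewrite !cmodM lerD2r.
  by rewrite ler_piMl ?cmod_ge0 // blaschke_le1.
have mhb : cmeasurable hb.
  by apply: cmeas_M; [exact: blaschke_line_meas|exact: cker_meas].
have [ho1 ho2] := orth fb hfb mfb g hb (H2_inverse_shift u v0) bv mhb.
have E t : fb t * (hb t)^* = fb t * conjc (blaschke beta (t +i* 0)) * cker (u +i* v) t.
  rewrite Num_conjE /hb conjcM mulrA; congr (_ * _); rewrite /cker conjcV; congr (_^-1).
  by apply: complex_eqP; rewrite !ReImE /=; ring.
apply: complex_eqP => /=; rewrite /Int /Rintegral.
  by under eq_integral do rewrite -E; rewrite ho1.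
by under eq_integral do rewrite -E; rewrite ho2.
Unshelve. all: by end_near. Qed.

(* [AN N z] is the Cauchy integral of [fb B_N^*] at [z], up to the factor [2 pi i]; by
   orthogonality it tends to 0. *)
Definition AN N z := Cint (fun t => fb t * conjc (Bline N t) * cker z t).

Definition twopii : R[i] := 0 +i* (2 * pi).

Lemma twopii_neq0 : twopii != 0.
Proof. by rewrite eq_complex /= negb_and orbC gt_eqF // mulr_gt0 // pi_gt0. Qed.

Lemma cmod_twopii : cmod twopii = 2 * pi.
Proof. by rewrite /cmod /= expr0n add0r sqrtr_sqr ger0_norm // mulr_ge0 // pi_ge0. Qed.

Definition fN N z := f z - bprod beta N z * AN N z / twopii.

Lemma AN_cvg u v : 0 < v -> cmod (AN N (u +i* v)) @[N --> \oo] --> (0 : R).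
Proof.
move=> v0; have vn0 : v != 0 by rewrite gt_eqF.
have mN N : cmeasurable (fun t => fb t * conjc (Bline N t) * cker (u +i* v) t).
  by apply: CL1_meas; apply: fb_cker_CL1 => //; [exact: Bline_conj_meas|exact: Bline_conj_le1].
have mB : cmeasurable (fun t => fb t * conjc (blaschke beta (t +i* 0)) * cker (u +i* v) t).
  by apply: CL1_meas; apply: fb_cker_CL1 => //; [exact: Bconj_meas|exact: Bconj_le1].
pose G t := cmod (fb t) ^+ 2 + cmod (cker (u +i* v) t) ^+ 2.
have LG : L1 G by exact: L1D fb_L2 (cker_L2 u vn0).
have bG (w : R[i]) t : cmod w <= 1 -> cmod (fb t * w * cker (u +i* v) t) <= G t.
  move=> w1; have := fb_cker_le u v t w1.
  by have := cmod_ge0 (fb t * w * cker (u +i* v) t); rewrite /G; lra.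
have ptw t : cmod (fb t * conjc (Bline N t) * cker (u +i* v) t
    - fb t * conjc (blaschke beta (t +i* 0)) * cker (u +i* v) t) @[N --> \oo] --> (0 : R).
  have h := cvgM (cvg_cst (cmod (fb t) * cmod (cker (u +i* v) t)))
    (@blaschke_cvg R beta hbeta (t +i* 0) (lexx 0)).
  rewrite mulr0 in h; rewrite (_ : (fun N => _) = fun N => cmod (fb t) * cmod (cker (u +i* v) t)
    * cmod (bprod beta N (t +i* 0) - blaschke beta (t +i* 0))); first exact: h.
  apply/funext => N; rewrite -mulrBl -mulrBr !cmodM -rmorphB /= cmodJ mulrAC //.
have c := @cvg_complexP R (fun N => AN N (u +i* v)) 0.
rewrite (_ : (fun N => _) = fun N => cmod (AN N (u +i* v) - 0)); last by apply/funext => N; rewrite subr0.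
apply: c; rewrite -(model_orth u v0).
  apply: (@Int_dominated _ _ _ G (fun N => (mN N).1) mB.1 _ LG _).2.
    by apply: ae_all => t; apply: cvg_Re_cmod; exact: ptw.
  by move=> N t; apply: le_trans (Re_le_cmod _) _; apply: bG; exact: Bline_conj_le1.
apply: (@Int_dominated _ _ _ G (fun N => (mN N).2) mB.2 _ LG _).2.
  by apply: ae_all => t; apply: cvg_Im_cmod; exact: ptw.
by move=> N t; apply: le_trans (Im_le_cmod _) _; apply: bG; exact: Bline_conj_le1.
Qed.

Lemma fN_cvg u v : 0 < v -> cmod (fN N (u +i* v) - f (u +i* v)) @[N --> \oo] --> (0 : R).
Proof.
move=> v0.
have h : cmod (AN N (u +i* v)) * (cmod twopii)^-1 @[N --> \oo] --> (0 : R).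
  by have := cvgM (AN_cvg u v0) (cvg_cst (cmod twopii)^-1); rewrite mul0r; apply.
apply: (squeeze_cvgr _ (cvg_cst 0) h); apply: nearW => N.
rewrite cmod_ge0 /= /fN addrAC subrr add0r cmodN cmodM cmodV ler_wpM2r ?invr_ge0 ?cmod_ge0 //.
by rewrite cmodM ler_piMl ?cmod_ge0 // bprod_le1 //= ltW.
Qed.

Lemma f_cauchy u v : 0 < v -> twopii * f (u +i* v) = Cint (fun t => fb t * 1 * cker (u +i* v) t).
Proof.
move=> v0; have [hH _] := hf; have [_ <-] := cauchy_H2 u hH hfb mfb v0.
by apply: Cint_ext => t; rewrite mulr1.
Qed.

Lemma fN_bound N u v : 0 < v ->
  cmod (fN N (u +i* v)) <= (Int (fun t => cmod (fb t) ^+ 2) + pi / v) / pi.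
Proof.
move=> v0; set C := _ + _.
have h1 : cmod (twopii * f (u +i* v)) <= C.
  rewrite f_cauchy //; apply: (@fb_cker_bound u v (fun=> 1) v0).
    by split; exact: measurable_cst.
  by move=> t; rewrite cmod1.
have h2 : cmod (bprod beta N (u +i* v) * AN N (u +i* v)) <= C.
  rewrite cmodM; apply: le_trans (fb_cker_bound u v0 (Bline_conj_meas N) (Bline_conj_le1 N)).
  by rewrite ler_piMl ?cmod_ge0 // bprod_le1 //= ltW.
have -> : fN N (u +i* v) = (twopii * f (u +i* v) - bprod beta N (u +i* v) * AN N (u +i* v)) / twopii.
  by rewrite /fN mulrBl; congr (_ - _); rewrite mulrAC divff ?twopii_neq0 ?mul1r.
rewrite cmodM cmodV cmod_twopii ler_pdivrMr ?mulr_gt0 ?pi_gt0 //.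
apply: le_trans (cmod_triangleB _ _) _; apply: le_trans (lerD h1 h2) _.
have E (x : R) : x / pi * (2 * pi) = x + x by rewrite mulrA mulrAC divfK ?mulr_natr ?mulr2n // gt_eqF ?pi_gt0.
by rewrite E.
Qed.

Lemma bfactor_kernel (s t : R) z : 0 < s -> - 1 < complex.Im z ->
  1 - bfactor (s +i* 1) z * conjc (bfactor (s +i* 1) (t +i* 0))
  = (0 +i* 2) / (z - (s +i* 1)^*) * (t +i* 0 - z) * cker (s +i* 1) t.
Proof.
move=> s0 hz; set a := s +i* 1.
have d1 : z - a^* != 0 by exact: bfactor_den_neq0.
have d2 : t +i* 0 - a != 0 by exact: cker_den_neq0.
have d3 : (t +i* 0) - a^* != 0 by rewrite bfactor_den_neq0 //= oppr_lt0.
pose k := (cmod (a ^+ 2 + 1))%:C / (a ^+ 2 + 1).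
have k1 : k * k^* = 1.
  by rewrite -sqr_normc cmodE (_ : cmod k = 1) ?expr1n //; exact: cmod_unim.
have ct : conjc (t +i* 0) = t +i* 0 by apply: complex_eqP => //=; rewrite oppr0.
rewrite !Num_conjE in d1 d3 k1.
rewrite /bfactor -/k !Num_conjE; move: k k1 => k k1.
rewrite !conjcM !conjcV !conjcB conjcK ct.
rewrite (_ : 0 +i* 2 = a - conjc a); last first.
  by apply: complex_eqP => /=; rewrite ?subrr // opprK -mulr2n.
have -> : k * ((z - a) / (z - conjc a)) * (conjc k * ((t +i* 0 - conjc a) / (t +i* 0 - a)))
   = k * conjc k * (((z - a) / (z - conjc a)) * ((t +i* 0 - conjc a) / (t +i* 0 - a))) by ring.
rewrite k1 mul1r /cker -/a; field.
by rewrite d1 d2.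
Qed.

Lemma fN_step N u v : 0 < v -> let z := u +i* v in let a := bzero beta N.+1 in
  fN N.+1 z = fN N z + bprod beta N z * ((0 +i* 2) / (z - a^*) * AN N a) / twopii.
Proof.
move=> v0 /=; set z := u +i* v; set a := bzero beta N.+1.
have s0 : 0 < N.+1%:R `^ beta :> R by exact: powR_gt0.
have hz : - 1 < complex.Im z by rewrite /= (lt_trans _ v0) // oppr_lt0.
have CN M : CL1 (fun t => fb t * conjc (Bline M t) * cker z t).
  by apply: fb_cker_CL1 => //; [exact: Bline_conj_meas|exact: Bline_conj_le1].
have Ca : CL1 (fun t => fb t * conjc (Bline N t) * cker a t).
  by apply: fb_cker_CL1 => //; [exact: Bline_conj_meas|exact: Bline_conj_le1].
have E : AN N z - bfactor a z * AN N.+1 z = (0 +i* 2) / (z - a^*) * AN N a.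
  rewrite /AN -CintZ // -CintB //; last exact: CL1Z.
  rewrite -CintZ //; apply: Cint_ext => t.
  have -> : conjc (Bline N.+1 t) = conjc (Bline N t) * conjc (bfactor a (t +i* 0)).
    by rewrite /Bline bprodS; exact: rmorphM.
  have tz : t +i* 0 - z != 0 by apply: cker_den_neq0; rewrite gt_eqF.
  have -> : fb t * conjc (Bline N t) * cker z t
     - bfactor a z * (fb t * (conjc (Bline N t) * conjc (bfactor a (t +i* 0))) * cker z t)
     = fb t * conjc (Bline N t) * cker z t * (1 - bfactor a z * conjc (bfactor a (t +i* 0))) by ring.
  rewrite bfactor_kernel // -/a.
  have -> : cker z t = (t +i* 0 - z)^-1 by [].
  by move: (0 +i* 2) (cker a t) => c k; field; rewrite tz bfactor_den_neq0.
rewrite -E /fN bprodS -/a; field.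
exact: twopii_neq0.
Qed.

Lemma bprod_poly N : exists q : {poly R[i]}, forall z, - 1 < complex.Im z ->
  bprod beta N z * \prod_(1 <= n < N.+1) (z - (bzero beta n)^*) = q.[z].
Proof.
elim: N => [|N [q hq]].
  by exists 1 => z _; rewrite bprod0 big_geq // mul1r hornerC.
set a := bzero beta N.+1.
exists (q * ((cmod (a ^+ 2 + 1))%:C / (a ^+ 2 + 1))%:P * ('X - a%:P)) => z hz.
have -> : \prod_(1 <= n < N.+2) (z - (bzero beta n)^*)
    = (\prod_(1 <= n < N.+1) (z - (bzero beta n)^*)) * (z - a^*) by rewrite big_nat_recr.
rewrite bprodS !hornerM hornerC hornerXsubC -hq // /bfactor -/a.
by field; rewrite (bfactor_den_neq0 _ hz) (bfactor_unim_neq0 (powR_gt0 _ _)).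
Qed.

Lemma fN_poly N : exists p : {poly R[i]}, forall u v, 0 < v ->
  fN N (u +i* v) * \prod_(1 <= n < N.+1) (u +i* v - (bzero beta n)^*) = p.[u +i* v].
Proof.
elim: N => [|N [p hp]].
  exists 0 => u v v0; rewrite horner0 big_geq // mulr1 /fN bprod0 mul1r.
  have -> : AN 0 (u +i* v) = twopii * f (u +i* v).
    by rewrite f_cauchy // /AN; apply: Cint_ext => t; rewrite /Bline bprod0 conjc1.
  by rewrite mulrAC divff ?twopii_neq0 // mul1r subrr.
have [q hq] := bprod_poly N; set a := bzero beta N.+1.
exists (p * ('X - (a^*)%:P) + q * ((0 +i* 2) * AN N a / twopii)%:P) => u v v0.
have hz : - 1 < complex.Im (u +i* v) by rewrite /= (lt_trans _ v0) // oppr_lt0.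
have -> : \prod_(1 <= n < N.+2) (u +i* v - (bzero beta n)^*)
    = (\prod_(1 <= n < N.+1) (u +i* v - (bzero beta n)^*)) * (u +i* v - a^*).
  by rewrite big_nat_recr.
rewrite hornerD !hornerM hornerC hornerXsubC -hp // -hq // fN_step // -/a.
have dn := bfactor_den_neq0 (N.+1%:R `^ beta) hz.
rewrite ?Num_conjE in dn *.
move: (0 +i* 2) (\prod_(1 <= n < N.+1) _) (AN N a) => c P A.
by field; rewrite twopii_neq0 (bfactor_den_neq0 _ hz).
Qed.

End ModelSpaceApproximation.

(** * Jensen inequality for the Poisson kernel *)

Section LogQuadratic.
Variable R : realType.
Notation mu := (@lebesgue_measure R).

Lemma is_derive_ln_quad (A B s : R) : 0 < A * s ^+ 2 + B * s + 1 ->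
  is_derive s 1 (fun s => ln (A * s ^+ 2 + B * s + 1))
    ((2 * A * s + B) / (A * s ^+ 2 + B * s + 1)).
Proof.
move=> h.
have dq : is_derive s 1 (fun s : R => A * s ^+ 2 + B * s + 1) (2 * A * s + B).
  apply: is_derive_eq; rewrite /GRing.scale /= ; ring.
have := @is_derive1_comp _ (@ln R) (fun s : R => A * s ^+ 2 + B * s + 1) s
  (A * s ^+ 2 + B * s + 1)^-1 (2 * A * s + B) (is_derive1_ln h) dq.
by rewrite mulrC.
Qed.

Lemma ratio_cont (A B s : R) : 0 < A * s ^+ 2 + B * s + 1 ->
  {for s, continuous (fun s : R => (2 * A * s + B) / (A * s ^+ 2 + B * s + 1))}.
Proof.
move=> h.
have cid : (fun x : R => x) x @[x --> s] --> s by exact: cvg_id.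
have cc (c : R) : (fun x : R => c) x @[x --> s] --> c by exact: cvg_cst.
apply: cvgM; first by apply: cvgD; [exact: (cvgM (cc (2 * A)) cid)|exact: cc].
apply: cvgV; first exact: lt0r_neq0.
apply: cvgD; last exact: cc.
apply: cvgD; last exact: (cvgM (cc B) cid).
exact: (cvgM (cc A) (cvgM cid cid)).
Qed.

Lemma integral_ln_quad (A B S : R) : 0 < S ->
  (forall s : R, 0 <= s -> 0 < A * s ^+ 2 + B * s + 1) ->
  (\int[mu]_(s in `[0%R, S]) ((2 * A * s + B) / (A * s ^+ 2 + B * s + 1))%:E
    = (ln (A * S ^+ 2 + B * S + 1))%:E)%E.
Proof.
move=> S0 h.
pose F (s : R) := ln (A * s ^+ 2 + B * s + 1).
pose g (s : R) := (2 * A * s + B) / (A * s ^+ 2 + B * s + 1).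
have dF (s : R) : 0 <= s -> is_derive s 1 F (g s) by move=> s0; apply: is_derive_ln_quad; exact: h.
have cF (s : R) : 0 <= s -> {for s, continuous F}.
  by move=> s0; apply/differentiable_continuous/derivable1_diffP; have [] := dF s s0.
rewrite (@continuous_FTC2 _ g F 0 S) //.
- by rewrite /F expr0n /= !mulr0 !add0r ln1 oppr0 adde0.
- by apply: cont_on_within => s s0 _; exact: ratio_cont (h s s0).
- split.
  + by move=> s; rewrite in_itv /= => /andP[/ltW s0 _]; have [] := dF s s0.
  + by apply: cvg_at_right_filter; exact: cF.
  + by apply: cvg_at_left_filter; apply: cF; exact: ltW.
- move=> s; rewrite in_itv /= => /andP[/ltW s0 _].
  by rewrite derive1E; have [_ ->] := dF s s0.
Qed.

End LogQuadratic.

Section PoissonJensen.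
Variables (R : realType) (u v : R).
Hypothesis v0 : 0 < v.

Definition poisson (x : R) : R := v / pi * ((x - u) ^+ 2 + v ^+ 2)^-1.

Lemma poisson_ge0 x : 0 <= poisson x.
Proof.
by rewrite !mulr_ge0 ?invr_ge0 ?pi_ge0 ?ltW ?den_gt0 ?gt_eqF // ?invr_gt0 ?pi_gt0.
Qed.

Lemma poisson_cont : continuous poisson.
Proof.
by move=> x; apply: cvgM; [exact: cvg_cst|apply: inv_den_cont; rewrite gt_eqF].
Qed.

Lemma poisson_L1 : L1 poisson.
Proof. by apply: L1Z; apply: L1_inv_den; rewrite gt_eqF. Qed.

Lemma poisson_Int : Int poisson = 1.
Proof.
rewrite IntZ; last by apply: L1_inv_den; rewrite gt_eqF.
by rewrite Int_inv_den // mulrA divfK ?divff ?gt_eqF ?pi_gt0.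
Qed.

Lemma den_mul_cker (t : R) :
  cker (u +i* v) t * cker (u +i* - v) t = ((t - u) ^+ 2 + v ^+ 2)^-1 %:C.
Proof.
have vn0 : v != 0 by rewrite gt_eqF.
apply: complex_eqP; rewrite !ReImE !cker_Re !cker_Im sqrrN /=;
  have := den_gt0 u t vn0; set D := _ + _ => D0; last by field; rewrite gt_eqF.
have -> : (t - u) / D * ((t - u) / D) - v / D * (- v / D) = ((t - u) ^+ 2 + v ^+ 2) / (D * D).
  by field; rewrite gt_eqF.
by rewrite -/D; field; rewrite gt_eqF.
Qed.

(* Cauchy's formula for [1 / ((w - z^* ) (w - a + i b))] at [z = u + i v]. *)
Lemma poisson_semigroup (a b : R) : 0 < b ->
  L1 (fun x => poisson x * (b / ((x - a) ^+ 2 + b ^+ 2))) /\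
  Int (fun x => poisson x * (b / ((x - a) ^+ 2 + b ^+ 2)))
    = (v + b) / ((u - a) ^+ 2 + (v + b) ^+ 2).
Proof.
move=> b0; have vn0 : v != 0 by rewrite gt_eqF.
have bn0 : - b != 0 by rewrite oppr_eq0 gt_eqF.
pose F (w : R[i]) := (w - u +i* - v)^-1 * (w - a +i* - b)^-1.
have m0 : 0 < Num.min v b by rewrite lt_min v0.
have dF w : - Num.min v b < complex.Im w -> cder F w.
  rewrite ltrNl lt_min => /andP[h1 h2].
  apply: cderM; apply: cderV; try exact: cder_sub.
    by apply: cplx_shift_neq0; rewrite ltrNl.
  by apply: cplx_shift_neq0; rewrite ltrNl.
have FM y : 0 <= y -> (line_L2 F y <= (v ^- 2 * (pi / b))%:E)%E.
  move=> y0; have yb : 0 < y + b by rewrite ltr_wpDl.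
  have yv : v <= y + v by rewrite lerDr.
  have E x : cmod (F (x +i* y)) ^+ 2 <= v ^- 2 * ((x - a) ^+ 2 + (y + b) ^+ 2)^-1.
    rewrite cmodM !cmodV exprMn !exprVn !cmod_sub_sqr !opprK; apply: ler_wpM2r.
      by rewrite invr_ge0 ltW // den_gt0 // gt_eqF.
    rewrite lef_pV2 ?posrE ?exprn_gt0 // ?den_gt0 ?gt_eqF ?(lt_le_trans v0) //.
    rewrite ler_wpDl ?sqr_ge0 // ler_pXn2r // ?nnegrE ?ltW // (lt_le_trans v0) //.
  have LD := L1Z (v ^- 2) (L1_inv_den a (lt0r_neq0 yb)).
  have mF : measurable_fun setT (fun x => cmod (F (x +i* y))).
    apply: cmeas_cmod; apply: ccontinuous_meas; apply: cder_line_ccontinuous => x.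
    by apply: dF; rewrite /= (lt_le_trans _ y0) // oppr_lt0.
  have LF : L1 (fun x => cmod (F (x +i* y)) ^+ 2).
    apply: (L1_le _ _ LD); first exact: measurable_funX.
    by move=> x; rewrite ger0_norm ?sqr_ge0.
  rewrite line_L2_EFin // lee_fin; apply: le_trans (Int_le LF LD E) _.
  rewrite IntZ; last exact: L1_inv_den (lt0r_neq0 yb).
  rewrite Int_inv_den // ler_wpM2l ?invr_ge0 ?sqr_ge0 // ler_pM2l ?pi_gt0 //.
  by rewrite lef_pV2 ?posrE // lerDr.
have [CF IF] := @cauchy_shifted R F u v _ _ m0 v0 dF FM.
have E t : F (t +i* 0) * cker (u +i* v) t = ((t - u) ^+ 2 + v ^+ 2)^-1 %:C * cker (a +i* - b) t.
  by rewrite -den_mul_cker /F -!/(cker _ _) mulrC mulrA.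
have EI t : complex.Im (F (t +i* 0) * cker (u +i* v) t)
    = - (pi / v) * (poisson t * (b / ((t - a) ^+ 2 + b ^+ 2))).
  rewrite E cImM cker_Im /= mul0r addr0 sqrrN /poisson.
  have := den_gt0 u t vn0; set D := _ + _ => D0.
  have := den_gt0 a t (lt0r_neq0 b0); set D' := _ + _ => D'0.
  by move: (@pi R) (pi_gt0 R) => p p0; field; rewrite !gt_eqF.
have FI : complex.Im ((0 +i* (2 * pi)) * F (u +i* v))
    = - (pi / v) * ((v + b) / ((u - a) ^+ 2 + (v + b) ^+ 2)).
  have -> : F (u +i* v) = (0 +i* (- (2 * v)^-1)) * ((u - a) +i* (v + b))^-1.
    have e1 : u +i* v - u +i* - v = 0 +i* (2 * v) by apply: complex_eqP; rewrite !ReImE /=; ring.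
    have e2 : u +i* v - a +i* - b = (u - a) +i* (v + b) by apply: complex_eqP; rewrite !ReImE /=; ring.
    rewrite /F e1 e2; congr (_ * _).
    apply: complex_eqP; first by rewrite cReV /= mul0r.
    by rewrite cImV cmod_sqr /=; field; rewrite gt_eqF.
  have h : 0 < (u - a) ^+ 2 + (v + b) ^+ 2 by rewrite den_gt0 // gt_eqF // addr_gt0.
  rewrite !ReImE cReV cImV cmod_sqr /=; move: h; set D := _ + _ => h.
  by move: (@pi R) (pi_gt0 R) => p p0; field; rewrite !gt_eqF.
have cn0 : - (pi / v) != 0 by rewrite oppr_eq0 gt_eqF // divr_gt0 // pi_gt0.
have C2 := CF.2.
rewrite (_ : (fun t => _) = fun t => - (pi / v) * (poisson t * (b / ((t - a) ^+ 2 + b ^+ 2)))) in C2;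
  last by apply/funext => t; exact: EI.
have LG : L1 (fun x => poisson x * (b / ((x - a) ^+ 2 + b ^+ 2))).
  by apply: L1_ext (L1Z (- (pi / v))^-1 C2) => t; rewrite mulKf.
split => //; apply: (mulfI cn0); rewrite -FI -IF -IntZ //.
by apply: Int_ext => t; exact: esym (EI t).
Qed.

Lemma poisson_ratio (a s : R) : 0 < s ->
  let d := u - a in
  L1 (fun x => poisson x * ((2 * (x - a) ^+ 2 * s) / ((x - a) ^+ 2 * s ^+ 2 + 1))) /\
  Int (fun x => poisson x * ((2 * (x - a) ^+ 2 * s) / ((x - a) ^+ 2 * s ^+ 2 + 1)))
   = (2 * (d ^+ 2 + v ^+ 2) * s + 2 * v) / ((d ^+ 2 + v ^+ 2) * s ^+ 2 + 2 * v * s + 1).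
Proof.
move=> s0 d; have b0 : 0 < s^-1 by rewrite invr_gt0.
have [LG IG] := poisson_semigroup a b0.
have E x : poisson x * ((2 * (x - a) ^+ 2 * s) / ((x - a) ^+ 2 * s ^+ 2 + 1))
   = 2 / s * (poisson x - s^-1 * (poisson x * (s^-1 / ((x - a) ^+ 2 + s^-1 ^+ 2)))).
  have h : 0 < (x - a) ^+ 2 * s ^+ 2 + 1 by rewrite ltr_wpDl // mulr_ge0 // sqr_ge0.
  have -> : (x - a) ^+ 2 + s^-1 ^+ 2 = ((x - a) ^+ 2 * s ^+ 2 + 1) / s ^+ 2 by field; rewrite gt_eqF.
  move: h; set D := _ + 1 => h.
  have -> : (2 * (x - a) ^+ 2 * s) = 2 / s * (D - 1) by rewrite /D; field; rewrite gt_eqF.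
  by move: (poisson x) => p; field; rewrite !gt_eqF.
have L2 := L1B poisson_L1 (L1Z s^-1 LG).
split; first by apply: L1_ext (L1Z (2 / s) L2) => x; rewrite E.
rewrite (Int_ext E) IntZ // IntB //; [|exact: poisson_L1|exact: L1Z].
rewrite poisson_Int IntZ // IG -/d.
have h : 0 < d ^+ 2 * s ^+ 2 + (v * s + 1) ^+ 2.
  apply: ltr_wpDl; first by rewrite mulr_ge0 ?sqr_ge0.
  by rewrite exprn_gt0 // addr_gt0 // mulr_gt0.
have -> : d ^+ 2 + (v + s^-1) ^+ 2 = (d ^+ 2 * s ^+ 2 + (v * s + 1) ^+ 2) / s ^+ 2.
  by field; rewrite gt_eqF.
have -> : (d ^+ 2 + v ^+ 2) * s ^+ 2 + 2 * v * s + 1 = d ^+ 2 * s ^+ 2 + (v * s + 1) ^+ 2 by ring.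
have -> : v + s^-1 = (v * s + 1) / s by field; rewrite gt_eqF.
have -> : (2 * (d ^+ 2 + v ^+ 2) * s + 2 * v) = 2 / s * ((d ^+ 2 * s ^+ 2 + (v * s + 1) ^+ 2) - (v * s + 1)).
  by field; rewrite gt_eqF.
move: h; set D := _ + (_ + 1) ^+ 2 => h.
by move: (v * s + 1) => e; field; rewrite !gt_eqF.
Qed.

End PoissonJensen.

Section JensenPoisson.
Variables (R : realType) (u v : R).
Hypothesis v0 : 0 < v.
Notation mu := (@lebesgue_measure R).
Notation P := (poisson u v).

Lemma integral_indic_itv (S : R) (g : R -> R) : cont_on 0 S g ->
  (\int[mu]_(s in setT) (g s * \1_(`]0%R, S]) s)%:E = \int[mu]_(s in `[0%R, S]) (g s)%:E)%E.
Proof.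
move=> cg; rewrite -integral_itv_obnd_cbnd; last first.
  apply: (measurable_funS _ _ (measurable_int _ (seg_integrable cg))) => //.
  by apply: subset_itvr; rewrite bnd_simp.
rewrite [RHS]integral_mkcond; apply: eq_integral => s _.
by rewrite patchE indicE; case: (s \in _); rewrite ?mulr1 ?mulr0.
Qed.

Lemma jensen_scaled (a S : R) : 0 < S ->
  L1 (fun x => P x * ln ((x - a) ^+ 2 * S ^+ 2 + 1)) /\
  Int (fun x => P x * ln ((x - a) ^+ 2 * S ^+ 2 + 1))
    = ln (((u - a) ^+ 2 + v ^+ 2) * S ^+ 2 + 2 * v * S + 1).
Proof.
move=> S0.
pose q (X s : R) := (2 * X * s + 0) / (X * s ^+ 2 + 0 * s + 1).
have qpos (X s : R) : 0 <= X -> 0 < X * s ^+ 2 + 0 * s + 1.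
  by move=> X0; rewrite mul0r addr0 ltr_wpDl // mulr_ge0 // sqr_ge0.
have q_ge0 (X s : R) : 0 <= X -> 0 < s -> 0 <= q X s.
  move=> X0 s0; apply: divr_ge0; last by apply: ltW; exact: qpos.
  rewrite addr0; apply: mulr_ge0; last exact: ltW.
  by apply: mulr_ge0.
pose I (s : R) : R := \1_(`]0%R, S]) s.
have I0 s : 0 <= I s by rewrite /I indicE.
pose K (x s : R) := P x * (q ((x - a) ^+ 2) s * I s).
have Iz s : ~~ (0 < s) -> I s = 0.
  rewrite /I indicE => /negP h; rewrite memNset //= => h1; apply: h.
  by move: h1; rewrite in_itv /= => /andP[].
have qI0 x s : 0 <= q ((x - a) ^+ 2) s * I s.
  have [s0|/negP s0] := boolP (0 < s); last by rewrite Iz ?mulr0 //; apply/negP.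
  by apply: mulr_ge0 => //; apply: q_ge0 => //; exact: sqr_ge0.
have K0 x s : 0 <= K x s by rewrite mulr_ge0 ?qI0 ?poisson_ge0.
have qc x : continuous (q ((x - a) ^+ 2)).
  by move=> s; apply: ratio_cont; apply: qpos; exact: sqr_ge0.
have sqc (y : R) : continuous (fun x : R => (x - y) ^+ 2).
  move=> x; have h : (fun t : R => t - y) t @[t --> x] --> x - y.
    by apply: cvgB; [exact: cvg_id|exact: cvg_cst].
  exact: (cvgM h h).
have mK : measurable_fun setT (fun z : R * R => K z.1 z.2).
  apply: (@measurable_continuous_section _ K) => [s x|x].
    apply: cvgM; first exact: poisson_cont.
    apply: cvgM; last exact: cvg_cst.
    have c2 : (fun x => 2 * (x - a) ^+ 2 * s + 0) t @[t --> x] --> 2 * (x - a) ^+ 2 * s + 0.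
      apply: cvgD; last exact: cvg_cst.
      apply: cvgM; last exact: cvg_cst.
      by apply: cvgM; [exact: cvg_cst|exact: sqc].
    apply: cvgM; first exact: c2.
    apply: cvgV; first by apply: lt0r_neq0; apply: qpos; exact: sqr_ge0.
    apply: cvgD; last exact: cvg_cst.
    apply: cvgD; last exact: cvg_cst.
    by apply: cvgM; [exact: sqc|exact: cvg_cst].
  apply: measurable_funM; first exact: measurable_cst.
  apply: measurable_funM; last exact: measurable_indic.
  exact: continuous_measurable_fun (qc x).
have inner_s x : (\int[mu]_(s in setT) (K x s)%:E = (P x * ln ((x - a) ^+ 2 * S ^+ 2 + 1))%:E)%E.
  have mqI : measurable_fun setT (fun s => (q ((x - a) ^+ 2) s * I s)%:E).
    by apply/measurable_EFinP; apply: measurable_funM; [exact: continuous_measurable_fun (qc x)|exact: measurable_indic].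
  under eq_integral do rewrite /K EFinM.
  have qIE s : [set: R] s -> (0 <= (q ((x - a) ^+ 2) s * I s)%:E)%E by rewrite lee_fin qI0.
  have -> := @ge0_integralZl_EFin _ _ _ mu setT measurableT _ qIE mqI (P x) (poisson_ge0 u v0 x).
  rewrite integral_indic_itv; last by move=> s _ _; exact: qc.
  rewrite integral_ln_quad //; last by move=> s _; apply: qpos; exact: sqr_ge0.
  by rewrite mul0r addr0 EFinM.
pose J (s : R) := (2 * ((u - a) ^+ 2 + v ^+ 2) * s + 2 * v)
  / (((u - a) ^+ 2 + v ^+ 2) * s ^+ 2 + 2 * v * s + 1).
have Jpos (s : R) : 0 <= s -> 0 < ((u - a) ^+ 2 + v ^+ 2) * s ^+ 2 + 2 * v * s + 1.
  move=> s0; rewrite ltr_wpDl // addr_ge0 // !mulr_ge0 // ?addr_ge0 ?sqr_ge0 //; exact: ltW.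
have inner_x s : (\int[mu]_(x in setT) (K x s)%:E = (J s * I s)%:E)%E.
  have [s0|/negP s0] := boolP (0 < s); last first.
    have Is : I s = 0 by apply: Iz; apply/negP.
    by under eq_integral do rewrite /K Is !mulr0; rewrite integral0 Is mulr0.
  have [L E] := poisson_ratio u v0 a s0.
  have E1 x : K x s = I s * (P x * ((2 * (x - a) ^+ 2 * s) / ((x - a) ^+ 2 * s ^+ 2 + 1))).
    by rewrite /K /q addr0 mul0r addr0; ring.
  under eq_integral do rewrite E1.
  by rewrite (Int_EFin (L1Z (I s) L)) IntZ // E mulrC.
have ton := tonelli_line mK K0.
have total : (\int[mu]_(x in setT) (P x * ln ((x - a) ^+ 2 * S ^+ 2 + 1))%:E
    = (ln (((u - a) ^+ 2 + v ^+ 2) * S ^+ 2 + 2 * v * S + 1))%:E)%E.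
  under eq_integral do rewrite -inner_s.
  rewrite ton; under eq_integral do rewrite inner_x.
  rewrite integral_indic_itv; last by move=> s s0 _; apply: ratio_cont; exact: Jpos.
  by rewrite integral_ln_quad.
have posln x : 0 <= P x * ln ((x - a) ^+ 2 * S ^+ 2 + 1).
  apply: mulr_ge0; first exact: poisson_ge0.
  by apply: ln_ge0; rewrite lerDr; apply: mulr_ge0; exact: sqr_ge0.
have mln : measurable_fun setT (fun x => P x * ln ((x - a) ^+ 2 * S ^+ 2 + 1)).
  apply: measurable_funM; first by apply: continuous_measurable_fun; exact: poisson_cont.
  apply: measurableT_comp; first exact: measurable_ln.
  apply: continuous_measurable_fun => x; apply: cvgD; last exact: cvg_cst.
  by apply: cvgM; [exact: sqc|exact: cvg_cst].
have LL : L1 (fun x => P x * ln ((x - a) ^+ 2 * S ^+ 2 + 1)).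
  apply: (proj1 (@L1_ge0P _ _ _ mln posln _)); rewrite total; exact: lexx.
split; first exact: LL.
by apply: EFin_inj; rewrite -Int_EFin; [exact: total|exact: LL].
Qed.

Lemma jensen_poisson (a b : R) : 0 < b ->
  L1 (fun x => P x * ln ((x - a) ^+ 2 + b ^+ 2)) /\
  Int (fun x => P x * ln ((x - a) ^+ 2 + b ^+ 2)) = ln ((u - a) ^+ 2 + (v + b) ^+ 2).
Proof.
move=> b0; have S0 : 0 < b^-1 by rewrite invr_gt0.
have [L I] := jensen_scaled a S0.
have b20 : 0 < b ^+ 2 by rewrite exprn_gt0.
have E x : P x * ln ((x - a) ^+ 2 + b ^+ 2)
    = ln (b ^+ 2) * P x + P x * ln ((x - a) ^+ 2 * b^-1 ^+ 2 + 1).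
  have h : 0 < (x - a) ^+ 2 * b^-1 ^+ 2 + 1 by rewrite ltr_wpDl // mulr_ge0 // sqr_ge0.
  rewrite (mulrC (ln _)) -mulrDr -lnM ?posrE //; congr (_ * ln _).
  by field; rewrite gt_eqF.
have LP := L1Z (ln (b ^+ 2)) (poisson_L1 u v0).
split; first by apply: L1_ext (L1D LP L) => x; rewrite E.
rewrite (Int_ext E) IntD // IntZ ?poisson_Int // ?I; last exact: poisson_L1.
rewrite mulr1 -lnM ?posrE //; last first.
  rewrite ltr_wpDl // addr_ge0 // !mulr_ge0 // ?addr_ge0 ?sqr_ge0 //; exact: ltW.
by congr ln; field; rewrite gt_eqF.
Qed.

End JensenPoisson.

Section TruncatedLog.
Variable R : realType.
Implicit Types (K s t : R).

Definition lam K s : R := ln (Num.max s (expR (- K))).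

Lemma lam_arg_gt0 K s : 0 < Num.max s (expR (- K)).
Proof. by rewrite lt_max expR_gt0 orbT. Qed.

Lemma lam_ge K s : - K <= lam K s.
Proof.
rewrite -[X in X <= _](expRK (- K)) /lam ler_ln ?posrE ?expR_gt0 ?lam_arg_gt0 //.
by rewrite le_max lexx orbT.
Qed.

Lemma lam_ln K s : 0 < s -> ln s <= lam K s.
Proof. by move=> s0; rewrite ler_ln ?posrE ?lam_arg_gt0 // le_max lexx. Qed.

Lemma lam_mono K s t : s <= t -> lam K s <= lam K t.
Proof.
move=> st; rewrite ler_ln ?posrE ?lam_arg_gt0 // ge_max !le_max st /=.
by rewrite lexx orbT.
Qed.

Lemma lam_maxE K s : 0 < s -> lam K s = Num.max (ln s) (- K).
Proof.
move=> s0; rewrite /lam; case: (leP s (expR (- K))) => h.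
  rewrite expRK max_r // -[X in _ <= X]expRK ler_ln ?posrE ?expR_gt0 //.
by rewrite max_l // -[X in X <= _]expRK ler_ln ?posrE ?expR_gt0 // ltW.
Qed.

Lemma lam_le K s t : 0 <= K -> 0 < t -> s <= t -> `|lam K s| <= K + `|ln t|.
Proof.
move=> K0 t0 st; rewrite ler_norml; apply/andP; split.
  by have := lam_ge K s; have := normr_ge0 (ln t); lra.
apply: le_trans (lam_mono K st) _; rewrite lam_maxE // ge_max; apply/andP; split.
  by have := ler_norm (ln t); lra.
by have := normr_ge0 (ln t); lra.
Qed.

Lemma lam_cont K : continuous (lam K).
Proof.
move=> s; apply: (@cvg_comp _ _ _ (fun t : R => Num.max t (expR (- K))) (@ln R)).
  exact: continuous_maxl.
by apply: continuous_ln; exact: lam_arg_gt0.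
Qed.

End TruncatedLog.

Section JensenLowerBound.
Variables (R : realType) (u v : R).
Hypothesis v0 : 0 < v.
Notation P := (poisson u v).

Lemma quadratic_pullback_roots (p : {poly R[i]}) (c0 : R[i]) :
  exists (c : R[i]) (A : seq R[i]), forall w, p.[w ^+ 2 + c0] = c * \prod_(a <- A) (w - a).
Proof.
have [r hr] := closed_field_poly_normal p.
exists (lead_coef p), (flatten [seq [:: sqrtc (a - c0); - sqrtc (a - c0)] | a <- r]) => w.
rewrite [in LHS]hr hornerZ; congr (_ * _).
elim: r {hr} => [|a r IH]; first by rewrite !big_nil hornerC.
rewrite big_cons hornerM hornerXsubC IH /= !big_cons mulrA opprK; congr (_ * _).
by rewrite -subr_sqr sqr_sqrtc; ring.
Qed.

(* The modulus [|x - a|] at a real point [x], with [|Im a|] increased by [e] so that its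
   logarithm is an integrable function of [x]. *)
Definition fatmod (e : R) (a : R[i]) (x : R) : R :=
  Num.sqrt ((x - complex.Re a) ^+ 2 + (`|complex.Im a| + e) ^+ 2).

Lemma fatmod_arg_gt0 (e : R) a x : 0 < e ->
  0 < (x - complex.Re a) ^+ 2 + (`|complex.Im a| + e) ^+ 2.
Proof. by move=> e0; apply: den_gt0; rewrite gt_eqF // ltr_wpDl. Qed.

Lemma fatmod_gt0 (e : R) a x : 0 < e -> 0 < fatmod e a x.
Proof. by move=> e0; rewrite sqrtr_gt0 fatmod_arg_gt0. Qed.

Lemma ln_fatmod (e : R) a x : 0 < e ->
  ln (fatmod e a x) = 2^-1 * ln ((x - complex.Re a) ^+ 2 + (`|complex.Im a| + e) ^+ 2).
Proof.
move=> e0; have h := fatmod_arg_gt0 a x e0.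
rewrite -(sqr_sqrtr (ltW h)) -/(fatmod e a x) lnXn ?fatmod_gt0 // -[ln _ *+ 2]mulr_natl.
by rewrite mulKf.
Qed.

Lemma fatmod0 a x : fatmod 0 a x = cmod (x +i* 0 - a).
Proof. by rewrite /fatmod /cmod !ReImE /= addr0 sub0r sqrrN real_normK ?num_real. Qed.

Lemma fatmod_mono (e e' : R) a x : 0 <= e -> e <= e' -> fatmod e a x <= fatmod e' a x.
Proof.
move=> e0 ee; apply: ler_wsqrtr; rewrite lerD2l ler_pXn2r // ?nnegrE ?addr_ge0 //.
  by rewrite lerD2l.
exact: le_trans ee.
Qed.

Lemma fatmod_continuous (e : R) a : continuous (fatmod e a).
Proof.
move=> x; apply: (@cvg_comp _ _ _
  (fun x => (x - complex.Re a) ^+ 2 + (`|complex.Im a| + e) ^+ 2) Num.sqrt).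
  exact: den_cont.
exact: sqrt_continuous.
Qed.

Lemma fatmod_cont a x (e_ : nat -> R) : e_ n @[n --> \oo] --> (0 : R) ->
  fatmod (e_ n) a x @[n --> \oo] --> cmod (x +i* 0 - a).
Proof.
move=> h; rewrite -fatmod0 /fatmod.
have h1 : `|complex.Im a| + e_ n @[n --> \oo] --> `|complex.Im a| + 0.
  by apply: cvgD => //; exact: cvg_cst.
have h2 : (x - complex.Re a) ^+ 2 + (`|complex.Im a| + e_ n) ^+ 2 @[n --> \oo]
    --> (x - complex.Re a) ^+ 2 + (`|complex.Im a| + 0) ^+ 2.
  by apply: cvgD; [exact: cvg_cst|exact: (cvgM h1 h1)].
exact: (cvg_comp _ _ h2 (@sqrt_continuous R _)).
Qed.

Lemma fatprod_gt0 (e : R) (A : seq R[i]) x : 0 < e -> 0 < \prod_(a <- A) fatmod e a x.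
Proof. by move=> e0; apply: prodr_gt0 => a _; exact: fatmod_gt0. Qed.

Lemma ln_fatprod (e : R) (A : seq R[i]) x : 0 < e ->
  ln (\prod_(a <- A) fatmod e a x) = \sum_(a <- A) ln (fatmod e a x).
Proof.
move=> e0; elim: A => [|a A IH]; first by rewrite !big_nil ln1.
by rewrite !big_cons lnM ?posrE ?fatmod_gt0 ?fatprod_gt0 // IH.
Qed.

Lemma fatprod_mono (e e' : R) (A : seq R[i]) x : 0 <= e -> e <= e' ->
  \prod_(a <- A) fatmod e a x <= \prod_(a <- A) fatmod e' a x.
Proof.
move=> e0 ee; apply: ler_prod => a _; rewrite fatmod_mono // andbT.
exact: sqrtr_ge0.
Qed.

Lemma fatprod_cont (A : seq R[i]) x (e_ : nat -> R) : e_ n @[n --> \oo] --> (0 : R) ->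
  \prod_(a <- A) fatmod (e_ n) a x @[n --> \oo] --> \prod_(a <- A) cmod (x +i* 0 - a).
Proof. by move=> h; apply: cvg_big => [|a _]; [exact: mul_continuous|exact: fatmod_cont]. Qed.

Lemma jensen_fatmod (e : R) a : 0 < e ->
  L1 (fun x => P x * ln (fatmod e a x)) /\
  (u +i* v != a -> ln (cmod (u +i* v - a)) <= Int (fun x => P x * ln (fatmod e a x))).
Proof.
move=> e0; set b := `|complex.Im a| + e.
have b0 : 0 < b by rewrite ltr_wpDl.
have [L I] := jensen_poisson u v0 (complex.Re a) b0.
have E x : P x * ln (fatmod e a x) = 2^-1 * (P x * ln ((x - complex.Re a) ^+ 2 + b ^+ 2)).
  by rewrite ln_fatmod // mulrCA.
split; first by apply: L1_ext (L1Z 2^-1 L) => x; rewrite E.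
move=> wa; rewrite (Int_ext E) IntZ // I.
have w0 : 0 < cmod (u +i* v - a) by rewrite cmod_gt0 subr_eq0.
rewrite ler_pdivlMl // mulr_natl -lnXn // ler_ln ?posrE ?exprn_gt0 //; last first.
  by apply: den_gt0; rewrite gt_eqF // addr_gt0.
rewrite cmod_sqr !ReImE /= lerD2l.
rewrite -[X in X <= _]real_normK ?num_real //.
rewrite ler_pXn2r ?nnegrE ?normr_ge0 ?(ltW (addr_gt0 v0 b0)) //.
apply: le_trans (ler_normB _ _) _; rewrite (gtr0_norm v0) lerD2l.
by rewrite /b lerDl ltW.
Qed.

Lemma jensen_rational (c : R[i]) (A : seq R[i]) (D : R -> R) (K : R) :
  0 <= K -> (forall x, 0 < D x) -> continuous D -> L1 (fun x => P x * ln (D x)) ->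
  c != 0 -> (forall a, a \in A -> u +i* v != a) ->
  ln (cmod c) + \sum_(a <- A) ln (cmod (u +i* v - a)) - Int (fun x => P x * ln (D x))
  <= Int (fun x => P x * lam K (cmod c * (\prod_(a <- A) cmod (x +i* 0 - a)) / D x)).
Proof.
move=> K0 D0 cD LD cn0 hA; have c0 : 0 < cmod c by rewrite cmod_gt0.
pose q e x := cmod c * (\prod_(a <- A) fatmod e a x) / D x.
pose g e x := ln (cmod c) + \sum_(a <- A) ln (fatmod e a x) - ln (D x).
have q0 (e x : R) : 0 < e -> 0 < q e x.
  by move=> e0; rewrite divr_gt0 // mulr_gt0 // fatprod_gt0.
have qg (e x : R) : 0 < e -> ln (q e x) = g e x.
  move=> e0; rewrite /q ln_div ?posrE ?mulr_gt0 ?fatprod_gt0 // lnM ?posrE ?fatprod_gt0 //.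
  by rewrite ln_fatprod.
have PgE e x : P x * g e x
    = ln (cmod c) * P x + \sum_(a <- A) P x * ln (fatmod e a x) - P x * ln (D x).
  by rewrite /g mulrBr mulrDr mulr_sumr (mulrC (P x)).
have LP := poisson_L1 u v0.
have LS (e : R) : 0 < e -> L1 (fun x => \sum_(a <- A) P x * ln (fatmod e a x)).
  by move=> e0; apply: L1_sum => a; exact: (jensen_fatmod a e0).1.
have LPg (e : R) : 0 < e -> L1 (fun x => P x * g e x).
  move=> e0; apply: L1_ext (L1B (L1D (L1Z (ln (cmod c)) LP) (LS e e0)) LD) => x.
  by rewrite PgE.
have Ig (e : R) : 0 < e -> ln (cmod c) + \sum_(a <- A) ln (cmod (u +i* v - a))
    - Int (fun x => P x * ln (D x)) <= Int (fun x => P x * g e x).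
  move=> e0; rewrite (Int_ext (PgE e)) IntB //; last by apply: L1D; [exact: L1Z|exact: LS].
  rewrite IntD; [|exact: L1Z|exact: LS].
  rewrite IntZ // poisson_Int // mulr1.
  rewrite lerD2r lerD2l Int_sum; last by move=> a; exact: (jensen_fatmod a e0).1.
  rewrite !big_seq; apply: ler_sum => a aA; apply: (jensen_fatmod a e0).2; exact: hA.
pose bound x := K * P x + `|P x * g 1 x|.
have Lb : L1 bound by apply: L1D; [exact: L1Z|exact/L1_norm/LPg].
have mlam (F : R[i] -> R -> R) : (forall a, continuous (F a)) ->
    measurable_fun setT (fun x => P x * lam K (cmod c * (\prod_(a <- A) F a x) / D x)).
  move=> hF; apply: continuous_measurable_fun => x; apply: cvgM; first exact: poisson_cont.
  apply: (@cvg_comp _ _ _ (fun x => cmod c * (\prod_(a <- A) F a x) / D x) (lam K)); last exact: lam_cont.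
  apply: cvgM; last by apply: cvgV; [exact: lt0r_neq0|exact: cD].
  apply: cvgM; first exact: cvg_cst.
  by apply: continuous_big => [|a _]; [exact: mul_continuous|exact: hF].
have cmodc a : continuous (fun x : R => cmod (x +i* 0 - a)).
  rewrite (_ : (fun x => _) = fatmod 0 a); first exact: fatmod_continuous.
  by apply/funext => x; rewrite fatmod0.
have qb n x : `|P x * lam K (q (eta_ R n) x)| <= bound x.
  have e1 : eta_ R n <= 1 by rewrite invf_le1 // ler1n.
  have qq : q (eta_ R n) x <= q 1 x.
    rewrite ler_pM2r ?invr_gt0 // ler_pM2l //; apply: fatprod_mono => //.
    exact/ltW/eta_gt0.
  rewrite normrM ger0_norm ?poisson_ge0 // /bound normrM (ger0_norm (poisson_ge0 u v0 x)).
  rewrite (mulrC K) -mulrDr; apply: ler_wpM2l; first exact: poisson_ge0.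
  by rewrite -qg //; apply: lam_le => //; exact: q0.
have [Llim Clim] := @Int_dominated _ (fun n x => P x * lam K (q (eta_ R n) x)) _ bound
  (fun n => mlam _ (@fatmod_continuous (eta_ R n))) (mlam _ cmodc)
  ltac:(apply: ae_all => x; apply: cvgM; [exact: cvg_cst|];
    apply: (@cvg_comp _ _ _ (fun n => q (eta_ R n) x) (lam K)); [|exact: lam_cont];
    apply: cvgM; [|exact: cvg_cst]; apply: cvgM; [exact: cvg_cst|];
    apply: fatprod_cont; exact: eta_cvg) Lb qb.
rewrite -(cvg_lim (@Rhausdorff R) Clim); apply: limr_ge; first exact: cvgP Clim.
apply: nearW => n; have en := eta_gt0 R n.
apply: le_trans (Ig _ en) _; apply: Int_le; first exact: LPg.
  exact: (L1_le (mlam _ (@fatmod_continuous (eta_ R n))) (qb n) Lb).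
move=> x; apply: ler_wpM2l; first exact: poisson_ge0.
by rewrite -qg //; apply: lam_ln; exact: q0.
Qed.

End JensenLowerBound.

(** * Jensen inequality along parabolas *)

Lemma upper_half_sqrt (R : realType) (z : R[i]) : 0 < complex.Im z ->
  exists u v : R, [/\ 0 < u, 0 < v & z = (u ^+ 2 - v ^+ 2) +i* (2 * u * v)].
Proof.
move=> z0; have := sqr_sqrtc z; move: (sqrtc z) => [u v] e.
have {}e : z = (u ^+ 2 - v ^+ 2) +i* (2 * u * v).
  by rewrite -e; apply: complex_eqP; rewrite expr2 !ReImE /=; ring.
have uv : 0 < u * v by move: z0; rewrite e /= -mulrA pmulr_rgt0.
have [u0|u0|u0] := ltgtP u 0; last by move: uv; rewrite u0 mul0r ltxx.
  exists (- u), (- v); split; rewrite ?oppr_gt0 //.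
    by rewrite -(nmulr_rgt0 _ u0).
  by rewrite e !sqrrN mulrN mulrN mulNr opprK.
by exists u, v; split=> //; rewrite -(pmulr_rgt0 _ u0).
Qed.

Section DenominatorLoss.
Variables (R : realType) (u v : R).
Hypothesis v0 : 0 < v.
Hypothesis u0 : 0 < u.
Notation P := (poisson u v).

Lemma denominator_loss (m y : R) : 0 < m -> 0 < y ->
  L1 (fun x => P x * ln (cmod (x ^+ 2 +i* y - (m +i* 1)^*))) /\
  Int (fun x => P x * ln (cmod (x ^+ 2 +i* y - (m +i* 1)^*)))
   <= ln (cmod ((u ^+ 2 - v ^+ 2) +i* (2 * u * v + y) - (m +i* 1)^*))
      + (1 + y) * v * (Num.sqrt m ^+ 3)^-1.
Proof.
move=> m0 y0; have h0 : 0 < 1 + y by rewrite addr_gt0.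
have [s [t [s0 t0 [/esym hst /esym hh]]]] := @upper_half_sqrt R (m +i* (1 + y)) h0.
have ms : m <= s ^+ 2 by rewrite -hst gerBl sqr_ge0.
have half (z : R[i]) (A B : R) : 0 < A -> 0 < B -> cmod z ^+ 2 = A * B ->
    ln (cmod z) = 2^-1 * (ln A + ln B).
  move=> A0 B0 e; have z0 : 0 < cmod z.
    rewrite lt_neqAle cmod_ge0 andbT eq_sym; apply/eqP => z0.
    by have := mulr_gt0 A0 B0; rewrite -e z0 expr0n ltxx.
  by rewrite -lnM ?posrE // -e lnXn // -[ln _ *+ 2]mulr_natl mulKf.
have [L1s I1] := jensen_poisson u v0 s t0.
have [L2s I2] := jensen_poisson u v0 (- s) t0.
have E x : P x * ln (cmod (x ^+ 2 +i* y - (m +i* 1)^*))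
   = 2^-1 * (P x * ln ((x - s) ^+ 2 + t ^+ 2) + P x * ln ((x - - s) ^+ 2 + t ^+ 2)).
  rewrite (half _ ((x - s) ^+ 2 + t ^+ 2) ((x - - s) ^+ 2 + t ^+ 2)).
  - by rewrite -mulrDr mulrCA.
  - by apply: den_gt0; rewrite gt_eqF.
  - by apply: den_gt0; rewrite gt_eqF.
  rewrite cmod_sqr !ReImE /= -hst opprK (addrC y) -hh; ring.
have LS := L1D L1s L2s.
split; first by apply: L1_ext (L1Z 2^-1 LS) => x; rewrite E.
rewrite (Int_ext E) IntZ // IntD // I1 I2.
have A20 : 0 < (u - - s) ^+ 2 + (v - t) ^+ 2.
  by rewrite ltr_pwDl ?sqr_ge0 // opprK exprn_gt0 // addr_gt0.
have A10 : 0 < (u - s) ^+ 2 + (v + t) ^+ 2 by apply: den_gt0; rewrite gt_eqF // addr_gt0.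
rewrite (half _ ((u - s) ^+ 2 + (v + t) ^+ 2) ((u - - s) ^+ 2 + (v - t) ^+ 2)) //; last first.
  by rewrite cmod_sqr !ReImE /= -hst opprK -(addrA _ y) (addrC y) -hh; ring.
have s20 : 0 < s ^+ 2 by rewrite exprn_gt0.
have key : ln ((u - - s) ^+ 2 + (v + t) ^+ 2) <= ln ((u - - s) ^+ 2 + (v - t) ^+ 2) + 4 * v * t / s ^+ 2.
  have -> : (u - - s) ^+ 2 + (v + t) ^+ 2
     = ((u - - s) ^+ 2 + (v - t) ^+ 2) * (1 + 4 * v * t / ((u - - s) ^+ 2 + (v - t) ^+ 2)).
    by field; rewrite gt_eqF //; move: A20; rewrite opprK.
  have pos : 0 < 4 * v * t / ((u - - s) ^+ 2 + (v - t) ^+ 2) by rewrite divr_gt0 // !mulr_gt0.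
  rewrite lnM ?posrE // ?addr_gt0 // lerD2l.
  apply: le_trans (le_ln1Dx _) _; first by apply: lt_trans pos; rewrite oppr_lt0.
  rewrite ler_pM2l ?mulr_gt0 // lef_pV2 ?posrE // opprK.
  apply: ler_wpDr; first exact: sqr_ge0.
  have us : s <= u + s by rewrite lerDr ltW.
  by rewrite ler_pXn2r // ?nnegrE ?(ltW s0) // (le_trans (ltW s0) us).
have loss : 2 * v * t / s ^+ 2 <= (1 + y) * v * (Num.sqrt m ^+ 3)^-1.
  rewrite -hh; have -> : 2 * v * t / s ^+ 2 = 2 * s * t * v * (s ^+ 3)^-1 by field; rewrite gt_eqF.
  apply: ler_wpM2l; first by rewrite !mulr_ge0 // ltW.
  have sm0 : 0 < Num.sqrt m by rewrite sqrtr_gt0.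
  rewrite lef_pV2 ?posrE ?exprn_gt0 // ler_pXn2r // ?nnegrE ?sqrtr_ge0 ?(ltW s0) //.
  by rewrite -(@ler_pXn2r _ 2) // ?nnegrE ?sqrtr_ge0 ?(ltW s0) // sqr_sqrtr ?(ltW m0).
have e4 : 2 * v * t / s ^+ 2 = 2^-1 * (4 * v * t / s ^+ 2) by field; rewrite gt_eqF.
rewrite e4 in loss.
move: key loss; move: (ln _) (ln _) (ln _) (4 * v * t / s ^+ 2) => a b c e; lra.
Qed.

End DenominatorLoss.

Section ModelSpaceJensen.
Variables (R : realType) (beta : R) (f : R[i] -> R[i]) (fb : R -> R[i]).
Hypothesis hbeta : 1 < 2 * beta.
Hypothesis hf : model_space (blaschke beta) f.
Hypothesis hfb : boundary_value f fb.
Hypothesis mfb : cmeasurable fb.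
Variables (u v : R).
Hypotheses (u0 : 0 < u) (v0 : 0 < v).
Notation P := (poisson u v).
Notation fN := (fN beta f fb).

Definition node_den N (z : R[i]) : R := \prod_(1 <= n < N.+1) cmod (z - conjc (bzero beta n)).

Lemma node_den_gt0 N (z : R[i]) : 0 < complex.Im z -> 0 < node_den N z.
Proof.
move=> z0; apply: prodr_gt0 => n _; rewrite cmod_gt0.
by apply: bfactor_den_neq0; apply: lt_trans z0; rewrite oppr_lt0.
Qed.

Lemma node_den_S N (z : R[i]) :
  node_den N.+1 z = node_den N z * cmod (z - conjc (bzero beta N.+1)).
Proof. by rewrite /node_den big_nat_recr. Qed.

Lemma node_den_parabola_cont N (y : R) : continuous (fun x : R => node_den N (x ^+ 2 +i* y)).
Proof.
apply: continuous_big => [|n _ x]; first exact: mul_continuous.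
apply: (@cvg_comp _ _ _ (fun t : R => (t ^+ 2 - n%:R `^ beta) ^+ 2 + (y - - 1) ^+ 2) (@Num.sqrt R));
  last exact: sqrt_continuous.
apply: cvgD; last exact: cvg_cst.
have hx : (t ^+ 2 - n%:R `^ beta) @[t --> x] --> (x ^+ 2 - n%:R `^ beta).
  by apply: cvgB; [exact: exprn_continuous|exact: cvg_cst].
exact: (cvgM hx hx).
Qed.

Lemma node_power n : (Num.sqrt (n.+1%:R `^ beta) ^+ 3)^-1 = n.+1%:R `^ (- (3 / 2 * beta)) :> R.
Proof.
rewrite -powR12_sqrt ?powR_ge0 // -powR_mulrn ?powR_ge0 // -!powRrM powRN; congr (_ `^ _)^-1.
by field.
Qed.

Lemma node_den_loss N (y : R) : 0 < y ->
  L1 (fun x => P x * ln (node_den N (x ^+ 2 +i* y))) /\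
  Int (fun x => P x * ln (node_den N (x ^+ 2 +i* y)))
   <= ln (node_den N ((u ^+ 2 - v ^+ 2) +i* (2 * u * v + y))) + (1 + y) * v * psum (3 / 2 * beta) N.
Proof.
move=> y0; have zy : 0 < 2 * u * v + y by rewrite addr_gt0 // !mulr_gt0.
elim: N => [|N [IH1 IH2]].
  have e : (fun x => P x * ln (node_den 0 (x ^+ 2 +i* y))) = fun=> 0.
    by apply/funext => x; rewrite /node_den big_geq // ln1 mulr0.
  by rewrite e /psum /node_den !big_geq // ln1 mulr0 addr0 Int0; split=> //; exact: L10.
have [h1 h2] := denominator_loss v0 u0 (powR_gt0 beta (ltr0Sn R N)) y0.
have e : (fun x => P x * ln (node_den N.+1 (x ^+ 2 +i* y))) =
    fun x => P x * ln (node_den N (x ^+ 2 +i* y))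
             + P x * ln (cmod (x ^+ 2 +i* y - conjc (bzero beta N.+1))).
  apply/funext => x; rewrite node_den_S lnM ?mulrDr // posrE ?node_den_gt0 // cmod_gt0.
  by apply: bfactor_den_neq0 => /=; apply: lt_trans y0; rewrite oppr_lt0.
rewrite e; split; first exact: L1D.
rewrite IntD // node_den_S lnM ?posrE ?node_den_gt0 //; last first.
  by rewrite cmod_gt0; apply: bfactor_den_neq0 => /=; apply: lt_trans zy; rewrite oppr_lt0.
move: h2; rewrite node_power psumS => h2.
rewrite (mulrDr _ (psum _ _)) addrACA; exact: lerD.
Qed.

Lemma fN_pullback N (y : R) : exists (c : R[i]) (A : seq R[i]), forall w : R[i],
  0 < complex.Im (w ^+ 2 + 0 +i* y) ->
  cmod (fN N (w ^+ 2 + 0 +i* y)) * node_den N (w ^+ 2 + 0 +i* y)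
    = cmod c * \prod_(a <- A) cmod (w - a).
Proof.
have [p hp] := fN_poly hf hfb mfb N.
have [c [A hA]] := quadratic_pullback_roots p (0 +i* y).
exists c, A => w; have := hA w; move: (w ^+ 2 + _) => [a b] /= e b0.
by rewrite /node_den -cmod_prod -cmod_prod -!cmodM -e -hp.
Qed.

Lemma parabola_sqr (r s y : R) :
  (r +i* s) ^+ 2 + 0 +i* y = (r ^+ 2 - s ^+ 2) +i* (2 * r * s + y).
Proof. by apply: complex_eqP; rewrite !expr2 !ReImE /=; ring. Qed.

Lemma parabola_sqr0 (x y : R) : (x +i* 0) ^+ 2 + 0 +i* y = x ^+ 2 +i* y.
Proof. by rewrite parabola_sqr expr0n subr0 mulr0 add0r. Qed.

Lemma fN_parabola_meas N (y : R) : 0 < y ->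
  measurable_fun setT (fun x : R => cmod (fN N (x ^+ 2 +i* y))).
Proof.
move=> y0; have [c [A hA]] := fN_pullback N y.
rewrite (_ : (fun x : R => _) = fun x : R =>
    cmod c * (\prod_(a <- A) fatmod 0 a x) * (node_den N (x ^+ 2 +i* y))^-1); last first.
  apply/funext => x; have := hA (x +i* 0); rewrite parabola_sqr0 => /(_ y0) h.
  have d0 := node_den_gt0 N (y0 : 0 < complex.Im (x ^+ 2 +i* y)).
  apply: (mulIf (lt0r_neq0 d0)); rewrite divfK ?gt_eqF // h; congr (_ * _).
  by apply: eq_bigr => a _; rewrite fatmod0.
apply: continuous_measurable_fun => x; apply: cvgM.
  apply: cvgM; first exact: cvg_cst.
  by apply: continuous_big => [|a _]; [exact: mul_continuous|exact: fatmod_continuous].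
apply: cvgV; last exact: node_den_parabola_cont.
by rewrite gt_eqF // node_den_gt0.
Qed.

Lemma fN_jensen N (y K : R) : 0 < y -> 0 <= K ->
  fN N ((u ^+ 2 - v ^+ 2) +i* (2 * u * v + y)) != 0 ->
  ln (cmod (fN N ((u ^+ 2 - v ^+ 2) +i* (2 * u * v + y)))) - (1 + y) * v * psum (3 / 2 * beta) N
    <= Int (fun x => P x * lam K (cmod (fN N (x ^+ 2 +i* y)))).
Proof.
move=> y0 K0; have zy : 0 < 2 * u * v + y by rewrite addr_gt0 // !mulr_gt0.
have [c [A hA]] := fN_pullback N y.
have := hA (u +i* v); rewrite parabola_sqr => /(_ zy).
set z := _ +i* _ => hz fz.
have dz : 0 < node_den N z by exact: node_den_gt0.
have : cmod c * \prod_(a <- A) cmod (u +i* v - a) != 0.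
  by rewrite -hz mulf_neq0 ?gt_eqF ?cmod_gt0.
rewrite mulf_eq0 negb_or cmod_eq0 => /andP[c0 hprod].
have hAa a : a \in A -> u +i* v != a.
  move=> aA; apply: contra hprod => /eqP ea.
  by rewrite prodf_seq_eq0; apply/hasP; exists a => //=; rewrite cmod_eq0 subr_eq0 ea.
have [l1 l2] := node_den_loss N y0.
have := jensen_rational v0 K0 (fun x => node_den_gt0 N (y0 : 0 < complex.Im (x ^+ 2 +i* y)))
  (@node_den_parabola_cont N y) l1 c0 hAa.
set I1 := Int _; set I2 := Int _ => h.
have -> : Int (fun x => P x * lam K (cmod (fN N (x ^+ 2 +i* y)))) = I2.
  apply: Int_ext => x; congr (_ * lam K _).
  have := hA (x +i* 0); rewrite parabola_sqr0 => /(_ y0) <-.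
  by rewrite mulfK // gt_eqF // node_den_gt0.
apply: le_trans h; rewrite -/z -/I1 in l2.
have hs : ln (cmod (fN N z)) + ln (node_den N z) =
    ln (cmod c) + \sum_(a <- A) ln (cmod (u +i* v - a)).
  rewrite -lnM ?posrE ?cmod_gt0 // hz lnM ?posrE ?cmod_gt0 //.
    congr (_ + _); elim: (A) hAa => [|a s IH] h; first by rewrite !big_nil ln1.
    rewrite !big_cons lnM ?posrE ?cmod_gt0 ?subr_eq0 ?h ?mem_head //.
      by rewrite IH // => b bs; apply: h; rewrite inE bs orbT.
    rewrite big_seq; apply: prodr_gt0 => b bs; rewrite cmod_gt0 subr_eq0; apply: h.
    by rewrite inE bs orbT.
  rewrite lt_neqAle eq_sym hprod prodr_ge0 // => a _; exact: cmod_ge0.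
rewrite -hs; move: l2; lra.
Qed.

End ModelSpaceJensen.

(** * The logarithmic integral *)

Section SquareSubstitution.
Variable R : realType.
Notation mu := (@lebesgue_measure R).

Lemma integral_sqr_substitution (G : R -> R) (b : R) : 0 <= b -> continuous G ->
  (\int[mu]_(t in `[0%R, (b ^+ 2)%R]) (G t)%:E
    = \int[mu]_(x in `[0%R, b]) (G (x ^+ 2) * (2 * x))%:E)%E.
Proof.
move=> b0 cG.
have dF (x : R) : derivable (fun x : R => x ^+ 2) x 1 by exact: exprn_derivable.
have eF : (fun x : R => x ^+ 2)^`() = fun x : R => 2 * x.
  by apply/funext => x; rewrite exp_derive1 /GRing.scale /= expr1.
have c2 : continuous (fun x : R => 2 * x).
  by move=> x; apply: cvgM; [exact: cvg_cst|exact: cvg_id].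
have := @integration_by_substitution_increasing R (fun x : R => x ^+ 2) G 0 b b0.
rewrite eF expr0n /= => -> //.
- move=> x y; rewrite !in_itv /= => /andP[x0 _] /andP[y0 _] xy.
  by rewrite ltr_pXn2r // nnegrE.
- apply/cvg_ex; exists (2 * 0 : R); apply: cvg_at_right_filter; exact: (c2 0).
- apply/cvg_ex; exists (2 * b : R); apply: cvg_at_left_filter; exact: (c2 b).
- split; first by move=> x _; exact: dF.
    by apply: cvg_at_right_filter; exact: exprn_continuous.
  by apply: cvg_at_left_filter; exact: exprn_continuous.
- exact: continuous_subspaceT.
Qed.

Lemma integral_half_line_le (h : R -> R) (M : R) : continuous h -> (forall x, 0 <= h x) ->
  (forall n : nat, (\int[mu]_(x in `[0%R, n%:R]) (h x)%:E <= M%:E)%E) ->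
  (\int[mu]_(x in `[0%R, +oo[) (h x)%:E <= M%:E)%E.
Proof.
move=> ch h0 hn.
have e : `[0%R, +oo[%classic = \bigcup_n `[0%R, n%:R : R]%classic.
  apply/seteqP; split => x /=.
    rewrite in_itv /= andbT => x0; exists (Num.truncn x).+1 => //=.
    by rewrite in_itv /= x0 /= ltW // truncnS_gt.
  by move=> [n _] /=; rewrite !in_itv /= andbT => /andP[].
have mh : measurable_fun setT (EFin \o h).
  by apply/measurable_EFinP; exact: continuous_measurable_fun.
have hc : ((\int[mu]_(x in `[0%R, n%:R]) (h x)%:E) @[n --> \oo] -->
           \int[mu]_(x in `[0%R, +oo[) (h x)%:E)%E.
  rewrite e; apply: ge0_nondecreasing_set_cvg_integral => //.
  - by move=> m n mn; apply/subsetPset/subset_itvl; rewrite bnd_simp ler_nat.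
  - by move=> n; exact: measurable_funTS.
  - by move=> n x _; rewrite lee_fin.
rewrite -(cvg_lim _ hc) //; apply: lime_le; first exact: (cvgP _ hc).
exact: nearW.
Qed.

End SquareSubstitution.

Section LogPlusBound.
Variable R : realType.
Notation mu := (@lebesgue_measure R).

Lemma parabola_moment (g : R -> R) (M : R) : continuous g -> (forall t, 0 <= g t) ->
  (\int[mu]_t (g t)%:E <= M%:E)%E ->
  L1 (fun x => `|x| * g (x ^+ 2)) /\ Int (fun x => `|x| * g (x ^+ 2)) <= M.
Proof.
move=> cg g0 hM.
have ch : continuous (fun x : R => `|x| * g (x ^+ 2)).
  move=> x; apply: cvgM; first exact: norm_continuous.
  by apply: (@cvg_comp _ _ _ (fun x : R => x ^+ 2) g); [exact: exprn_continuous|exact: cg].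
have h0 (x : R) : 0 <= `|x| * g (x ^+ 2) by rewrite mulr_ge0.
apply: L1_ge0P => //; first exact: continuous_measurable_fun.
rewrite ge0_symfun_integralT //; last by move=> x /=; rewrite normrN sqrrN.
rewrite -set_itvcy -ge0_integralZl_EFin //; last first.
- apply/measurable_EFinP; apply: measurable_funTS; exact: continuous_measurable_fun.
- by move=> x _; rewrite lee_fin.
under eq_integral do rewrite -EFinM.
apply: integral_half_line_le.
- by move=> x; apply: cvgM; [exact: cvg_cst|exact: ch].
- by move=> x; rewrite mulr_ge0.
move=> n; rewrite (_ : integral _ _ _ = \int[mu]_(t in `[0%R, (n%:R ^+ 2)%R]) (g t)%:E)%E.
  apply: le_trans hM; apply: ge0_subset_integral => //.
    by apply/measurable_EFinP; exact: continuous_measurable_fun.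
  by move=> x _; rewrite lee_fin.
rewrite integral_sqr_substitution //; apply: eq_integral => x.
rewrite inE /= in_itv /= => /andP[x0 _]; congr EFin.
by rewrite ger0_norm // [RHS]mulrC mulrA.
Qed.

Lemma lam0_le1 (s : R) : s <= 1 -> lam 0 s = 0.
Proof. by move=> s1; rewrite /lam oppr0 expR0 max_r // ln1. Qed.

Lemma lam0_ge0 (s : R) : 0 <= lam 0 s.
Proof. by have := lam_ge 0 s; rewrite oppr0. Qed.

Lemma lam0_le_moment (e s x : R) : 0 < e -> e <= 1 ->
  lam 0 s <= `|x| * s ^+ 2 + e * s ^+ 2
    + 2^-1 * (ln ((x - 0) ^+ 2 + 1 ^+ 2) - ln ((x - 0) ^+ 2 + e ^+ 2)).
Proof.
move=> e0 e1; rewrite subr0.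
have q0 : 0 < x ^+ 2 + e ^+ 2 by rewrite ltr_wpDl ?sqr_ge0 // exprn_gt0.
have q1 : 0 < x ^+ 2 + 1 ^+ 2 by rewrite ltr_wpDl ?sqr_ge0 // exprn_gt0.
have e2 : e ^+ 2 <= 1 ^+ 2 by rewrite ler_pXn2r // ?nnegrE ltW.
have [s1|s1] := leP s 1.
  rewrite lam0_le1 // addr_ge0 //; first by rewrite addr_ge0 // mulr_ge0 ?sqr_ge0 // ltW.
  rewrite mulr_ge0 ?invr_ge0 // subr_ge0 ler_ln ?posrE // lerD2l //.
have s0 : 0 < s by apply: lt_trans s1.
have q2 : 0 < `|x| + e by rewrite ltr_wpDl.
rewrite lam_maxE // oppr0 max_l ?ln_ge0 ?(ltW s1) //.
have h1 : ln s = ln ((`|x| + e) * s) - ln (`|x| + e) by rewrite lnM ?posrE // addrAC subrr add0r.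
have h2 : ln ((`|x| + e) * s) <= (`|x| + e) * s ^+ 2.
  apply: (@le_trans _ _ ((`|x| + e) * s)).
    have := @le_ln1Dx R ((`|x| + e) * s - 1); rewrite addrCA subrr addr0.
    move=> h; apply: le_trans (h _) _; last by rewrite gerBl.
    by rewrite ltrBrDl subrr mulr_gt0.
  by rewrite ler_pM2l // expr2 ler_pMr // ltW.
have h3 : ln (x ^+ 2 + e ^+ 2) <= 2 * ln (`|x| + e).
  rewrite mulr_natl -lnXn // ler_ln ?posrE ?exprn_gt0 // sqrrD real_normK ?num_real //.
  by rewrite -addrA lerD2l lerDr mulrn_wge0 // mulr_ge0 // ltW.
have h4 : 0 <= ln (x ^+ 2 + 1 ^+ 2).
  by rewrite ln_ge0 // expr1n lerDr sqr_ge0.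
rewrite h1 -mulrDl; move: h2 h3 h4.
move: (ln ((`|x| + e) * s)) ((`|x| + e) * s ^+ 2) (ln (x ^+ 2 + 1 ^+ 2)) (ln (`|x| + e)).
move=> A B C D; move: (ln (x ^+ 2 + e ^+ 2)) => E h2 h3 h4.
lra.
Qed.

End LogPlusBound.

Section NegativeLog.
Variable R : realType.
Implicit Types (K s : R).

Definition nlam K s : R := lam 0 s - lam K s.

Lemma nlam_mono K K' s : K <= K' -> nlam K s <= nlam K' s.
Proof.
move=> KK; rewrite lerD2l lerN2 ler_ln ?posrE ?lam_arg_gt0 //.
by rewrite ge_max !le_max lexx /= ler_expR lerN2 KK orbT.
Qed.

Lemma nlam_ge0 K s : 0 <= K -> 0 <= nlam K s.
Proof. by move=> K0; apply: le_trans (nlam_mono s K0); rewrite /nlam subrr. Qed.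

Lemma nlam_cont K : continuous (nlam K).
Proof. by move=> s; apply: cvgB; exact: lam_cont. Qed.

Lemma nlam_cvg s (w : R) : 0 <= s -> 0 < w ->
  (nlam n%:R s * w)%:E @[n --> \oo] --> maxe (- (elog s * w%:E))%E 0%E.
Proof.
rewrite le_eqVlt => /predU1P[<-|s0] w0; rewrite /elog.
  rewrite eqxx mulNyr gtr0_sg // mul1e /= max_l ?leey //.
  rewrite (_ : (fun n => _) = fun n => (n%:R * w)%:E); last first.
    apply/funext => n; rewrite /nlam lam0_le1 // sub0r /lam max_r ?expR_ge0 //.
    by rewrite expRK opprK.
  apply/cvgeryP/cvgryPge => A.
  by apply: filterS (nbhs_infty_ger (A / w)) => n; rewrite ler_pdivrMr.
rewrite gt_eqF // -EFinM -EFinN -EFin_max.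
apply: cvg_near_cst.
near=> n.
have hn : - n%:R <= ln s.
  rewrite lerNl; near: n; exact: nbhs_infty_ger.
rewrite /nlam !lam_maxE // oppr0 (max_l hn); congr EFin.
rewrite mulrDl -mulNr -[X in _ = Num.max _ X](mul0r w) -maxr_pMl ?(ltW w0) // -mulrDl; congr (_ * _).
by case: (leP (ln s) 0) => h; [rewrite max_l ?oppr_ge0 // add0r|rewrite subrr max_r // oppr_le0 ltW].
Unshelve. all: by end_near.
Qed.

Definition weight (t : R) : R := (Num.sqrt t ^+ 3 + 1)^-1.

Lemma weight_den_gt0 (t : R) : 0 < Num.sqrt t ^+ 3 + 1.
Proof. by rewrite ltr_wpDl // exprn_ge0 // sqrtr_ge0. Qed.

Lemma weight_gt0 (t : R) : 0 < weight t.
Proof. by rewrite invr_gt0 weight_den_gt0. Qed.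

Lemma weight_cont : continuous weight.
Proof.
move=> t; apply: cvgV; first by rewrite gt_eqF // weight_den_gt0.
apply: cvgD; last exact: cvg_cst.
apply: (@cvg_comp _ _ _ (@Num.sqrt R) (fun r : R => r ^+ 3)); first exact: sqrt_continuous.
exact: exprn_continuous.
Qed.

Lemma weight_powR (t : R) : 0 <= t -> weight t = (t `^ (3%:R / 2%:R) + 1)^-1.
Proof.
move=> t0; rewrite /weight -powR12_sqrt // -powR_mulrn ?powR_ge0 // -powRrM.
by congr ((_ `^ _ + 1)^-1); rewrite mulrC.
Qed.

Lemma weight_poisson (u v x : R) : 0 < u -> 0 < v -> 0 <= x ->
  weight (x ^+ 2) * (2 * x) <= 2 * pi / v * (1 + u ^+ 2 + v ^+ 2) * poisson u v x.
Proof.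
move=> u0 v0 x0; rewrite /weight sqrtr_sqr ger0_norm //.
have d0 : 0 < (x - u) ^+ 2 + v ^+ 2 by apply: den_gt0; rewrite gt_eqF.
have p0 := pi_gt0 R.
have -> : 2 * pi / v * (1 + u ^+ 2 + v ^+ 2) * poisson u v x =
    2 * (1 + u ^+ 2 + v ^+ 2) * ((x - u) ^+ 2 + v ^+ 2)^-1.
  rewrite /poisson; move: p0 d0; move: (@pi R) ((x - u) ^+ 2 + v ^+ 2) => p d p0 d0.
  by field; rewrite !gt_eqF.
rewrite mulrC ler_pdivrMr ?ltr_wpDl ?exprn_ge0 // mulrAC ler_pdivlMr //.
rewrite -!mulrA ler_pM2l //.
have h1 : x * ((x - u) ^+ 2 + v ^+ 2) <= x ^+ 3 + x * (u ^+ 2 + v ^+ 2).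
  have -> : x * ((x - u) ^+ 2 + v ^+ 2) = x ^+ 3 + x * (u ^+ 2 + v ^+ 2) - 2 * (x ^+ 2 * u) by ring.
  by rewrite gerBl mulr_ge0 // mulr_ge0 ?sqr_ge0 // ltW.
have h2 : x <= x ^+ 3 + 1.
  have [x1|x1] := leP x 1; first by rewrite ler_wpDl // exprn_ge0.
  have : x <= x ^+ 3 by rewrite -[X in X <= _]expr1 ler_eXn2l.
  by lra.
apply: le_trans h1 _.
have q0 : 0 <= u ^+ 2 + v ^+ 2 by rewrite addr_ge0 // sqr_ge0.
have := ler_wpM2r q0 h2; rewrite -addrA; lra.
Qed.

End NegativeLog.

Section ModelSpaceLogarithm.
Variables (R : realType) (beta : R) (f : R[i] -> R[i]) (fb : R -> R[i]).
Hypothesis hbeta : 2 / 3 < beta.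
Hypothesis hf : model_space (blaschke beta) f.
Hypothesis hfb : boundary_value f fb.
Hypothesis mfb : cmeasurable fb.
Variables (u v : R).
Hypotheses (u0 : 0 < u) (v0 : 0 < v).
Notation mu := (@lebesgue_measure R).
Notation P := (poisson u v).

Lemma holomorphic_line_cont (y : R) : 0 < y -> continuous (fun t : R => cmod (f (t +i* y))).
Proof. by move=> y0 t; have [[h1 _] _] := hf; exact: (cder_cmod_cont (h1 _ _)).1. Qed.

Lemma holomorphic_parabola_cont (y : R) : 0 < y ->
  continuous (fun x : R => cmod (f (x ^+ 2 +i* y))).
Proof.
move=> y0 x; apply: (@cvg_comp _ _ _ (fun x : R => x ^+ 2) (fun t : R => cmod (f (t +i* y)))).
  exact: exprn_continuous.
exact: holomorphic_line_cont.
Qed.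

Lemma f_jensen (y K : R) : 0 < y -> y <= 1 -> 0 <= K ->
  f ((u ^+ 2 - v ^+ 2) +i* (2 * u * v + y)) != 0 ->
  L1 (fun x => P x * lam K (cmod (f (x ^+ 2 +i* y)))) /\
  ln (cmod (f ((u ^+ 2 - v ^+ 2) +i* (2 * u * v + y)))) - 2 * v * (1 + (3 / 2 * beta - 1)^-1)
    <= Int (fun x => P x * lam K (cmod (f (x ^+ 2 +i* y)))).
Proof.
move=> y0 y1 K0; have zy : 0 < 2 * u * v + y by rewrite addr_gt0 // !mulr_gt0.
set z := _ +i* _ => fz.
have hb : 1 < 2 * beta by move: hbeta; lra.
have p1 : 1 < 3 / 2 * beta by move: hbeta; lra.
pose M := (Int (fun t => cmod (fb t) ^+ 2) + pi / y) / pi.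
have M0 : 0 < M.
  rewrite divr_gt0 ?pi_gt0 // ltr_wpDl ?divr_gt0 ?pi_gt0 //.
  by apply: Int_ge0 => t; exact: sqr_ge0.
have mlam (h : R -> R) : measurable_fun setT h -> measurable_fun setT (fun x => P x * lam K (h x)).
  move=> mh; apply: measurable_funM.
    by apply: continuous_measurable_fun; exact: poisson_cont.
  apply: measurableT_comp mh; apply: continuous_measurable_fun; exact: lam_cont.
have cN t : 0 < complex.Im t -> cmod (fN beta f fb N t) @[N --> \oo] --> cmod (f t).
  case: t => a b /= b0; apply: cvg_cmod_cmod; exact: fN_cvg.
have [||||h1 h2] := @Int_dominated R
    (fun N x => P x * lam K (cmod (fN beta f fb N (x ^+ 2 +i* y))))
    (fun x => P x * lam K (cmod (f (x ^+ 2 +i* y)))) (fun x => (K + `|ln M|) * P x)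
    (fun N => mlam _ (fN_parabola_meas hf hfb mfb N y0)).
- by apply: mlam; apply: continuous_measurable_fun; exact: holomorphic_parabola_cont.
- apply: ae_all => x; apply: cvgM; first exact: cvg_cst.
  apply: (@cvg_comp _ _ _ (fun N => cmod (fN beta f fb N (x ^+ 2 +i* y))) (lam K)).
    exact: cN.
  exact: lam_cont.
- by apply: L1Z; exact: poisson_L1.
- move=> N x; rewrite normrM ger0_norm ?poisson_ge0 // mulrC ler_wpM2r ?poisson_ge0 //.
  by apply: lam_le => //; exact: fN_bound.
split=> //.
have hz := cN z zy.
have fz0 : 0 < cmod (f z) by rewrite cmod_gt0.
have hl : ln (cmod (fN beta f fb N z)) - 2 * v * (1 + (3 / 2 * beta - 1)^-1) @[N --> \oo] -->
          ln (cmod (f z)) - 2 * v * (1 + (3 / 2 * beta - 1)^-1).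
  apply: cvgB; last exact: cvg_cst.
  by apply: (@cvg_comp _ _ _ _ (@ln R) _ _ _ hz); exact: continuous_ln.
apply: (ler_cvg_to hl h2).
have hne : \forall N \near \oo, 0 < cmod (fN beta f fb N z) by exact: (cvgr_gt _ hz).
apply: filterS hne => N; rewrite cmod_gt0 => fNz.
apply: le_trans (fN_jensen hf hfb mfb u0 v0 y0 K0 fNz).
have := @psum_le R _ N p1; move: (psum_ge0 (3 / 2 * beta) N).
set S := psum _ _; set C := 1 + _ => S0 SC.
rewrite lerD2l lerN2 -!mulrA !(mulrCA _ v) ler_wpM2l ?(ltW v0) //.
by apply: ler_pM => //; [rewrite addr_ge0 // ltW|lra].
Qed.

Lemma f_line_bound (y : R) : 0 < y ->
  exists2 B : R, 0 < B & forall x : R, cmod (f (x +i* y)) <= B.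
Proof.
move=> y0; exists ((Int (fun t => cmod (fb t) ^+ 2) + pi / y) / pi).
  rewrite divr_gt0 ?pi_gt0 // ltr_wpDl ?divr_gt0 ?pi_gt0 //.
  by apply: Int_ge0 => t; exact: sqr_ge0.
move=> x; have hb : 1 < 2 * beta by move: hbeta; lra.
have hc : cmod (fN beta f fb N (x +i* y)) @[N --> \oo] --> cmod (f (x +i* y)).
  by apply: cvg_cmod_cmod; exact: fN_cvg.
apply: (ler_cvg_to hc (cvg_cst _)); apply: nearW => N; exact: fN_bound.
Qed.

Lemma poisson_le x : P x <= (pi * v)^-1.
Proof.
rewrite /poisson -mulrA invfM mulrC -mulrA ler_pM2l ?invr_gt0 ?pi_gt0 //.
rewrite ler_pdivrMl ?den_gt0 ?gt_eqF // mulrDl [X in _ + X](_ : _ = v).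
  by rewrite lerDr mulr_ge0 ?sqr_ge0 // invr_ge0 ltW.
by rewrite expr2 mulfK // gt_eqF.
Qed.

Lemma logplus_bound : exists C : R, forall y : R, 0 < y ->
  L1 (fun x => P x * lam 0 (cmod (f (x ^+ 2 +i* y)))) /\
  Int (fun x => P x * lam 0 (cmod (f (x ^+ 2 +i* y)))) <= C.
Proof.
have [[h1 [M hM]] _] := hf.
exists ((pi * v)^-1 * M + 1
   + 2^-1 * (ln ((u - 0) ^+ 2 + (v + 1) ^+ 2) - ln ((u - 0) ^+ 2 + v ^+ 2))) => y y0.
have [B B0 hB] := f_line_bound y0.
pose e := Num.min 1 (B ^+ 2)^-1.
have e0 : 0 < e by rewrite lt_min ltr01 invr_gt0 exprn_gt0.
have e1 : e <= 1 by rewrite ge_min lexx.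
have eB : e <= (B ^+ 2)^-1 by rewrite ge_min lexx orbT.
pose s x := cmod (f (x ^+ 2 +i* y)).
have cs : continuous s by exact: (holomorphic_parabola_cont y0).
have [m1 m2] : L1 (fun x => `|x| * s x ^+ 2) /\ Int (fun x => `|x| * s x ^+ 2) <= M.
  apply: (@parabola_moment R (fun t => cmod (f (t +i* y)) ^+ 2)).
  - move=> t; apply: (@cvg_comp _ _ _ (fun t : R => cmod (f (t +i* y))) (fun r : R => r ^+ 2)).
      exact: (holomorphic_line_cont y0).
    exact: exprn_continuous.
  - by move=> t; exact: sqr_ge0.
  - exact: hM.
have [j1 j2] := jensen_poisson u v0 0 ltr01.
have [k1 k2] := jensen_poisson u v0 0 e0.
have pL := poisson_L1 u v0.
pose g x := (pi * v)^-1 * (`|x| * s x ^+ 2) + P x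
  + 2^-1 * (P x * ln ((x - 0) ^+ 2 + 1 ^+ 2) - P x * ln ((x - 0) ^+ 2 + e ^+ 2)).
have gL : L1 g by apply: L1D; [apply: L1D => //; exact: L1Z|apply: L1Z; exact: L1B].
have le_g x : P x * lam 0 (s x) <= g x.
  have p0 := poisson_ge0 u v0 x.
  apply: le_trans (ler_wpM2l p0 (lam0_le_moment (s x) x e0 e1)) _.
  rewrite mulrDr mulrDr /g [X in _ + X](_ : _ = 2^-1 * (P x * ln ((x - 0) ^+ 2 + 1 ^+ 2)
     - P x * ln ((x - 0) ^+ 2 + e ^+ 2))); last by ring.
  rewrite lerD2r; apply: lerD.
    by apply: ler_wpM2r (poisson_le x); rewrite mulr_ge0 ?sqr_ge0.
  apply: ler_piMr => //; apply: le_trans (ler_wpM2r (sqr_ge0 _) eB) _.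
  by rewrite ler_pdivrMl ?exprn_gt0 // mulr1 ler_pXn2r ?nnegrE ?cmod_ge0 ?(ltW B0) // hB.
have lL : L1 (fun x => P x * lam 0 (s x)).
  apply: (L1_le _ _ gL).
    apply: measurable_funM; first by apply: continuous_measurable_fun; exact: poisson_cont.
    apply: measurableT_comp (continuous_measurable_fun cs).
    by apply: continuous_measurable_fun; exact: lam_cont.
  by move=> x; rewrite ger0_norm // mulr_ge0 ?lam0_ge0 // poisson_ge0.
split=> //; apply: le_trans (Int_le lL gL le_g) _.
rewrite /g IntD; [|by apply: L1D => //; exact: L1Z|by apply: L1Z; exact: L1B].
rewrite IntD //; last exact: L1Z.
rewrite (IntZ _ m1) (IntZ _ (L1B j1 k1)) (IntB j1 k1) j2 k2 poisson_Int //.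
rewrite lerD //; first by rewrite lerD2r ler_wpM2l // invr_ge0 mulr_ge0 // ?pi_ge0 // ltW.
rewrite ler_wpM2l ?invr_ge0 // lerD2l lerN2 ler_ln ?posrE.
- by rewrite lerD2l ler_pXn2r ?nnegrE ?lerDl ?addr_ge0 ?(ltW v0) ?(ltW e0).
- by apply: den_gt0; rewrite gt_eqF.
- by apply: den_gt0; rewrite gt_eqF // addr_gt0.
Qed.

Hypothesis fz : f ((u ^+ 2 - v ^+ 2) +i* (2 * u * v)) != 0.

Lemma f_vertical_cvg :
  cmod (f ((u ^+ 2 - v ^+ 2) +i* (2 * u * v + eta_ R n))) @[n --> \oo] -->
  cmod (f ((u ^+ 2 - v ^+ 2) +i* (2 * u * v))).
Proof.
have [[h1 _] _] := hf; apply: cvg_cmod_cmod; apply: cder_vertical_cvg; apply: h1.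
by rewrite /= !mulr_gt0.
Qed.

Lemma nlam_poisson_bound : exists C : R, \forall n \near \oo, forall K : R, 0 <= K ->
  L1 (fun x => P x * nlam K (cmod (f (x ^+ 2 +i* eta_ R n)))) /\
  Int (fun x => P x * nlam K (cmod (f (x ^+ 2 +i* eta_ R n)))) <= C.
Proof.
have [C hC] := logplus_bound.
pose z0 : R[i] := (u ^+ 2 - v ^+ 2) +i* (2 * u * v).
have z00 : 0 < cmod (f z0) by rewrite cmod_gt0; exact: fz.
exists (C - (ln (cmod (f z0) / 2) - 2 * v * (1 + (3 / 2 * beta - 1)^-1))).
have lt2 : cmod (f z0) / 2 < cmod (f z0) by lra.
have h : \forall n \near \oo,
    cmod (f z0) / 2 < cmod (f ((u ^+ 2 - v ^+ 2) +i* (2 * u * v + eta_ R n))).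
  exact: (cvgr_gt _ f_vertical_cvg).
apply: filterS h => n h K K0.
have e0 := eta_gt0 R n.
have e1 : eta_ R n <= 1 by rewrite /eta_ invf_le1 // ler1n.
set z := _ +i* _ in h.
have fz' : 0 < cmod (f z) by apply: lt_trans h; rewrite divr_gt0.
have fzn : f z != 0 by rewrite -cmod_gt0.
have [l1 l2] := hC _ e0.
have [k1 k2] := f_jensen e0 e1 K0 fzn.
have e : (fun x => P x * nlam K (cmod (f (x ^+ 2 +i* eta_ R n)))) =
   fun x => P x * lam 0 (cmod (f (x ^+ 2 +i* eta_ R n))) - P x * lam K (cmod (f (x ^+ 2 +i* eta_ R n))).
  by apply/funext => x; rewrite -mulrBr.
rewrite e; split; first exact: L1B.
rewrite (IntB l1 k1); apply: lerB => //; apply: le_trans k2; rewrite lerD2r.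
by rewrite ler_ln ?posrE ?divr_gt0 // ltW.
Qed.

Lemma nlam_half_line_bound : exists C : R, \forall n \near \oo, forall K : R, 0 <= K ->
  (\int[mu]_(t in `[0%R, +oo[) (nlam K (cmod (f (t +i* eta_ R n))) * weight t)%:E <= C%:E)%E.
Proof.
have [C hC] := nlam_poisson_bound.
pose c := 2 * pi / v * (1 + u ^+ 2 + v ^+ 2).
have c0 : 0 <= c.
  by rewrite mulr_ge0 ?addr_ge0 ?sqr_ge0 // mulr_ge0 ?invr_ge0 ?(ltW v0) // mulr_ge0 ?pi_ge0.
exists (c * C); apply: filterS hC => n hC K K0.
have [l1 l2] := hC K K0.
have e0 := eta_gt0 R n.
have cn : continuous (fun t : R => nlam K (cmod (f (t +i* eta_ R n)))).
  move=> t; apply: (@cvg_comp _ _ _ (fun t : R => cmod (f (t +i* eta_ R n))) (nlam K)).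
    exact: (holomorphic_line_cont e0).
  exact: nlam_cont.
have ch : continuous (fun t : R => nlam K (cmod (f (t +i* eta_ R n))) * weight t).
  by move=> t; apply: cvgM; [exact: cn|exact: weight_cont].
apply: integral_half_line_le => //.
  by move=> t; rewrite mulr_ge0 ?nlam_ge0 // ltW // weight_gt0.
move=> m; have -> : m%:R = Num.sqrt m%:R ^+ 2 :> R by rewrite sqr_sqrtr.
rewrite integral_sqr_substitution ?sqrtr_ge0 //.
have mG : measurable_fun setT (fun x => c * (P x * nlam K (cmod (f (x ^+ 2 +i* eta_ R n))))).
  exact: L1_meas (L1Z c l1).
have G0 x : 0 <= c * (P x * nlam K (cmod (f (x ^+ 2 +i* eta_ R n)))).
  by apply: mulr_ge0 => //; apply: mulr_ge0; [exact: poisson_ge0|exact: nlam_ge0].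
apply: (@le_trans _ _ (\int[mu]_x (c * (P x * nlam K (cmod (f (x ^+ 2 +i* eta_ R n)))))%:E)%E);
  last first.
  by rewrite (Int_EFin (L1Z c l1)) lee_fin (IntZ _ l1) ler_wpM2l.
apply: (@le_trans _ _ (\int[mu]_(x in `[0%R, Num.sqrt m%:R])
    (c * (P x * nlam K (cmod (f (x ^+ 2 +i* eta_ R n)))))%:E)%E); last first.
  apply: ge0_subset_integral => //; first by apply/measurable_EFinP.
  by move=> x _; rewrite lee_fin.
apply: ge0_le_integral => //.
- move=> x /=; rewrite in_itv /= => /andP[x0 _]; rewrite lee_fin.
  by rewrite !mulr_ge0 ?nlam_ge0 // ltW // weight_gt0.
- apply/measurable_EFinP; apply: measurable_funTS; apply: continuous_measurable_fun => x.
  apply: cvgM; last by apply: cvgM; [exact: cvg_cst|exact: cvg_id].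
  apply: (@cvg_comp _ _ _ (fun x : R => x ^+ 2)
    (fun t : R => nlam K (cmod (f (t +i* eta_ R n))) * weight t)).
    exact: exprn_continuous.
  exact: ch.
- by apply/measurable_EFinP; exact: measurable_funTS.
move=> x /=; rewrite in_itv /= => /andP[x0 _]; rewrite lee_fin.
rewrite -mulrA [X in X <= _]mulrC [X in _ <= X]mulrA ler_wpM2r ?nlam_ge0 //.
exact: weight_poisson.
Qed.

Lemma nlam_boundary_bound : exists C : R, forall K : R, 0 <= K ->
  (\int[mu]_(t in `[0%R, +oo[) (nlam K (cmod (fb t)) * weight t)%:E <= C%:E)%E.
Proof.
have [C [N _ hC]] := nlam_half_line_bound.
exists C => K K0.
pose I (t : R) : R := \1_(`[0%R, +oo[) t.
have mI : measurable_fun setT I by exact: measurable_indic.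
have I0 t : 0 <= I t by rewrite /I indicE.
have e (h : R -> R) : (\int[mu]_(t in `[0%R, +oo[) (h t)%:E = \int[mu]_t (h t * I t)%:E)%E.
  rewrite [LHS]integral_mkcond; apply: eq_integral => t _.
  by rewrite patchE /I indicE; case: (t \in _); rewrite ?mulr1 ?mulr0.
have mG (h : R -> R) : measurable_fun setT h ->
    measurable_fun setT (fun t => nlam K (h t) * weight t * I t).
  move=> mh; apply: measurable_funM => //; apply: measurable_funM.
    by apply: measurableT_comp mh; apply: continuous_measurable_fun; exact: nlam_cont.
  by apply: continuous_measurable_fun; exact: weight_cont.
have G0 (s t : R) : 0 <= nlam K s * weight t * I t.
  by rewrite !mulr_ge0 ?nlam_ge0 // ltW // weight_gt0.
rewrite e; apply: (@fatou_le R
  (fun n t => nlam K (cmod (f (t +i* eta_ R (n + N)))) * weight t * I t)) => //.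
- move=> n; apply: mG; apply: continuous_measurable_fun.
  exact: (holomorphic_line_cont (eta_gt0 R _)).
- by apply: mG; exact: cmeas_cmod.
- apply: (ae_mono (boundary_seq hfb)) => t ht.
  have h1 : cmod (f (t +i* eta_ R n)) @[n --> \oo] --> cmod (fb t) by apply: cvg_cmod_cmod.
  have h2 : cmod (f (t +i* eta_ R (n + N))) @[n --> \oo] --> cmod (fb t).
    by move: h1; rewrite -(cvg_shiftn N).
  apply: cvgM; last exact: cvg_cst.
  apply: cvgM; last exact: cvg_cst.
  by apply: (@cvg_comp _ _ _ _ (nlam K) _ _ _ h2); exact: nlam_cont.
- by move=> n; rewrite -e; apply: hC => //=; exact: leq_addl.
Qed.

Lemma elog_negative_bound : exists C : R,
  (\int[mu]_(t in `]0%R, +oo[) (maxe (- (elog (cmod (fb t)) * (weight t)%:E)) 0) <= C%:E)%E.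
Proof.
have [C hC] := nlam_boundary_bound; exists C.
have mG (n : nat) : measurable_fun setT (fun t => (nlam n%:R (cmod (fb t)) * weight t)%:E).
  apply/measurable_EFinP; apply: measurable_funM.
    apply: measurableT_comp (cmeas_cmod mfb).
    by apply: continuous_measurable_fun; exact: nlam_cont.
  by apply: continuous_measurable_fun; exact: weight_cont.
have G0 (n : nat) (t : R) : 0 <= nlam n%:R (cmod (fb t)) * weight t.
  by rewrite mulr_ge0 ?nlam_ge0 // ltW // weight_gt0.
have -> : (\int[mu]_(t in `]0%R, +oo[) (maxe (- (elog (cmod (fb t)) * (weight t)%:E)) 0)
    = \int[mu]_(t in `]0%R, +oo[) limn (fun n => (nlam n%:R (cmod (fb t)) * weight t)%:E))%E.
  apply: eq_integral => t _; apply/esym/cvg_lim => //.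
  by apply: nlam_cvg; [exact: cmod_ge0|exact: weight_gt0].
have hm : {homo (fun n => \int[mu]_(t in `]0%R, +oo[) (nlam n%:R (cmod (fb t)) * weight t)%:E)%E :
    m n / (m <= n)%N >-> (m <= n)%E}.
  move=> m n mn; apply: ge0_le_integral => //.
  - by move=> t _; rewrite lee_fin.
  - exact: measurable_funTS (mG m).
  - exact: measurable_funTS (mG n).
  - move=> t _; rewrite lee_fin ler_wpM2r //; first by rewrite ltW // weight_gt0.
    by apply: nlam_mono; rewrite ler_nat.
rewrite monotone_convergence //.
- apply: lime_le; first exact: ereal_nondecreasing_is_cvgn.
  apply: nearW => n; apply: le_trans (hC n%:R (ler0n _ _)).
  apply: ge0_subset_integral => //.
  + exact: measurable_funTS (mG n).
  + by move=> t _; rewrite lee_fin.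
  + by apply: subset_itvr; rewrite bnd_simp.
- by move=> n; exact: measurable_funTS (mG n).
- by move=> n t _; rewrite lee_fin.
- move=> t _ m n mn; rewrite lee_fin ler_wpM2r //; first by rewrite ltW // weight_gt0.
  by apply: nlam_mono; rewrite ler_nat.
Qed.

End ModelSpaceLogarithm.

Theorem theorem3p1 (R : realType) (beta : R) (f : R[i] -> R[i]) (fb : R -> R[i]) :
  2%:R / 3%:R < beta ->
  model_space (blaschke beta) f ->
  (exists z : R[i], 0 < complex.Im z /\ f z != 0) ->
  boundary_value f fb -> cmeasurable fb ->
  (-oo < \int[@lebesgue_measure R]_(t in `]0%R, +oo[)
           (elog (cmod (fb t)) * ((t `^ (3%:R / 2%:R) + 1)^-1)%:E))%E.
Proof.
move=> hbeta hf [z [z0 fz]] hfb mfb.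
have [u [v [u0 v0 ez]]] := upper_half_sqrt z0.
rewrite ez in fz.
have [C hC] := elog_negative_bound hbeta hf hfb mfb u0 v0 fz.
rewrite (_ : integral _ _ _ = \int[@lebesgue_measure R]_(t in `]0%R, +oo[)
    (elog (cmod (fb t)) * (weight t)%:E))%E; last first.
  by apply: eq_integral => t; rewrite inE /= in_itv /= andbT => t0; rewrite weight_powR // ltW.
set g := fun t : R => (elog (cmod (fb t)) * (weight t)%:E)%E in hC *.
rewrite integralE; set A := integral _ _ _; set B := integral _ _ _.
have A0 : (0 <= A)%E by apply: integral_ge0 => t _; exact: funepos_ge0.
have B0 : (0 <= B)%E by apply: integral_ge0 => t _; exact: funeneg_ge0.
have BC : (B <= C%:E)%E by rewrite /B; under eq_integral do rewrite funenegE.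
have Bf : B \is a fin_num by rewrite ge0_fin_numE //; apply: le_lt_trans BC (ltry _).
rewrite -(fineK Bf); apply: (@lt_le_trans _ _ (- (fine B)%:E)%E); first exact: ltNyr.
by rewrite leeDr.
Qed.
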